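(* (i) Let $\Omega\subseteq\mathbb R^d$ be open. The space $\mathcal D'(\Omega)$ of Schwartz distributions on $\Omega$ coincides with the set of all $T\in\mathcal D^*(\Omega)$ for which there exists a sequence $(T_n)_{n\in\mathbb N}$ in $S_\Omega[\mathcal L_{loc}(\Omega)]$ such that $T_n\to T$ weakly in $\mathcal D^*(\Omega)$. (ii) For every open $\Omega\subseteq\mathbb R^d$, $\mathcal D'(\Omega)$ is a differential $\mathcal E(\Omega)$-submodule of $\mathcal D^*(\Omega)$ (i.e. an $\mathcal E(\Omega)$-submodule closed under all $\partial^\alpha$). Consequently, $\mathcal D'(\Omega)$ is a differential $\mathbb C$-vector subspace of $\mathcal D^*(\Omega)$. (iii) The family $\{\mathcal D'(\Omega)\}_{\Omega\in\mathcal T^d}$ is a subsheaf of $\{\mathcal D^*(\Omega)\}_{\Omega\in\mathcal T^d}$, as sheaves of differential $\mathcal E(\Omega)$-modules (and of $\mathbb C$-vector spaces), where $\mathcal T^d$ is the usual topology of $\mathbb R^d$. Consequently, for every distribution $T\in\mathcal D'(\Omega)$, the support of $T$ in $\mathcal D^*(\Omega)$ coincides with the usual support of $T$ in distribution theory. (iv) The inclusion $\mathcal D'\subset\mathcal D^*$ is invariant under diffeomorphisms: for all open sets $X,Y\subseteq\mathbb R^d$, every diffeomorphism $\theta:X\to Y$ and every $T\in\mathcal D'(X)$, one has $\theta_*(T)\in\mathcal D'(Y)$.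
   Context: $\mathcal E(\Omega)=\mathcal C^\infty(\Omega)$; $\mathcal D(\Omega)=\mathcal C_0^\infty(\Omega)$ is the $\mathbb C$-vector space of smooth compactly supported functions $\Omega\to\mathbb C$; $\mathcal D'(\Omega)$ is the usual space of Schwartz distributions (linear functionals on $\mathcal D(\Omega)$ continuous for the standard test-function topology); $\mathcal D^*(\Omega)$ is the algebraic dual of $\mathcal D(\Omega)$ (all linear functionals), with evaluation $\langle T,\varphi\rangle$. $\mathcal L_{loc}(\Omega)$ is the space of Lebesgue measurable, locally integrable functions $\Omega\to\mathbb C$. Operations on $\mathcal D^*(\Omega)$: for $f\in\mathcal E(\Omega)$, $\langle fT,\varphi\rangle=\langle T,f\varphi\rangle$; for a multi-index $\alpha$, $\langle\partial^\alpha T,\varphi\rangle=(-1)^{|\alpha|}\langle T,\partial^\alpha\varphi\rangle$; for open $X\subseteq\Omega$, the restriction $T{\restriction}X\in\mathcal D^*(X)$ is $\langle T{\restriction}X,\varphi\rangle=\langle T,\bar\varphi\rangle$, where $\bar\varphi$ is the extension of $\varphi\in\mathcal D(X)$ by zero to $\Omega$. Weak convergence $T_n\to T$ means $\lim_{n\to\infty}\langle T_n,\varphi\rangle=\langle T,\varphi\rangle$ in $\mathbb C$ for every $\varphi\in\mathcal D(\Omega)$. The Schwartz embedding $S_\Omega:\mathcal L_{loc}(\Omega)\to\mathcal D^*(\Omega)$ is $S_\Omega(f)=T_f$, $\langle T_f,\varphi\rangle=\int_\Omega f(x)\varphi(x)\,dx$. With these operations $\{\mathcal D^*(\Omega)\}_{\Omega\in\mathcal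 T^d}$ is a sheaf; the support of $T\in\mathcal D^*(\Omega)$ is the complement in $\Omega$ of the largest open subset of $\Omega$ on which $T$ restricts to $0$. Change of variables: for a diffeomorphism $\theta:X\to Y$ of open subsets of $\mathbb R^d$ put $J_\theta=|\det(\partial\theta/\partial x)|:X\to\mathbb R$ and define $\theta_*:\mathcal D^*(X)\to\mathcal D^*(Y)$ by $\langle\theta_*(T),\varphi\rangle=\langle T,(\varphi\circ\theta)\,J_\theta\rangle$ for all $\varphi\in\mathcal D(Y)$. *)

(* Defs.v *)
From HB Require Import structures.
From mathcomp Require Import all_boot all_order all_algebra.
From mathcomp Require Import all_classical all_reals all_analysis.
From mathcomp Require Import complex.

Set Implicit Arguments.
Unset Strict Implicit.
Unset Printing Implicit Defensive.

Import Order.TTheory GRing.Theory Num.Theory.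
Import numFieldNormedType.Exports.

Local Open Scope classical_set_scope.
Local Open Scope complex_scope.
Local Open Scope ring_scope.

Section real_smooth.
Context {R : realType} {d : nat}.
Local Notation V := 'rV[R]_d.
Implicit Types (A B : set V) (f g : V -> R) (x : V).

Definition pderiv (i : 'I_d) f : V -> R := 'D_(delta_mx 0 i) f.

(* C^oo on A: all iterated partial derivatives are (Frechet) differentiable at
   every point of A, hence continuous there.  The functions are total, but for
   A open only their values on A matter, see [smooth_local]. *)
Definition smooth_on A f :=
  forall (s : seq 'I_d) x, A x -> differentiable (foldr pderiv f s) x.

Lemma near0_differentiable f x :
  (\forall y \near x, f y = 0) -> differentiable f x.
Proof.
move=> f0; have fx0 : f x = 0 by exact: nbhs_singleton f0.
have E : f \o shift x = cst (f x) + (cst 0 : V -> R) +o_ (0 : V) id.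
  apply/eqaddoP => e e0.
  have : \forall y \near (0 : V), f (y + x) = 0.
    by move: f0; rewrite (near_shift 0) subr0.
  apply: filterS => y fy0.
  have -> : (f \o shift x - (cst (f x) + cst 0)) y = 0.
    by rewrite !fctE /= fx0 fy0 addr0 subr0.
  by rewrite normr0; apply: mulr_ge0; [exact: ltW|exact: (@normr_ge0 R V)].
have c0 : continuous (cst 0 : V -> R) by move=> ?; apply: cst_continuous.
have D : 'd f x = cst 0 :> (V -> R).
  exact: (@diff_unique R V R f (\0 : {linear V -> R}) x c0 E).
by apply/diff_locallyP; rewrite D; split.
Qed.

Lemma near_eq_differentiable f g x :
  (\forall y \near x, f y = g y) -> differentiable f x -> differentiable g x.
Proof.
move=> fg df; have -> : g = f + (g - f) by rewrite addrC subrK.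
apply: differentiableD => //; apply: near0_differentiable.
by near do (rewrite !fctE; rewrite (near fg) ?subrr//).
Unshelve. all: by end_near. Qed.

(* [smooth_on] truncated at order n, as needed for inductions. *)
Fixpoint Cn n A f : Prop :=
  (forall x, A x -> differentiable f x) /\
  (if n is n'.+1 then forall i, Cn n' A (pderiv i f) else True).

Lemma Cn_diff n A f x : Cn n A f -> A x -> differentiable f x.
Proof. by case: n => [|n] /= [H _]; exact: H. Qed.

Lemma CnS n A f : Cn n.+1 A f -> Cn n A f.
Proof.
elim: n f => [|n IH] f; first by move=> /= [].
by move=> [Df Hf]; split=> // i; exact: IH (Hf i).
Qed.

Lemma smooth_onP A f : smooth_on A f <-> forall n, Cn n A f.
Proof.
split.
  move=> H n; elim: n f H => [|n IH] f H /=; split=> //.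
  - exact: (H [::]).
  - exact: (H [::]).
  - by move=> i; apply: IH => s x Ax; rewrite -foldr_rcons; exact: H.
move=> H s; elim/last_ind: s f H => [|s i IH] f H x Ax.
  exact: (Cn_diff (H 0%N)).
by rewrite foldr_rcons; apply: IH => // n; have [_] := H n.+1; apply.
Qed.

Lemma near_open A f g x : open A -> {in A, f =1 g} -> A x ->
  \forall y \near x, f y = g y.
Proof.
move=> oA fg Ax; apply: filterS (open_nbhs_nbhs (conj oA Ax)) => y Ay.
exact/fg/mem_set.
Qed.

Lemma pderiv_local A f g i : open A -> {in A, f =1 g} ->
  {in A, pderiv i f =1 pderiv i g}.
Proof.
by move=> oA fg x /set_mem Ax; apply: near_eq_derive; exact: near_open Ax.
Qed.

Lemma Cn_local n A f g : open A -> {in A, f =1 g} -> Cn n A f -> Cn n A g.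
Proof.
move=> oA; elim: n f g => [|n IH] f g fg [Df Hf]; split=> //.
1,2: move=> x Ax; apply: (near_eq_differentiable _ (Df _ Ax)).
1,2: exact: near_open Ax.
by move=> i; apply: IH (Hf i); exact: pderiv_local.
Qed.

Lemma Cn_cst n A c : Cn n A (fun=> c).
Proof.
elim: n c => [|n IH] c /=; split=> //.
move=> i; suff -> : pderiv i (fun=> c) = fun=> 0 by [].
by apply/funext => x; exact: derive_cst.
Qed.

Lemma pderivD i f g x : differentiable f x -> differentiable g x ->
  pderiv i (f \+ g) x = pderiv i f x + pderiv i g x.
Proof. by move=> df dg; apply: deriveD; exact: diff_derivable. Qed.

Lemma pderivM i f g x : differentiable f x -> differentiable g x ->
  pderiv i (f \* g) x = f x * pderiv i g x + g x * pderiv i f x.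
Proof. by move=> df dg; apply: deriveM; exact: diff_derivable. Qed.

Lemma CnD n A f g : open A -> Cn n A f -> Cn n A g -> Cn n A (f \+ g).
Proof.
move=> oA; elim: n f g => [|n IH] f g [Df Hf] [Dg Hg]; split=> //.
1,2: by move=> x Ax; apply: (@differentiableD _ _ _ f g); auto.
move=> i; apply: (@Cn_local _ _ (pderiv i f \+ pderiv i g)) => //.
  by move=> x /set_mem Ax; rewrite pderivD; auto.
exact: IH (Hf i) (Hg i).
Qed.

Lemma CnM n A f g : open A -> Cn n A f -> Cn n A g -> Cn n A (f \* g).
Proof.
move=> oA; elim: n f g => [|n IH] f g Cf Cg; split=> //.
1,2: move=> x Ax; apply: (@differentiableM _ _ f g); first exact: Cn_diff Cf Ax.
1,2: exact: Cn_diff Cg Ax.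
move=> i.
apply: (@Cn_local _ _ ((f \* pderiv i g) \+ (g \* pderiv i f))) => //.
  move=> x /set_mem Ax; rewrite pderivM//; first exact: Cn_diff Cf Ax.
  exact: Cn_diff Cg Ax.
have [[_ Hf] [_ Hg]] := (Cf, Cg).
by apply: CnD => //; apply: IH; [exact: CnS|exact: Hg|exact: CnS|exact: Hf].
Qed.

Lemma Cn_sum n A I (r : seq I) (F : I -> V -> R) : open A ->
  (forall i, Cn n A (F i)) -> Cn n A (fun x => \sum_(i <- r) F i x).
Proof.
move=> oA H; elim: r => [|i r IH].
  by under eq_fun do rewrite big_nil; exact: Cn_cst.
by under eq_fun do rewrite big_cons; exact: CnD.
Qed.

Lemma Cn_prod n A I (r : seq I) (F : I -> V -> R) : open A ->
  (forall i, Cn n A (F i)) -> Cn n A (fun x => \prod_(i <- r) F i x).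
Proof.
move=> oA H; elim: r => [|i r IH].
  by under eq_fun do rewrite big_nil; exact: Cn_cst.
by under eq_fun do rewrite big_cons; exact: CnM.
Qed.

Lemma smoothD A f g : open A ->
  smooth_on A f -> smooth_on A g -> smooth_on A (f \+ g).
Proof. by move=> oA /smooth_onP F /smooth_onP G; apply/smooth_onP => n; exact: CnD. Qed.

Lemma smoothM A f g : open A ->
  smooth_on A f -> smooth_on A g -> smooth_on A (f \* g).
Proof. by move=> oA /smooth_onP F /smooth_onP G; apply/smooth_onP => n; exact: CnM. Qed.

Lemma smooth_cst A c : smooth_on A (fun=> c).
Proof. by apply/smooth_onP => n; exact: Cn_cst. Qed.

Lemma smooth_pderiv A f i : smooth_on A f -> smooth_on A (pderiv i f).
Proof. by move=> /smooth_onP F; apply/smooth_onP => n; have [_] := F n.+1; apply. Qed.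

Lemma smooth_local A f g : open A -> {in A, f =1 g} ->
  smooth_on A f -> smooth_on A g.
Proof. by move=> oA fg /smooth_onP F; apply/smooth_onP => n; exact: Cn_local (F n). Qed.

Lemma smooth_setU A B f : smooth_on A f -> smooth_on B f ->
  smooth_on (A `|` B) f.
Proof. by move=> FA FB s x [Ax|Bx]; [exact: FA|exact: FB]. Qed.

Lemma smooth_sub A B f : A `<=` B -> smooth_on B f -> smooth_on A f.
Proof. by move=> AB FB s x /AB; exact: FB. Qed.

End real_smooth.

Section real_smooth_comp.
Context {R : realType} {d : nat}.
Local Notation V := 'rV[R]_d.
Implicit Types (A B : set V) (f g : V -> R) (x : V) (theta : V -> V).

Definition coordf theta (j : 'I_d) : V -> R := fun x => theta x 0 j.

Lemma row_differentiable theta x :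
  (forall j, differentiable (coordf theta j) x) -> differentiable theta x.
Proof.
move=> D; rewrite (_ : theta = \sum_(j < d) (fun y => coordf theta j y *: (delta_mx 0 j : V))).
  by apply: differentiable_sum => j; exact: differentiableZl.
by apply/funext => y; rewrite fct_sumE; exact: row_sum_delta.
Qed.

Lemma diff_coordf theta x j v : differentiable theta x ->
  'd (coordf theta j) x v = ('d theta x v) 0 j.
Proof.
move=> D; pose c := fun N : V => N 0 j : R.
have dc y : differentiable c y by exact: differentiable_coord.
have [l lE] : exists l : {linear V -> R}, c = l.
  have @l : {linear V -> R}.
    by exists c; do 2![eexists]; do ?[constructor];
       rewrite /c ?mxE// => ? *; rewrite ?mxE//; move=> ?; rewrite !mxE.
  by exists l.
rewrite (_ : coordf theta j = c \o theta)// diff_comp//= lE diff_lin -?lE//.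
exact: coord_continuous.
Qed.

Lemma pderiv_comp i f theta x : differentiable f (theta x) ->
  (forall j, differentiable (coordf theta j) x) ->
  pderiv i (f \o theta) x =
  \sum_(j < d) pderiv j f (theta x) * pderiv i (coordf theta j) x.
Proof.
move=> Df Dt; have DT := row_differentiable Dt.
rewrite [LHS]deriveE; last exact: differentiable_comp.
rewrite diff_comp//= [in LHS](row_sum_delta ('d theta x (delta_mx 0 i))).
rewrite linear_sum; apply: eq_bigr => j _.
rewrite linearZ.
have -> : pderiv j f (theta x) = 'd f (theta x) (delta_mx 0 j).
  exact: deriveE.
have -> : pderiv i (coordf theta j) x = ('d theta x (delta_mx 0 i)) 0 j.
  by rewrite [LHS]deriveE// diff_coordf.
exact: mulrC.
Qed.

Lemma Cn_comp n A B f theta : open A -> (forall x, A x -> B (theta x)) ->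
  (forall m, Cn m B f) -> (forall m j, Cn m A (coordf theta j)) ->
  Cn n A (f \o theta).
Proof.
move=> oA AB + Ct; elim: n f => [|n IH] f Cf; split=> //.
1,2: move=> x Ax; apply: differentiable_comp; last exact: (Cn_diff (Cf 0%N) (AB _ Ax)).
1,2: by apply: row_differentiable => j; exact: (Cn_diff (Ct 0%N j)).
move=> i; apply: (@Cn_local _ _ _ _
  (fun x => \sum_(j < d) ((pderiv j f \o theta) \* pderiv i (coordf theta j)) x)) => //.
  move=> x /set_mem Ax; rewrite pderiv_comp//; first exact: (Cn_diff (Cf 0%N) (AB _ Ax)).
  by move=> j; exact: (Cn_diff (Ct 0%N j)).
apply: Cn_sum => // j; apply: CnM => //.
  by apply: IH => m; have [_] := Cf m.+1; apply.
by have [_] := Ct n.+1 j; apply.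
Qed.

Lemma smooth_comp A B f theta : open A -> (forall x, A x -> B (theta x)) ->
  smooth_on B f -> (forall j, smooth_on A (coordf theta j)) ->
  smooth_on A (f \o theta).
Proof.
move=> oA AB /smooth_onP F H; apply/smooth_onP => n; apply: Cn_comp AB F _ => //.
by move=> m j; have /smooth_onP := H j.
Qed.

Definition jacobian_matrix theta x : 'M[R]_d :=
  \matrix_(i, j) pderiv j (coordf theta i) x.

Lemma smooth_det A theta : open A -> (forall j, smooth_on A (coordf theta j)) ->
  smooth_on A (fun x => \det (jacobian_matrix theta x)).
Proof.
move=> oA H; apply/smooth_onP => n; rewrite /determinant.
apply: Cn_sum => // s; apply: (CnM oA (Cn_cst _ _ _)).
apply: Cn_prod => // i.
suff E k : Cn n A (fun x => jacobian_matrix theta x i k) by exact: E.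
rewrite [X in Cn _ _ X](_ : _ = pderiv k (coordf theta i)); last first.
  by apply/funext => x; rewrite mxE.
by have /smooth_onP := smooth_pderiv k (H i).
Qed.

Lemma smooth_normr A f : open A -> (forall x, A x -> f x != 0) ->
  smooth_on A f -> smooth_on A (fun x => `|f x|).
Proof.
move=> oA f0 F.
have sgE x : A x -> \forall y \near x, Num.sg (f y) = Num.sg (f x).
  move=> Ax; have cf : f @ x --> f x by exact/differentiable_continuous/(F [::]).
  have := f0 _ Ax; rewrite neq_lt => /orP[n0|p0].
    have : \forall y \near x, f y < 0 by apply: (@cvgr_lt R V (nbhs x) _ f (f x) cf 0 n0).
    by apply: filterS => y y0; rewrite !ltr0_sg.
  have : \forall y \near x, 0 < f y by apply: (@cvgr_gt R V (nbhs x) _ f (f x) cf 0 p0).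
  by apply: filterS => y y0; rewrite !gtr0_sg.
apply: (@smooth_local _ _ _ ((fun x => Num.sg (f x)) \* f)) => //.
  by move=> x _ /=; rewrite [RHS]normrEsg.
apply: smoothM => //; apply/smooth_onP => n.
have D x : A x -> differentiable (fun x => Num.sg (f x)) x.
  move=> Ax; apply: (near_eq_differentiable (f := cst (Num.sg (f x)))).
    by apply: filterS (sgE _ Ax) => y ->.
  exact: differentiable_cst.
case: n => [|n]; split=> // i.
apply: (@Cn_local _ _ _ _ (fun=> 0)) => //; last exact: Cn_cst.
move=> x /set_mem Ax; rewrite /pderiv.
rewrite (near_eq_derive _ (g := cst (Num.sg (f x)))) ?derive_cst//.
exact: sgE.
Qed.

End real_smooth_comp.

Section complex_smooth.
Context {R : realType} {d : nat}.
Local Notation C := R[i].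
Local Notation V := 'rV[R]_d.
Local Notation Re := complex.Re.
Local Notation Im := complex.Im.
Implicit Types (A B : set V) (f g : V -> C) (x : V).

(* R[i] carries no structure of normed space over R, so that calculus on
   C-valued functions of real variables goes through real and imaginary parts. *)
Definition Csmooth_on A f :=
  smooth_on A (fun x => Re (f x)) /\ smooth_on A (fun x => Im (f x)).

Definition Cpderiv (i : 'I_d) f : V -> C :=
  fun x => pderiv i (fun y => Re (f y)) x +i* pderiv i (fun y => Im (f y)) x.

(* For al = (al_0, ..., al_{d-1}), the list with al_i copies of i, so that
   [Cpartial al] is d_0^al_0 ... d_{d-1}^al_{d-1}. *)
Definition midx_seq (al : 'I_d -> nat) : seq 'I_d :=
  flatten [seq nseq (al i) i | i <- enum 'I_d].

Definition midx_deg (al : 'I_d -> nat) : nat := \sum_i al i.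

Definition Cpartial (al : 'I_d -> nat) f : V -> C := foldr Cpderiv f (midx_seq al).

Definition support_set f : set V := closure [set x | f x != 0].

Lemma CReM (a b : C) : Re (a * b) = Re a * Re b - Im a * Im b.
Proof. by case: a b => [? ?] []. Qed.

Lemma CImM (a b : C) : Im (a * b) = Re a * Im b + Im a * Re b.
Proof. by case: a b => [? ?] []. Qed.

Lemma CReD (a b : C) : Re (a + b) = Re a + Re b.
Proof. by case: a b => [? ?] []. Qed.

Lemma CImD (a b : C) : Im (a + b) = Im a + Im b.
Proof. by case: a b => [? ?] []. Qed.

Lemma Csmooth_cst A c : Csmooth_on A (fun=> c).
Proof. by split; exact: smooth_cst. Qed.

Lemma Csmooth_local A f g : open A -> {in A, f =1 g} ->
  Csmooth_on A f -> Csmooth_on A g.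
Proof.
by move=> oA fg [Fr Fi]; split;
  [apply: smooth_local Fr|apply: smooth_local Fi] => // x Ax; rewrite fg.
Qed.

Lemma Csmooth_sub A B f : A `<=` B -> Csmooth_on B f -> Csmooth_on A f.
Proof. by move=> AB [? ?]; split; exact: smooth_sub AB _. Qed.

Lemma Csmooth_setU A B f : Csmooth_on A f -> Csmooth_on B f ->
  Csmooth_on (A `|` B) f.
Proof. by move=> [? ?] [? ?]; split; exact: smooth_setU. Qed.

Lemma CsmoothD A f g : open A ->
  Csmooth_on A f -> Csmooth_on A g -> Csmooth_on A (fun x => f x + g x).
Proof.
move=> oA [Fr Fi] [Gr Gi]; split.
  by under eq_fun do rewrite CReD; exact: smoothD.
by under eq_fun do rewrite CImD; exact: smoothD.
Qed.

Lemma smoothN A (f : V -> R) : open A -> smooth_on A f -> smooth_on A (fun x => - f x).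
Proof.
move=> oA F; under eq_fun do rewrite -mulN1r.
by apply: smoothM => //; exact: smooth_cst.
Qed.

Lemma CsmoothM A f g : open A ->
  Csmooth_on A f -> Csmooth_on A g -> Csmooth_on A (fun x => f x * g x).
Proof.
move=> oA [Fr Fi] [Gr Gi]; split.
  under eq_fun do rewrite CReM.
  by apply: smoothD => //; [|apply: smoothN => //]; exact: smoothM.
by under eq_fun do rewrite CImM; apply: smoothD => //; exact: smoothM.
Qed.

Lemma Csmooth_pderiv A i f : Csmooth_on A f -> Csmooth_on A (Cpderiv i f).
Proof. by move=> [? ?]; split; exact: smooth_pderiv. Qed.

Lemma Csmooth_foldr A s f : Csmooth_on A f -> Csmooth_on A (foldr Cpderiv f s).
Proof. by move=> F; elim: s => //= i s; exact: Csmooth_pderiv. Qed.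

Lemma Csmooth_zero_setC A f : closed A -> (forall x, ~ A x -> f x = 0) ->
  Csmooth_on (~` A) f.
Proof.
move=> cA f0; apply: (@Csmooth_local _ (fun=> 0)); last exact: Csmooth_cst.
  exact: closed_openC.
by move=> x /set_mem /f0 ->.
Qed.

Lemma pderiv_lin3 i (a b : R) (u v w : V -> R) x :
  differentiable u x -> differentiable v x -> differentiable w x ->
  pderiv i (fun y => a * u y + b * v y + w y) x =
  a * pderiv i u x + b * pderiv i v x + pderiv i w x.
Proof.
move=> Du Dv Dw.
have Dm (c : R) (h : V -> R) : differentiable h x -> differentiable ((fun=> c) \* h) x.
  by move=> Dh; exact: (@differentiableM _ _ (cst c) h).
have E (c : R) (h : V -> R) : differentiable h x ->
    pderiv i ((fun=> c) \* h) x = c * pderiv i h x.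
  move=> Dh; rewrite pderivM//.
  by rewrite [pderiv i (fun=> c) x]derive_cst mulr0 addr0.
have D1 : differentiable (((fun=> a) \* u) \+ ((fun=> b) \* v)) x.
  by apply: (@differentiableD _ _ _ ((fun=> a) \* u) ((fun=> b) \* v)); exact: Dm.
rewrite [LHS](pderivD i D1 Dw).
by rewrite (pderivD i (Dm a u Du) (Dm b v Dv)) !E.
Qed.

Lemma Cpderiv_lin i (c : C) f g : Csmooth_on setT f -> Csmooth_on setT g ->
  Cpderiv i (fun x => c * f x + g x) = (fun x => c * Cpderiv i f x + Cpderiv i g x).
Proof.
move=> [Fr Fi] [Gr Gi]; apply/funext => x.
have [fr fi gr gi] := And4 (Fr [::] x I) (Fi [::] x I) (Gr [::] x I) (Gi [::] x I).
rewrite /Cpderiv; case: c => a b; apply/eqP; rewrite eq_complex /=; apply/andP; split.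
  apply/eqP; under eq_fun do rewrite CReD CReM /= -mulNr.
  by rewrite pderiv_lin3// mulNr.
apply/eqP; under eq_fun do rewrite CImD CImM /=.
by rewrite pderiv_lin3.
Qed.

Lemma Cfoldr_lin s (c : C) f g : Csmooth_on setT f -> Csmooth_on setT g ->
  foldr Cpderiv (fun x => c * f x + g x) s =
  (fun x => c * foldr Cpderiv f s x + foldr Cpderiv g s x).
Proof.
move=> F G; elim: s => //= i s ->.
by rewrite Cpderiv_lin//; exact: Csmooth_foldr.
Qed.

Lemma Cpderiv_support i f : support_set (Cpderiv i f) `<=` support_set f.
Proof.
rewrite /support_set [X in _ `<=` X](_ : _ = closure (closure [set x | f x != 0])); last first.
  by rewrite -(closure_id (closure _)).1//; exact: closed_closure.
apply: closureS => x /=; apply: contraPP => /= Nx.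
have oN : open (~` support_set f) by exact/closed_openC/closed_closure.
have fz y : ~ support_set f y -> f y = 0.
  by move=> Ny; apply/eqP; apply/negPn/negP => fy; apply: Ny; exact: subset_closure.
have z (h : C -> R) : h 0 = 0 -> pderiv i (fun y => h (f y)) x = 0.
  move=> h0; rewrite (@pderiv_local _ _ _ _ (fun=> 0) _ oN) ?inE//.
    exact: derive_cst.
  by move=> y /set_mem /fz ->.
by rewrite /Cpderiv !z// eqxx.
Qed.

Lemma foldr_support s f : support_set (foldr Cpderiv f s) `<=` support_set f.
Proof.
by elim: s => [//|i s IH]; apply: subset_trans IH; exact: Cpderiv_support.
Qed.

End complex_smooth.

Record opens (R : realType) (d : nat) := Opens {
  oset :> set 'rV[R]_d ;
  oset_open : open oset }.

Program Definition opensI (R : realType) (d : nat) (X Y : opens R d) : opens R d :=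
  @Opens R d (X `&` Y) _.
Next Obligation. by move=> R d X Y; apply: openI; exact: oset_open. Qed.

(* E(Om), by total functions whose values outside of Om are irrelevant. *)
Record smoothfun (R : realType) (d : nat) (Om : opens R d) := Smoothfun {
  sfun :> 'rV[R]_d -> R[i] ;
  sfunP : Csmooth_on Om sfun }.

Section test_functions.
Context {R : realType} {d : nat}.
Local Notation C := R[i].
Local Notation V := 'rV[R]_d.
Implicit Types (Om X Y : opens R d).

Definition is_test (A : set V) : {pred V -> C^o} := [pred f : V -> C^o |
  `[< [/\ Csmooth_on setT f, compact (support_set f) & support_set f `<=` A] >]].

Lemma is_testP (A : set V) (f : V -> C) : reflect
  [/\ Csmooth_on setT f, compact (support_set f) & support_set f `<=` A]
  ((f : V -> C^o) \in is_test A).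
Proof. by apply: (iffP idP) => [/asboolP//|H]; exact/asboolP. Qed.

Lemma is_test_sub (A B : set V) : A `<=` B -> {subset is_test A <= is_test B}.
Proof.
move=> AB f /is_testP[? ? fA]; apply/is_testP; split=> //.
exact: subset_trans AB.
Qed.

Lemma support_compact (f : V -> C) (K : set V) :
  compact K -> (forall x, ~ K x -> f x = 0) ->
  compact (support_set f) /\ support_set f `<=` K.
Proof.
move=> cK f0; have clK : closed K by apply: compact_closed => //; exact: norm_hausdorff.
suff sK : support_set f `<=` K.
  by split=> //; apply: subclosed_compact sK => //; exact: closed_closure.
rewrite (closure_id K).1//; apply: closureS => x /= fx.
by apply: contrapT => /f0 fx0; rewrite fx0 eqxx in fx.
Qed.

Lemma support0 (f : V -> C) x : ~ support_set f x -> f x = 0.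
Proof.
by move=> Nx; apply/eqP/negPn/negP => fx; apply: Nx; exact: subset_closure.
Qed.

Lemma is_test_submod_closed (A : set V) : submod_closed (is_test A).
Proof.
split.
  have [//|c0 s0] := @support_compact (fun=> 0) set0 (@compact0 _).
  apply/is_testP; split; [exact: Csmooth_cst|exact: c0|].
  by apply: subset_trans (sub0set _).
move=> c f g /is_testP[Sf cf fA] /is_testP[Sg cg gA].
have [|cs ss] := @support_compact (fun x => c * f x + g x)
  (support_set f `|` support_set g) (compactU cf cg).
  by move=> x /not_orP[/support0 -> /support0 ->]; rewrite mulr0 addr0.
apply/is_testP; split.
- apply: CsmoothD Sg; first exact: openT.
  by apply: CsmoothM Sf; [exact: openT|exact: Csmooth_cst].
- exact: cs.
- by apply: subset_trans ss _; rewrite subUset.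
Qed.

HB.instance Definition _ (A : set V) :=
  GRing.isSubmodClosed.Build _ _ (is_test A) (is_test_submod_closed A).

(* D(Om): a compactly supported smooth function on the open set Om is
   represented by its extension by zero, which is smooth on the whole space. *)
Record test Om := Test { tfun :> V -> C^o ; tfunP : tfun \in is_test Om }.

HB.instance Definition _ Om := [isSub for @tfun Om].
HB.instance Definition _ Om := [Choice of test Om by <:].
HB.instance Definition _ Om := [SubChoice_isSubLmodule of test Om by <:].

End test_functions.


(* D^*(Om), the algebraic dual; R[i]^o is R[i] with its usual topology.
   Elements of D^*(Om) are compared pointwise, with [=1]. *)
Notation Dstar Om := {linear test Om -> (complex _)^o}.

Section operators.
Context {R : realType} {d : nat}.
Local Notation C := R[i].
Local Notation V := 'rV[R]_d.
Implicit Types (Om X Y : opens R d).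

Lemma test_linE Om (a : C) (u v : test Om) x : (a *: u + v) x = a * u x + v x :> C.
Proof. by []. Qed.

Lemma testP Om (u v : test Om) : (forall x, u x = v x) -> u = v.
Proof. by move=> uv; apply/val_inj/funext. Qed.

Lemma tpartial_subproof Om al (phi : test Om) :
  (Cpartial al phi : V -> C^o) \in is_test Om.
Proof.
have /is_testP[S K KO] := tfunP phi; apply/is_testP; split.
- exact: Csmooth_foldr.
- by apply: subclosed_compact K _; [exact: closed_closure|exact: foldr_support].
- by apply: subset_trans KO; exact: foldr_support.
Qed.

Definition tpartial Om al (phi : test Om) : test Om := Test (tpartial_subproof al phi).

Lemma tpartial_linear Om al : linear (@tpartial Om al).
Proof.
move=> a u v; apply: testP => x.
have /is_testP[Su _ _] := tfunP u; have /is_testP[Sv _ _] := tfunP v.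
by rewrite test_linE /= [LHS](congr1 (fun f => f x) (Cfoldr_lin _ a Su Sv)).
Qed.

HB.instance Definition _ Om al :=
  GRing.isLinear.Build C (test Om) (test Om) *:%R (@tpartial Om al) (tpartial_linear al).

Lemma tmul_subproof Om (f : smoothfun Om) (phi : test Om) :
  ((fun x => f x * phi x : C) : V -> C^o) \in is_test Om.
Proof.
have /is_testP[S K KO] := tfunP phi.
have [|c s] := @support_compact _ _ (fun x => f x * phi x) _ K.
  by move=> x /support0 ->; rewrite mulr0.
apply/is_testP; split => //; last exact: subset_trans KO.
rewrite (_ : setT = Om `|` ~` support_set phi); last first.
  apply/esym/seteqP; split=> // x _.
  by have [/KO|] := pselect (support_set phi x); [left|right].
apply: Csmooth_setU.
  apply: CsmoothM; [exact: oset_open|exact: sfunP|].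
  by apply: Csmooth_sub S.
apply: Csmooth_zero_setC => [|x /support0 ->]; last by rewrite mulr0.
exact: closed_closure.
Qed.

Definition tmul Om (f : smoothfun Om) (phi : test Om) : test Om :=
  Test (tmul_subproof f phi).

Lemma tmul_linear Om (f : smoothfun Om) : linear (tmul f).
Proof.
by move=> a u v; apply: testP => x; rewrite !test_linE /= mulrDr mulrCA.
Qed.

HB.instance Definition _ Om (f : smoothfun Om) :=
  GRing.isLinear.Build C (test Om) (test Om) *:%R (tmul f) (tmul_linear f).

(* The extension by zero D(X) -> D(Om) leaves the underlying function as is. *)
Definition text X Om (XO : X `<=` Om) (phi : test X) : test Om :=
  Test (is_test_sub XO (tfunP phi)).

Lemma text_linear X Om (XO : X `<=` Om) : linear (text XO).
Proof. by move=> a u v; exact: testP. Qed.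

HB.instance Definition _ X Om (XO : X `<=` Om) :=
  GRing.isLinear.Build C (test X) (test Om) *:%R (text XO) (text_linear XO).

Definition dzero Om : Dstar Om := \0.
Definition dadd Om (S T : Dstar Om) : Dstar Om := S \+ T.
Definition dscale Om (c : C) (T : Dstar Om) : Dstar Om := c \*: T.
Definition dmul Om (f : smoothfun Om) (T : Dstar Om) : Dstar Om := T \o tmul f.
Definition dpartial Om al (T : Dstar Om) : Dstar Om :=
  ((-1) ^+ midx_deg al : C) \*: (T \o tpartial al).
Definition restr X Om (XO : X `<=` Om) (T : Dstar Om) : Dstar X := T \o text XO.

End operators.

Lemma half_scale (K : numFieldType) (U : lmodType K) (u : U) :
  2^-1 *: (u + u) = u.
Proof. by rewrite -mulr2n -(scaler_nat 2 u) scalerA mulVf ?pnatr_eq0// scale1r. Qed.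

Lemma half_norm (K : numFieldType) : `|2^-1 : K| + `|2^-1 : K| <= 1.
Proof.
by rewrite ger0_norm ?invr_ge0 ?ler0n// -mulr2n -(mulr_natr 2^-1 2) mulVf ?pnatr_eq0.
Qed.

Section test_topology.
Context {R : realType} {d : nat}.
Local Notation C := R[i].
Local Notation V := 'rV[R]_d.
Variable Om : opens R d.

Definition absolutely_convex (W : set (test Om)) :=
  forall (a b : C) phi psi, `|a| + `|b| <= 1 -> W phi -> W psi ->
    W (a *: phi + b *: psi).

(* For K compact in Om, W meets D_K, the subspace of the functions supported in
   K, in a neighborhood of 0 for the topology of D_K, i.e., for the uniform
   convergence of all derivatives. *)
Definition nbhs0_on (K : set V) (W : set (test Om)) :=
  exists (m : nat) (e : R), 0 < e /\
    forall phi : test Om, support_set phi `<=` K ->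
      (forall al, (midx_deg al <= m)%N -> forall x, `|tpartial al phi x : C| < e%:C) ->
      W phi.

(* Neighborhood base at 0 for the LF topology of D(Om), which is the finest
   locally convex topology making all the inclusions D_K -> D(Om) continuous. *)
Definition test_base (W : set (test Om)) :=
  absolutely_convex W /\
  forall K : set V, compact K -> K `<=` Om -> nbhs0_on K W.

Definition test_nbhs (phi : test Om) : set_system (test Om) :=
  [set U | exists2 W, test_base W & forall psi, W (psi - phi) -> U psi].

Lemma test_base0 W : test_base W -> W 0.
Proof.
move=> [_ nW]; have [m [e [e0 H]]] := nW set0 (@compact0 _) (sub0set _).
apply: H => [|al _ x].
  have [//|_] := @support_compact _ _ (0 : test Om) set0 (@compact0 _).
  exact: subset_trans.
by rewrite linear0 normr0 ltcR.
Qed.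

Lemma test_baseI W1 W2 : test_base W1 -> test_base W2 -> test_base (W1 `&` W2).
Proof.
move=> [c1 n1] [c2 n2]; split.
  by move=> a b p q ab [? ?] [? ?]; split; [exact: c1|exact: c2].
move=> K cK KO.
have [m1 [e1 [e10 H1]]] := n1 K cK KO; have [m2 [e2 [e20 H2]]] := n2 K cK KO.
exists (maxn m1 m2), (Num.min e1 e2); split; first by rewrite lt_min e10.
move=> phi sK H; split; [apply: H1 => //|apply: H2 => //] => al am x.
  apply: lt_le_trans (H al _ x) _; first by rewrite leq_max am.
  by rewrite lecR ge_min lexx.
apply: lt_le_trans (H al _ x) _; first by rewrite leq_max am orbT.
by rewrite lecR ge_min lexx orbT.
Qed.

Lemma test_base_half W : test_base W -> test_base [set chi | W (chi + chi)].
Proof.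
move=> [cW nW]; split.
  move=> a b p q ab /= Wp Wq; rewrite addrACA -!scalerDr; exact: cW.
move=> K cK KO; have [m [e [e0 H]]] := nW K cK KO.
exists m, (e / 2); split; first by rewrite divr_gt0.
move=> phi sK Hphi; apply: H.
  have /is_testP[_ K' _] := tfunP phi.
  have [|_ s] := @support_compact _ _ (phi + phi : test Om) _ K'.
    by move=> x /support0 px; rewrite -[LHS]/(phi x + phi x : C) px addr0.
  exact: subset_trans s _.
move=> al am x; rewrite linearD -[X in `|X|]/(tpartial al phi x + tpartial al phi x : C).
apply: le_lt_trans (ler_normD _ _) _.
by rewrite [e in ltRHS]splitr rmorphD /=; apply: ltrD; exact: Hphi.
Qed.

Let test_nbhs_filter phi : ProperFilter (test_nbhs phi).
Proof.
split.
  by move=> [W /test_base0 W0 /(_ phi)]; apply; rewrite subrr.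
split.
- exists setT => //; split=> // K cK KO.
  by exists 0%N, 1.
- move=> A B [W1 b1 H1] [W2 b2 H2]; exists (W1 `&` W2); first exact: test_baseI.
  by move=> psi [w1 w2]; split; [exact: H1|exact: H2].
- by move=> A B AB [W b H]; exists W => // psi /H /AB.
Qed.

Let test_nbhs_singleton phi (A : set (test Om)) : test_nbhs phi A -> A phi.
Proof. by move=> [W /test_base0 W0]; apply; rewrite subrr. Qed.

Let test_nbhs_nbhs phi (A : set (test Om)) :
  test_nbhs phi A -> test_nbhs phi (test_nbhs^~ A).
Proof.
move=> [W b H]; exists [set chi | W (chi + chi)]; first exact: test_base_half.
move=> psi Wpsi; exists [set chi | W (chi + chi)]; first exact: test_base_half.
move=> eta Weta; apply: H.
have -> : eta - phi = 2^-1 *: ((eta - psi) + (eta - psi)) +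
    2^-1 *: ((psi - phi) + (psi - phi)).
  by rewrite !half_scale addrA subrK.
by apply: b.1 => //; exact: half_norm.
Qed.

HB.instance Definition _ := hasNbhs.Build (test Om) test_nbhs.
HB.instance Definition _ := Nbhs_isNbhsTopological.Build (test Om)
  test_nbhs_filter test_nbhs_singleton test_nbhs_nbhs.

Definition Dprime : set (Dstar Om) := [set T : Dstar Om | continuous T].

End test_topology.

Arguments Dprime {R d} Om.


(* C^oo diffeomorphisms X -> Y, together with their inverse; both maps are
   total functions whose values outside of X, resp. Y, are irrelevant. *)
Record diffeo (R : realType) (d : nat) (X Y : opens R d) := Diffeo {
  diffeo_fun :> 'rV[R]_d -> 'rV[R]_d ;
  diffeo_inv : 'rV[R]_d -> 'rV[R]_d ;
  diffeo_smooth : forall j, smooth_on X (coordf diffeo_fun j) ;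
  diffeo_inv_smooth : forall j, smooth_on Y (coordf diffeo_inv j) ;
  diffeo_to : forall x, oset X x -> oset Y (diffeo_fun x) ;
  diffeo_inv_to : forall y, oset Y y -> oset X (diffeo_inv y) ;
  diffeoK : forall x, oset X x -> diffeo_inv (diffeo_fun x) = x ;
  diffeo_invK : forall y, oset Y y -> diffeo_fun (diffeo_inv y) = y }.

Section change_of_variables.
Context {R : realType} {d : nat} {X Y : opens R d}.
Local Notation C := R[i].
Local Notation V := 'rV[R]_d.
Variable theta : diffeo X Y.

Definition jac (x : V) : R := `|\det (jacobian_matrix theta x)|.

Lemma det_jacobian_neq0 x : oset X x -> \det (jacobian_matrix theta x) != 0.
Proof.
move=> Xx; set eta := diffeo_inv theta.
have Dt j : differentiable (coordf theta j) x by exact: (diffeo_smooth theta j [::]).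
have De i : differentiable (coordf eta i) (theta x).
  by apply: (diffeo_inv_smooth theta i [::]); exact: diffeo_to.
suff E : jacobian_matrix eta (theta x) *m jacobian_matrix theta x = 1%:M.
  apply/eqP => d0; have := congr1 (fun M => \det M) E.
  by rewrite det_mulmx d0 mulr0 det1 => /eqP; rewrite eq_sym oner_eq0.
apply/matrixP => i j; rewrite !mxE.
transitivity (pderiv j (coordf eta i \o theta) x).
  by rewrite pderiv_comp//; apply: eq_bigr => k _; rewrite !mxE.
rewrite (@pderiv_local _ _ X _ (coordf id i)) ?inE//; last 2 first.
- exact: oset_open.
- by move=> y /set_mem Xy; rewrite /coordf /= /eta diffeoK.
have Did : is_diff x (id : V -> V) id by exact: is_diff_id.
rewrite /pderiv deriveE; last exact: differentiable_coord.
by rewrite diff_coordf// diff_val mxE eqxx eq_sym.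
Qed.

(* (phi \o theta) * J_theta on X, extended by zero. *)
Definition pullback (phi : V -> C) : V -> C :=
  fun x => if x \in (X : set V) then phi (theta x) * (jac x)%:C else 0.

Lemma pullback_test (phi : test Y) : (pullback phi : V -> C^o) \in is_test X.
Proof.
have /is_testP[S K KY] := tfunP phi; set eta := diffeo_inv theta.
have cK : compact (eta @` support_set phi).
  apply: continuous_compact => //; apply: continuous_in_subspaceT => y /set_mem Ky.
  apply/differentiable_continuous/row_differentiable => j.
  by apply: (diffeo_inv_smooth theta j [::]); exact: KY.
have KX : eta @` support_set phi `<=` X.
  by move=> _ [y Ky <-]; apply: diffeo_inv_to; exact: KY.
have z x : ~ (eta @` support_set phi) x -> pullback phi x = 0.
  move=> Nx; rewrite /pullback; case: ifPn => // /set_mem Xx.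
  rewrite support0 ?mul0r// => Kt; apply: Nx; exists (theta x) => //.
  exact: diffeoK.
have [c s] := support_compact cK z.
apply/is_testP; split => //; last exact: subset_trans KX.
rewrite (_ : setT = X `|` ~` (eta @` support_set phi)); last first.
  apply/esym/seteqP; split=> // x _.
  by have [/KX|] := pselect ((eta @` support_set phi) x); [left|right].
apply: Csmooth_setU; last first.
  by apply: Csmooth_zero_setC => //; apply: compact_closed => //; exact: norm_hausdorff.
have oX : open X by exact: oset_open.
apply: (@Csmooth_local _ _ _ (fun x => phi (theta x) * (jac x)%:C)) => //.
  by move=> x Xx; rewrite /pullback Xx.
have comp (f : V -> R) : smooth_on setT f -> smooth_on X (f \o theta).
  by move=> F; apply: smooth_comp F _ => //; exact: diffeo_smooth.
apply: CsmoothM => //.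
  by case: S => Sr Si; split; [exact: comp Sr|exact: comp Si].
split; last exact: smooth_cst.
apply: smooth_normr => //; first exact: det_jacobian_neq0.
by apply: smooth_det => //; exact: diffeo_smooth.
Qed.

Definition tpull (phi : test Y) : test X := Test (pullback_test phi).

Lemma tpull_linear : linear tpull.
Proof.
move=> a u v; apply: testP => x; rewrite test_linE /= /pullback.
case: ifPn => _; last by rewrite mulr0 addr0.
by rewrite mulrA -mulrDl.
Qed.

HB.instance Definition _ :=
  GRing.isLinear.Build C (test Y) (test X) *:%R tpull tpull_linear.

Definition dpush (T : Dstar X) : Dstar Y := T \o tpull.

End change_of_variables.

Section lebesgue.
Context {R : realType} {d : nat}.
Local Notation V := 'rV[R]_d.
Local Open Scope ereal_scope.

(* [None] allows for covers by finitely many boxes, and makes the outer measure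
   of set0 vanish also in dimension 0, where all boxes have volume 1. *)
Definition box (B : option (V * V)) : set V :=
  if B is Some (a, b) then [set x | forall i, (a 0 i <= x 0 i <= b 0 i)%R] else set0.

Definition box_volume (B : option (V * V)) : R :=
  if B is Some (a, b) then (\prod_i Num.max 0 (b 0 i - a 0 i))%R else 0%R.

Definition lebesgue_outer (A : set V) : \bar R :=
  ereal_inf [set \sum_(k <oo) (box_volume (B k))%:E |
    B in [set B : nat -> option (V * V) | A `<=` \bigcup_k box (B k)]].

Lemma box_volume_ge0 B : 0 <= (box_volume B)%:E.
Proof.
rewrite lee_fin; case: B => [[a b]|]//=.
by apply: prodr_ge0 => i _; rewrite le_max lexx.
Qed.

Lemma lebesgue_outer_ge0 A : 0 <= lebesgue_outer A.
Proof.
apply: le_ereal_inf_tmp => x [B AB <-{x}].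
by apply: nneseries_ge0 => n _ _; exact: box_volume_ge0.
Qed.

Lemma lebesgue_outer0 : lebesgue_outer set0 = 0.
Proof.
apply/eqP; rewrite eq_le lebesgue_outer_ge0 andbT.
apply: ereal_inf_lbound; exists (fun=> None); first by [].
by apply: lim_near_cst => //; near=> n => /=; rewrite big1.
Unshelve. all: by end_near. Qed.

Lemma le_lebesgue_outer : {homo lebesgue_outer : A B / A `<=` B >-> A <= B}.
Proof.
move=> A B AB; apply/ereal_inf_le_tmp => x [F BF <-{x}].
by exists F => //; exact: subset_trans BF.
Qed.

Lemma lebesgue_outer_sigma_subadditive : sigma_subadditive lebesgue_outer.
Proof.
move=> A; have [[i ioo]|] := pselect (exists i, lebesgue_outer (A i) = +oo).
  rewrite (eseries_pinfty _ _ ioo) ?leey// => n _.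
  by rewrite -ltNye (lt_le_trans _ (lebesgue_outer_ge0 _)).
rewrite -forallNE => Aoo.
suff add2e (e : {posnum R}) :
    lebesgue_outer (\bigcup_n A n) <= \sum_(i <oo) lebesgue_outer (A i) + e%:num%:E.
  by apply/lee_addgt0Pr => _/posnumP[].
rewrite (le_trans _ (epsilon_trick _ _ _))//; last first.
  by move=> n; exact: lebesgue_outer_ge0.
pose P n (B : nat -> option (V * V)) := A n `<=` \bigcup_k box (B k) /\
  \sum_(k <oo) (box_volume (B k))%:E <=
    lebesgue_outer (A n) + (e%:num / (2 ^ n.+1)%:R)%:E.
have [G PG] : {G : nat -> nat -> option (V * V) & forall n, P n (G n)}.
  apply: (@choice _ _ P) => n; rewrite /P /lebesgue_outer.
  set S := (X in ereal_inf X); move infS : (ereal_inf S) => iS.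
  case: iS infS => [r Sr|Soo|Soo].
  - have en1 : (0 < e%:num / (2 ^ n.+1)%:R)%R by [].
    have /(lb_ereal_inf_adherent en1) : ereal_inf S \is a fin_num by rewrite Sr.
    move=> [x [B AnB muBx] xS].
    by exists B; split => //; rewrite muBx -Sr; exact/ltW.
  - by have := Aoo n; rewrite /lebesgue_outer Soo.
  - by have := lebesgue_outer_ge0 (A n); rewrite /lebesgue_outer Soo.
pose mu (B : option (V * V)) := (box_volume B)%:E.
have muG_ge0 x : 0 <= (mu \o uncurry G) x by exact: box_volume_ge0.
apply: (@le_trans _ _ (\esum_(i in setT) (mu \o uncurry G) i)).
  apply: ereal_inf_lbound => /=.
  have /card_esym/ppcard_eqP[f] := card_nat2.
  exists (uncurry G \o f).
    move=> t [n _ /(PG n).1[j _ Bt]]; exists (f^-1%FUN (n, j)) => //=.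
    by rewrite invK ?inE.
  rewrite -(esum_pred_image (mu \o uncurry G) _ xpredT) ?[fun=> _]set_true//.
  by rewrite image_eq.
rewrite (_ : esum _ _ = \sum_(i <oo) \sum_(j <oo ) mu (G i j)); last first.
  pose J : nat -> set (nat * nat) := fun i => [set (i, j) | j in setT].
  rewrite (_ : setT = \bigcup_k J k); last first.
    by rewrite predeqE => -[a b]; split => // _; exists a => //; exists b.
  rewrite esum_bigcupT /=; last 2 first.
    - apply/trivIsetP => i j _ _ ij.
      rewrite predeqE => -[n m] /=; split => //= -[] [_] _ [<-{n} _].
      by move=> [m' _] [] /esym/eqP; rewrite (negbTE ij).
    - by move=> /= [n m]; exact: box_volume_ge0.
  rewrite -(image_id [set: nat]) -fun_true esum_pred_image//; last first.
    by move=> n _; apply: esum_ge0 => p _; exact: box_volume_ge0.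
  apply: eq_eseriesr => /= j _.
  rewrite -(esum_pred_image (mu \o uncurry G) (pair j) predT)//=; last 2 first.
    - by move=> n _; exact: box_volume_ge0.
    - by move=> ? ? _ _; exact: (@can_inj _ _ _ snd).
  by congr esum; rewrite predeqE => -[a b]; split; move=> [i _ <-]; exists i.
apply: lee_lim.
- apply: is_cvg_nneseries => n *.
  by apply: nneseries_ge0 => m *; exact: (muG_ge0 (n, m)).
- by apply: is_cvg_nneseries => n *; apply: adde_ge0 => //; exact: lebesgue_outer_ge0.
- by near=> n; apply: lee_sum => i _; exact: (PG i).2.
Unshelve. all: by end_near. Qed.

HB.instance Definition _ := isOuterMeasure.Build R V lebesgue_outer
  lebesgue_outer0 lebesgue_outer_ge0 le_lebesgue_outer
  lebesgue_outer_sigma_subadditive.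

Definition lebesgue_outer_measure : {outer_measure set V -> \bar R} :=
  lebesgue_outer.

(* Lebesgue measure on the sigma-algebra of all Lebesgue measurable sets, not
   only the Borel sets. *)
Definition lebesgueRn :
    {measure set (caratheodory_type lebesgue_outer_measure) -> \bar R} :=
  (lebesgue_outer_measure :
    set (caratheodory_type lebesgue_outer_measure) -> \bar R).

End lebesgue.

Section distributions.
Context {R : realType} {d : nat}.
Local Notation C := R[i].
Local Notation V := 'rV[R]_d.
Local Notation Re := complex.Re.
Local Notation Im := complex.Im.
Local Notation lam := (@lebesgueRn R d).
Local Notation lebesgue_type :=
  (caratheodory_type (@lebesgue_outer_measure R d)).
Implicit Types (Om X Y : opens R d).

Definition Cintegral (D : set V) (g : V -> C) : C :=
  (\int[lam]_(x in D) Re (g x)) +i* (\int[lam]_(x in D) Im (g x)).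

Definition Lloc (D : set V) (f : V -> C) : Prop :=
  [/\ measurable_fun (D : set lebesgue_type)
         ((fun x => Re (f x)) : lebesgue_type -> R),
      measurable_fun (D : set lebesgue_type)
         ((fun x => Im (f x)) : lebesgue_type -> R) &
      forall K : set V, compact K -> K `<=` D ->
        (\int[lam]_(x in K) (Normc.normc (f x))%:E < +oo)%E].

(* The image S_Om[L_loc(Om)] of the Schwartz embedding. *)
Definition schwartz_image Om : set (Dstar Om) :=
  [set T : Dstar Om | exists2 f : V -> C, Lloc Om f &
    forall phi : test Om, T phi = Cintegral Om (fun x => f x * phi x)].

Definition weak_cvg Om (Tn : nat -> Dstar Om) (T : Dstar Om) : Prop :=
  forall phi, Tn n phi @[n --> \oo] --> T phi.

Definition differential_submodule Om (P : set (Dstar Om)) : Prop :=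
  [/\ P (dzero Om),
      forall S T, P S -> P T -> P (dadd S T),
      forall (f : smoothfun Om) T, P T -> P (dmul f T) &
      forall al T, P T -> P (dpartial al T)].

Definition differential_subspace Om (P : set (Dstar Om)) : Prop :=
  [/\ P (dzero Om),
      forall S T, P S -> P T -> P (dadd S T),
      forall (c : C) T, P T -> P (dscale c T) &
      forall al T, P T -> P (dpartial al T)].

Lemma subopensIl X Y : opensI X Y `<=` X.
Proof. by move=> x []. Qed.

Lemma subopensIr X Y : opensI X Y `<=` Y.
Proof. by move=> x []. Qed.

Definition smoothfun_restr X Om (XO : X `<=` Om) (f : smoothfun Om) : smoothfun X :=
  Smoothfun (Csmooth_sub XO (sfunP f)).

Definition subpresheaf (F : forall Om, set (Dstar Om)) : Prop :=
  forall Om X (XO : X `<=` Om) T, F Om T -> F X (restr XO T).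

(* Restriction is a morphism of differential modules over E(Om) -> E(X). *)
Definition restr_morphism : Prop :=
  forall Om X (XO : X `<=` Om),
  [/\ restr XO (dzero Om) =1 dzero X,
      forall S T : Dstar Om,
        restr XO (dadd S T) =1 dadd (restr XO S) (restr XO T),
      forall (c : C) (T : Dstar Om), restr XO (dscale c T) =1 dscale c (restr XO T),
      forall (f : smoothfun Om) (T : Dstar Om),
        restr XO (dmul f T) =1 dmul (smoothfun_restr XO f) (restr XO T) &
      forall al (T : Dstar Om), restr XO (dpartial al T) =1 dpartial al (restr XO T)].

Definition presheaf : Prop :=
  (forall Om (OO : Om `<=` Om) (T : Dstar Om), restr OO T =1 T) /\
  (forall (Om X Z : opens R d) (XO : X `<=` Om) (ZX : Z `<=` X) (ZO : Z `<=` Om) (T : Dstar Om),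
     restr ZX (restr XO T) =1 restr ZO T).

Definition separated (F : forall Om, set (Dstar Om)) : Prop :=
  forall Om (I : Type) (U : I -> opens R d) (UO : forall i, U i `<=` Om),
    oset Om `<=` \bigcup_i U i ->
    forall S T : Dstar Om, F Om S -> F Om T ->
      (forall i, restr (UO i) S =1 restr (UO i) T) -> S =1 T.

Definition gluing (F : forall Om, set (Dstar Om)) : Prop :=
  forall Om (I : Type) (U : I -> opens R d) (UO : forall i, U i `<=` Om),
    oset Om `<=` \bigcup_i U i ->
    forall T : forall i, Dstar (U i), (forall i, F (U i) (T i)) ->
      (forall i j, restr (@subopensIl (U i) (U j)) (T i) =1
                   restr (@subopensIr (U i) (U j)) (T j)) ->
      exists2 S : Dstar Om, F Om S & forall i, restr (UO i) S =1 T i.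

Definition sheaf_of_differential_modules (F : forall Om, set (Dstar Om)) : Prop :=
  [/\ forall Om, differential_submodule (F Om) /\ differential_subspace (F Om),
      subpresheaf F, separated F & gluing F].

Definition subsheaf_of_differential_modules (F G : forall Om, set (Dstar Om)) : Prop :=
  [/\ presheaf, restr_morphism,
      sheaf_of_differential_modules F,
      sheaf_of_differential_modules G &
      forall Om, F Om `<=` G Om].

(* S is the complement in Om of the largest open subset of Om on which T
   restricts to 0; the existence of this largest set is part of the claim. *)
Definition is_support Om (T : Dstar Om) (S : set V) : Prop :=
  exists (U : opens R d) (UO : U `<=` Om),
  [/\ restr UO T =1 dzero U,
      forall X (XO : X `<=` Om), restr XO T =1 dzero X -> X `<=` U &
      S = Om `\` U].

(* The points of Om near which T does not vanish, where T vanishes on U if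
   T phi = 0 for all test functions phi supported in U. *)
Definition dist_support Om (T : Dstar Om) : set V :=
  [set x | oset Om x /\
    forall U : set V, open U -> U x ->
      exists2 phi : test Om, support_set phi `<=` U & T phi != 0].

End distributions.

Arguments schwartz_image {R d} Om.

(* Main.v *)
(* T is a distribution iff on every compact subset K of Om it is bounded by finitely
   many derivatives ([DprimeP]); this criterion is stable under multiplication by
   smooth functions, differentiation, restriction and change of variables, and
   partitions of unity make it local.

   A weak limit of locally integrable functions satisfies the criterion by a gliding
   hump argument (the Banach-Steinhaus theorem for D(Om)).  Conversely, let eta_l be a
   locally finite smooth partition of unity on Om, and zeta_l in D(Om) with zeta_l = 1
   on the support of eta_l.  Replacing the distribution zeta_l T by its convolution
   with the normalized kernel (1 - c |z|^2)^n gives a smooth function: the kernel is a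
   finite sum of u_a(y) v_a(x), so the convolution is the finite sum of the
   T(zeta_l u_a) v_a, and no differentiation under the bracket is needed.  The kernels
   concentrate at 0 when n grows, uniformly with all derivatives when tested against
   eta_l psi.  As the sum over l is locally finite, the diagonal sequence of the sums
   over l < n converges weakly to T. *)

Require Import Defs.
From HB Require Import structures.
From mathcomp Require Import all_boot all_order all_algebra.
From mathcomp Require Import all_classical all_reals all_analysis.
From mathcomp Require Import measurable_realfun complex.
From mathcomp Require Import ring lra.

Set Implicit Arguments.
Unset Strict Implicit.
Unset Printing Implicit Defensive.

Import Order.TTheory GRing.Theory Num.Theory.
Import numFieldNormedType.Exports.

Local Open Scope classical_set_scope.
Local Open Scope complex_scope.
Local Open Scope ring_scope.

(** * Smooth functions *)

(** Two choices shape the proof. The topology of D(Om) is given by neighbourhoods, so every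
    continuity claim passes once through [DprimeP] and is afterwards an inequality between finitely
    many derivatives. These are taken along lists of indices, on which the inductions run; the
    symmetry of mixed derivatives translates them back into multi-indices.

    The regularizing kernel is the one of Landau's proof of the Weierstrass theorem. Being a
    polynomial in x - y, it cannot have compact support and behaves like an approximate identity
    only on a bounded ball: hence the preliminary cut-off by zeta_l. In exchange, little is asked of
    Lebesgue measure: open sets are measurable, bounded sets have finite measure, balls have
    positive measure, and translations preserve the measure. Integration by parts, which moves
    derivatives from the kernel to the test function, is deduced from translation invariance. *)

Section smooth_calculus.
Context {R : realType} {d : nat}.
Local Notation V := 'rV[R]_d.
Implicit Types (A B K : set V) (f g h : V -> R) (x y v w : V) (s : seq 'I_d).

Local Notation partials f s := (foldr pderiv f s).

Lemma norm_row_le v (e : R) : 0 <= e ->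
  (`|v| <= e) <-> (forall i, `|v 0 i| <= e).
Proof.
move=> e0; rewrite [ `|v|]/Num.Def.normr /= mx_normrE; split.
  move=> /bigmax_leP[_ H] i; exact: (H (0, i)).
by move=> H; apply/bigmax_leP; split => // -[a i] _ /=; rewrite ord1.
Qed.

Lemma norm_coord_le v i : `|v 0 i| <= `|v|.
Proof. by have /norm_row_le := lexx `|v|; apply. Qed.

Lemma norm_delta_row (i : 'I_d) : `|delta_mx 0 i : V| <= 1.
Proof.
by apply/norm_row_le => // l; rewrite mxE; case: (_ && _); rewrite ?normr1 ?normr0.
Qed.

Lemma derive_sum_pderiv f x v : differentiable f x ->
  'D_v f x = \sum_i v 0 i * pderiv i f x.
Proof.
move=> df; rewrite deriveE// [in LHS](row_sum_delta v) linear_sum.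
apply: eq_bigr => i _; rewrite linearZ /=.
by rewrite /pderiv deriveE.
Qed.

Lemma is_derive_line f x v (t : R) : differentiable f (x + t *: v) ->
  is_derive t 1 (fun u : R => f (x + u *: v)) ('D_v f (x + t *: v)).
Proof.
move=> df; have dv := diff_derivable (v := v) df.
have E : (fun h : R => h^-1 *: (((fun u => f (x + u *: v)) \o shift t) (h *: 1) - f (x + t *: v)))
    = (fun h : R => h^-1 *: ((f \o shift (x + t *: v)) (h *: v) - f (x + t *: v))).
  apply/funext => h /=; congr (_ *: (f _ - _)).
  by rewrite scalerDl addrCA [h *: 1]mulr1.
by split; [rewrite /derivable E; exact: dv | rewrite /derive E].
Qed.

Lemma mean_value_line f x v : (forall y, differentiable f y) ->
  exists2 c : R, 0 <= c <= 1 & f (x + v) - f x = 'D_v f (x + c *: v).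
Proof.
move=> df; pose F (u : R) := f (x + u *: v).
have dF (t : R) : is_derive t 1 F ('D_v f (x + t *: v)) by exact: is_derive_line.
have [|c + E] := @MVT_segment R F (fun t => 'D_v f (x + t *: v)) 0 1 ler01.
  apply: continuous_subspaceT => t; apply/differentiable_continuous/derivable1_diffP.
  by have [] := dF t.
rewrite in_itv /= => c01; exists c => //.
by move: E; rewrite /F scale1r scale0r addr0 subr0 mulr1.
Qed.

Lemma derive_scale f x (r : R) v : differentiable f x -> 'D_(r *: v) f x = r * 'D_v f x.
Proof. by move=> df; rewrite !deriveE// linearZ. Qed.

Lemma derive_translate f x v w : 'D_v (fun y => f (y + w)) x = 'D_v f (x + w).
Proof.
rewrite /derive.
suff -> : (fun h : R => h^-1 *: (((fun y => f (y + w)) \o shift x) (h *: v) - f (x + w)))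
  = (fun h : R => h^-1 *: ((f \o shift (x + w)) (h *: v) - f (x + w))) by [].
by apply/funext => h /=; rewrite addrA.
Qed.

Lemma differentiable_translate f x w :
  differentiable f (x + w) -> differentiable (fun y => f (y + w)) x.
Proof. by move=> df; apply: (@differentiable_comp _ _ _ _ (fun y => y + w) f). Qed.

(** The mean value theorem is applied to [G] in direction [i], then to [pderiv i f] in direction
    [j]. The left side is symmetric in [i] and [j], which is what [pderivC] exploits. *)
Lemma second_difference f i j x (r : R) : smooth_on setT f ->
  exists2 z : V, `|x - z| <= `|r| *+ 2 &
    f (x + r *: delta_mx 0 i + r *: delta_mx 0 j) - f (x + r *: delta_mx 0 i)
      - (f (x + r *: delta_mx 0 j) - f x) = r * (r * pderiv j (pderiv i f) z).
Proof.
move=> sf; have df s y : differentiable (partials f s) y by exact: sf.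
set ei := delta_mx 0 i : V; set ej := delta_mx 0 j : V.
pose G y := f (y + r *: ej) - f y.
have dsh y : differentiable (fun y => f (y + r *: ej)) y.
  exact/differentiable_translate/(df [::]).
have dG y : differentiable G y.
  by apply: (@differentiableB _ _ _ (fun y => f (y + r *: ej)) f) => //; exact: (df [::]).
have [c /andP[c0 c1] Ec] := mean_value_line x (r *: ei) dG.
have [b /andP[b0 b1] Eb] := mean_value_line (x + c *: (r *: ei)) (r *: ej) (df [:: i]).
exists (x + c *: (r *: ei) + b *: (r *: ej)).
  rewrite distrC addrC !addrA addNr add0r (le_trans (ler_normD _ _))// !normrZ mulr2n.
  by apply: lerD; rewrite mulrA -[leRHS]mulr1; apply: ler_pM;
    rewrite ?norm_delta_row ?mulr_ge0// ger0_norm// ler_piMl.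
move: Ec; rewrite /G derive_scale//.
have -> : 'D_ei G (x + c *: (r *: ei)) =
    pderiv i f (x + c *: (r *: ei) + r *: ej) - pderiv i f (x + c *: (r *: ei)).
  rewrite [LHS](@deriveB _ _ _ (fun y => f (y + r *: ej)) f); first last.
  - exact/diff_derivable/(df [::]).
  - exact/diff_derivable.
  by rewrite derive_translate.
by rewrite Eb derive_scale; [move=> <- | exact: (df [:: i])].
Qed.

(** Two mean value steps. The bound is uniform in [x], so that it can be integrated in
    [vint_pderiv]. *)
Lemma difference_quotient_bound f i x (r M : R) : 0 <= r -> smooth_on setT f ->
  (forall y, `|pderiv i (pderiv i f) y| <= M) ->
  `|r * pderiv i f x - (f (x + r *: delta_mx 0 i) - f x)| <= r * (r * M).
Proof.
move=> r0 sf HM; have df s y : differentiable (partials f s) y by exact: sf.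
have [c /andP[c0 c1]] := mean_value_line x (r *: delta_mx 0 i) (df [::]).
rewrite derive_scale; last exact: (df [::]).
move=> /= ->; rewrite scalerA.
have [b _] := mean_value_line x ((c * r) *: delta_mx 0 i) (df [:: i]).
rewrite derive_scale; last exact: (df [:: i]).
move=> /= E; rewrite -mulrBr -opprB E mulrN normrN !normrM (ger0_norm r0) (ger0_norm c0).
apply: ler_wpM2l => //; apply: ler_pM; rewrite ?mulr_ge0// ?ler_piMl//.
exact: HM.
Qed.

(** Both mixed derivatives, taken at suitable points [z] and [w] near [x], equal the same second
    difference divided by r^2; continuity at [x] concludes. *)
Lemma pderivC f i j : smooth_on setT f ->
  pderiv i (pderiv j f) = pderiv j (pderiv i f).
Proof.
move=> sf; apply/funext => x.
have cont k l : pderiv k (pderiv l f) @ x --> pderiv k (pderiv l f) x.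
  by apply/differentiable_continuous/(sf [:: k; l]).
apply/eqP; rewrite -subr_eq0 -normr_le0; apply/ler_addgt0Pr => /= e e0; rewrite add0r.
have e2 : 0 < e / 2 by rewrite divr_gt0.
have /cvgrPdist_le/(_ _ e2)/nbhs_normP[r1 /= r10 H1] := cont i j.
have /cvgrPdist_le/(_ _ e2)/nbhs_normP[r2 /= r20 H2] := cont j i.
(* The intermediate points lie within 2r of [x], and both continuity estimates must hold there. *)
pose r : R := Num.min r1 r2 / 3.
have m0 : 0 < Num.min r1 r2 by rewrite lt_min r10.
have r0 : 0 < r by rewrite divr_gt0.
have r3 : `|r| *+ 2 < Num.min r1 r2.
  by rewrite gtr0_norm// -mulr_natr /r -mulrA gtr_pMr// -[ltRHS](@divff _ 3%:R)// mulrC ltr_pM2r// ltr_nat.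
have [z zx Ez] := second_difference j i x r sf.
have [w wx Ew] := second_difference i j x r sf.
have E : pderiv i (pderiv j f) z = pderiv j (pderiv i f) w.
  apply: (@mulfI R r (lt0r_neq0 r0)); apply: (@mulfI R r (lt0r_neq0 r0)).
  apply: etrans (esym Ez) _.
  apply: etrans _ Ew.
  rewrite (addrAC x).
  by rewrite !opprB !addrA -!addrA; congr (_ + _); rewrite addrCA [RHS]addrCA; congr (_ + _); rewrite addrC.
have B1 : `|pderiv i (pderiv j f) x - pderiv i (pderiv j f) z| <= e / 2.
  by apply: H1; apply: le_lt_trans zx (lt_le_trans r3 _); rewrite ge_min lexx.
have B2 : `|pderiv j (pderiv i f) x - pderiv j (pderiv i f) w| <= e / 2.
  by apply: H2; apply: le_lt_trans wx (lt_le_trans r3 _); rewrite ge_min lexx orbT.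
rewrite (splitr e); apply: le_trans (lerD B1 B2).
by rewrite [X in _ <= _ + X]distrC -E; apply: le_trans (ler_normD _ _); rewrite addrA subrK.
Qed.

Lemma smooth_partials A f s : smooth_on A f -> smooth_on A (partials f s).
Proof. by move=> sf; elim: s => //= i s; exact: smooth_pderiv. Qed.

Lemma partials_local A f g s : open A -> {in A, f =1 g} ->
  {in A, partials f s =1 partials g s}.
Proof. by move=> oA fg; elim: s => //= i s; exact: pderiv_local. Qed.

(** The seminorms of D(Om) use multi-indices, that is, sorted lists; this lemma makes them control
    derivatives along arbitrary lists. *)
Lemma perm_partials f s1 s2 : smooth_on setT f -> perm_eq s1 s2 ->
  partials f s1 = partials f s2.
Proof.
move=> sf; elim: s1 s2 => [|i s1 IH] s2; first by rewrite perm_sym => /perm_nilP ->.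
move=> ps; have : i \in s2 by rewrite -(perm_mem ps) mem_head.
move=> /splitPr is2; case: is2 ps => t1 t2.
rewrite perm_sym perm_catC cat_cons perm_cons perm_catC perm_sym => /IH /= ->.
elim: t1 => //= j t1 <-; apply: pderivC; exact: smooth_partials.
Qed.

Lemma perm_midx_seq s : perm_eq s (midx_seq (fun i => count_mem i s)).
Proof.
apply/allP => /= i _; apply/eqP; rewrite /midx_seq count_flatten -map_comp.
rewrite (eq_map (g := fun j => if j == i then count_mem i s else 0%N)); last first.
  by move=> j /=; rewrite count_nseq /=; case: eqVneq => [->|]; rewrite ?mul1n ?mul0n.
rewrite sumnE big_map big_enum /= -big_mkcond (big_pred1 i)//.
Qed.

Lemma midx_deg_count s : midx_deg (fun i => count_mem i s) = size s.
Proof.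
rewrite (perm_size (perm_midx_seq s)) /midx_seq size_flatten /shape -map_comp sumnE big_map.
by rewrite big_enum; apply: eq_bigr => i _ /=; rewrite size_nseq.
Qed.

Lemma partialsD A f g s x : open A -> smooth_on A f -> smooth_on A g -> A x ->
  partials (f \+ g) s x = partials f s x + partials g s x.
Proof.
move=> oA sf sg; elim: s x => //= i s IH x Ax.
rewrite (@pderiv_local _ _ A _ (partials f s \+ partials g s)) ?inE//.
  by rewrite pderivD//; [exact: sf|exact: sg].
by move=> y /set_mem/IH.
Qed.

Lemma partialsZ A f (c : R) s x : open A -> smooth_on A f -> A x ->
  partials (fun y => c * f y) s x = c * partials f s x.
Proof.
move=> oA sf; elim: s x => //= i s IH x Ax.
rewrite (@pderiv_local _ _ A _ (cst c \* partials f s)) ?inE//.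
  rewrite pderivM//; first by rewrite [pderiv i (cst c) x]derive_cst mulr0 addr0.
  exact: sf.
by move=> y /set_mem/IH.
Qed.

Lemma smooth_sum A I (r : seq I) (F : I -> V -> R) : open A ->
  (forall i, smooth_on A (F i)) -> smooth_on A (fun x => \sum_(i <- r) F i x).
Proof.
by move=> oA H; apply/smooth_onP => n; apply: Cn_sum => // i; have /smooth_onP := H i.
Qed.

Lemma partials_sum A I (r : seq I) (F : I -> V -> R) s x : open A ->
  (forall i, smooth_on A (F i)) -> A x ->
  partials (fun x => \sum_(i <- r) F i x) s x = \sum_(i <- r) partials (F i) s x.
Proof.
move=> oA sF Ax; elim: r => [|i r IH].
  rewrite big_nil; under eq_fun do rewrite big_nil.
  elim: s x Ax => //= i s IH x Ax.
  rewrite (@pderiv_local _ _ A _ (cst 0)) ?inE//; first exact: derive_cst.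
  by move=> y /set_mem; exact: IH.
under eq_fun do rewrite big_cons.
by rewrite (partialsD _ oA (sF i))// ?IH ?big_cons//; exact: smooth_sum.
Qed.

Lemma smooth_bounded A f K : smooth_on A f -> compact K -> K `<=` A ->
  exists2 C : R, 0 <= C & forall x, K x -> `|f x| <= C.
Proof.
move=> sf cK KA.
have [|M [Mr HM]] := @compact_bounded R R (f @` K).
  apply: continuous_compact => //; apply: continuous_in_subspaceT => x /set_mem Kx.
  exact/differentiable_continuous/(sf [::])/KA.
exists (`|M| + 1) => [|x Kx]; first exact: addr_ge0.
by apply: HM; [rewrite ltr_pwDr// ler_norm | exists x].
Qed.

(* Induction on the derivation that is applied first, by
   [d_i ((h o theta) w) = sum_j (d_j h o theta) (d_i theta_j) w + (h o theta) d_i w]. *)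
Lemma partials_comp_mul_bound A B theta (w : V -> R) K s : open A ->
  (forall x, A x -> B (theta x)) -> (forall j, smooth_on A (coordf theta j)) ->
  smooth_on A w -> compact K -> K `<=` A ->
  exists2 C : R, 0 <= C & forall h (e : R), smooth_on B h ->
    (forall t x, (size t <= size s)%N -> K x -> `|partials h t (theta x)| <= e) ->
    forall x, K x -> `|partials ((h \o theta) \* w) s x| <= C * e.
Proof.
move=> oA AB st + cK KA; elim/last_ind: s w => [|s i IH] w sw.
  have [C C0 HC] := smooth_bounded sw cK KA.
  exists C => // h e _ H x Kx /=; rewrite normrM mulrC; apply: ler_pM => //.
    exact: HC.
  exact: (H [::] x).
have sD j : smooth_on A (pderiv i (coordf theta j)) by exact: smooth_pderiv.
have sM j : smooth_on A (pderiv i (coordf theta j) \* w) by exact: smoothM.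
have [c0 c00 H0] := IH _ (smooth_pderiv i sw).
have /choice[c Hc] j := (exists2P _ _).1 (IH _ (sM j)).
exists (\sum_j c j + c0) => [|h e sh H x Kx].
  by apply: addr_ge0 => //; apply: sumr_ge0 => j _; have [] := Hc j.
have sc f : smooth_on B f -> smooth_on A (f \o theta).
  by move=> sf; exact: smooth_comp AB sf st.
rewrite foldr_rcons (@partials_local A _ ((fun x => \sum_j
    ((pderiv j h \o theta) \* (pderiv i (coordf theta j) \* w)) x) \+
    ((h \o theta) \* pderiv i w)) s oA); first last.
- exact/mem_set/KA.
- move=> y /set_mem Ay; have Dt j : differentiable (coordf theta j) y by exact: (st j [::]).
  have Dh : differentiable h (theta y) by exact/(sh [::])/AB.
  rewrite pderivM; first last.
  + exact: (sw [::]).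
  + exact: (sc _ sh [::]).
  rewrite /= addrC pderiv_comp// mulrC mulr_suml; congr (_ + _).
  by apply: eq_bigr => j _; rewrite mulrA.
have Ax := KA _ Kx.
have sF j : smooth_on A ((pderiv j h \o theta) \* (pderiv i (coordf theta j) \* w)).
  by apply: smoothM => //; exact/sc/smooth_pderiv.
rewrite (partialsD _ oA) //; first last.
- by apply: smoothM => //; [exact: sc|exact: smooth_pderiv].
- exact: smooth_sum.
rewrite (partials_sum _ _ oA)// mulrDl mulr_suml.
apply: le_trans (ler_normD _ _) _; apply: lerD.
  apply: le_trans (ler_norm_sum _ _ _) _; apply: ler_sum => j _.
  have [_ Hj] := Hc j; apply: Hj => // [|t y ts Ky]; first exact: smooth_pderiv.
  by rewrite -foldr_rcons; apply: H => //; rewrite !size_rcons ltnS.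
apply: H0 => // t y ts Ky; apply: H => //.
by rewrite size_rcons (leq_trans ts).
Qed.

End smooth_calculus.

(** * Uniform limits of smooth functions *)

Section gradient.
Context {R : realType} {d : nat}.
Local Notation V := 'rV[R]_d.

Definition dot_row (g : 'I_d -> R) (v : V) : R := \sum_i v 0 i * g i.

Lemma dot_row_linear g : linear (dot_row g).
Proof.
move=> a u v; rewrite /dot_row scaler_sumr -big_split; apply: eq_bigr => i _ /=.
by rewrite !mxE mulrDl -mulrA.
Qed.

HB.instance Definition _ g := GRing.isLinear.Build R V R *:%R (dot_row g) (dot_row_linear g).

Lemma dot_row_continuous g : continuous (dot_row g).
Proof.
move=> x; apply: differentiable_continuous.
rewrite (_ : dot_row g = \sum_i (fun v : V => v 0 i * g i)); last first.
  by apply/funext => v; rewrite fct_sumE.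
apply: differentiable_sum => i; apply: (@differentiableM _ _ (fun v : V => v 0 i) (cst (g i))) => //.
exact: differentiable_coord.
Qed.

Lemma norm_dot_row_le g (e : R) (v : V) : (forall i, `|g i| <= e) ->
  `|dot_row g v| <= d%:R * e * `|v|.
Proof.
move=> ge; apply: le_trans (ler_norm_sum _ _ _) _.
apply: (@le_trans _ _ (\sum_(i < d) e * `|v|)).
  apply: ler_sum => i _; rewrite normrM mulrC; apply: ler_pM => //; exact: norm_coord_le.
by rewrite sumr_const card_ord -[leLHS]mulr_natl mulrA.
Qed.

(** An epsilon-delta form of Frechet differentiability that yields the partial derivatives at the
    same time. *)
Lemma differentiable_gradient (f : V -> R) (x : V) (g : 'I_d -> R) :
  (forall e : R, 0 < e -> exists2 r : R, 0 < r &
     forall v : V, `|v| < r -> `|f (x + v) - f x - dot_row g v| <= e * `|v|) ->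
  differentiable f x /\ forall i, pderiv i f x = g i.
Proof.
move=> H; have E : f \o shift x = cst (f x) + dot_row g +o_ (0 : V) id.
  apply/eqaddoP => e e0; have [r r0 Hr] := H _ e0.
  have : \forall v \near (0 : V), `|v| < r.
    by apply/nbhs_normP; exists r => // v; rewrite /= sub0r normrN.
  apply: filterS => v /Hr.
  by rewrite !fctE /= opprD addrA (addrC x).
have D : 'd f x = dot_row g :> (V -> R).
  exact: (@diff_unique R V R f (dot_row g) x (@dot_row_continuous g) E).
have df : differentiable f x.
  apply/diff_locallyP; rewrite D; split=> //; exact: dot_row_continuous.
split=> // i; rewrite /pderiv deriveE// D /dot_row (bigD1 i)//= big1 ?addr0.
  by rewrite mxE !eqxx mul1r.
by move=> j ji; rewrite mxE (negbTE ji) andbF mul0r.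
Qed.

(** The mean value theorem for the derivatives of [F n] passes to the limit: their gradients are
    uniformly close to the continuous functions [G (i :: s)]. *)
Lemma smooth_limit (F : nat -> V -> R) (G : seq 'I_d -> V -> R) :
  (forall n, smooth_on setT (F n)) ->
  (forall s (e : R), 0 < e -> exists N, forall n, (N <= n)%N ->
     forall x, `|foldr pderiv (F n) s x - G s x| <= e) ->
  smooth_on setT (G [::]) /\ forall s, foldr pderiv (G [::]) s = G s.
Proof.
move=> sF cF.
have sFs n s x : differentiable (foldr pderiv (F n) s) x by exact: sF.
have cG s x (e : R) : 0 < e -> exists2 r : R, 0 < r & forall y, `|y - x| < r -> `|G s y - G s x| <= e.
  move=> e0; have e3 : 0 < e / 3 by rewrite divr_gt0.
  have [N HN] := cF s _ e3; have := differentiable_continuous (sFs N s x).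
  move=> /cvgrPdist_le/(_ _ e3)/nbhs_normP[r /= r0 Hr]; exists r => // y yx.
  have A := HN _ (leqnn _) y; have B := HN _ (leqnn _) x.
  have C : `|foldr pderiv (F N) s x - foldr pderiv (F N) s y| <= e / 3.
    by apply: Hr => /=; rewrite distrC.
  move: A B C; rewrite !ler_norml => /andP[? ?] /andP[? ?] /andP[? ?].
  by apply/andP; split; lra.
have D s x : differentiable (G s) x /\ forall i, pderiv i (G s) x = G (i :: s) x.
  apply: differentiable_gradient => e e0.
  (* Each of the d coordinates contributes an error c + c, one [c] from uniform convergence and one
     from the continuity of [G (i :: s)]. Using d + 1 avoids a division by 0 in dimension 0. *)
  pose c : R := e / (2 * (d%:R + 1)).
  have d1 : 0 < d%:R + 1 :> R by rewrite ltr_pwDr.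
  have c0 : 0 < c by rewrite divr_gt0// mulr_gt0.
  have [r r0 Hr] : exists2 r : R, 0 < r &
      forall i y, `|y - x| < r -> `|G (i :: s) y - G (i :: s) x| <= c.
    have /choice[r Hr] i := (exists2P _ _).1 (cG (i :: s) x _ c0).
    exists (\big[Num.min/1]_i r i); first by apply/bigmin_gtP; split => // i _; exact: (Hr i).1.
    move=> i y /bigmin_gtP[_ yx]; apply: (Hr i).2; exact: yx.
  exists r => // v vr.
  have [N1 HN1] : exists N, forall i n, (N <= n)%N -> forall y,
      `|foldr pderiv (F n) (i :: s) y - G (i :: s) y| <= c.
    have /choice[N HN] i := cF (i :: s) _ c0.
    exists (\max_i N i) => i n Nn; apply: HN; exact: leq_trans (leq_bigmax _) Nn.
  (* For a fixed increment [v] the index n may depend on the slack [a], which pays for replacing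
     [G s] by a derivative of [F n] at both end points. *)
  apply/ler_addgt0Pr => /= a a0; have a2 : 0 < a / 2 by rewrite divr_gt0.
  have [N2 HN2] := cF s _ a2.
  pose n := maxn N1 N2; pose f := foldr pderiv (F n) s.
  have [b /andP[b0 b1]] := mean_value_line x v (sFs n s).
  rewrite derive_sum_pderiv// -/(dot_row (fun i => pderiv i f (x + b *: v)) v) -/f => E.
  have A y : `|f y - G s y| <= a / 2 by apply: HN2; rewrite leq_maxr.
  have -> : G s (x + v) - G s x - dot_row ((G^~ x) \o (cons^~ s)) v =
     (dot_row (fun i => pderiv i f (x + b *: v) - G (i :: s) x) v)
     + ((f x - G s x) - (f (x + v) - G s (x + v))).
    have -> : dot_row (fun i => pderiv i f (x + b *: v) - G (i :: s) x) v =
        (f (x + v) - f x) - dot_row ((G^~ x) \o (cons^~ s)) v.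
      rewrite E /dot_row -sumrB; apply: eq_bigr => i _; exact: mulrBr.
    lra.
  apply: le_trans (ler_normD _ _) _; apply: lerD; last first.
    rewrite (splitr a); apply: le_trans (ler_normB _ _) _; exact: lerD.
  have gc i : `|pderiv i f (x + b *: v) - G (i :: s) x| <= c + c.
    rewrite -(subrK (G (i :: s) (x + b *: v)) (pderiv i f (x + b *: v))) -addrA.
    apply: le_trans (ler_normD _ _) _; apply: lerD.
      by apply: (HN1 i n _ _); rewrite leq_maxl.
    apply: Hr; rewrite addrAC subrr add0r normrZ (le_lt_trans _ vr)// ger0_norm//.
    by rewrite ler_piMl.
  apply: le_trans (norm_dot_row_le v gc) _.
  apply: ler_wpM2r => //; have -> : e = c * 2 * (d%:R + 1).
    by rewrite /c; field; rewrite gt_eqF.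
  rewrite (mulrC d%:R) (_ : c + c = c * 2); last by rewrite mulr_natr mulr2n.
  by rewrite ler_wpM2l// ?mulr_ge0 ?lerDl// ltW.
have E s : foldr pderiv (G [::]) s = G s.
  by elim: s => //= i s ->; apply/funext => x; exact: (D s x).2.
split=> // s x _; rewrite E; exact: (D s x).1.
Qed.

End gradient.

(** * Partitions of unity *)

Section flat.
Context {R : realType}.
Implicit Types (t : R) (k : nat).

(** The classical flat function is the case k = 0. The powers of 1/t are included so that the family
    is stable under derivation up to linear combinations. *)
Definition flat k t : R := if 0 < t then t^-1 ^+ k * expR (- t^-1) else 0.

Lemma flat_ge0 k t : 0 <= flat k t.
Proof.
rewrite /flat; case: ifP => // /ltW t0.
by rewrite mulr_ge0 ?expR_ge0// exprn_ge0// invr_ge0.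
Qed.

(** The exponential dominates the term of order k + 2 of its series. The bound is quadratic in order
    to make the derivative at 0 vanish. *)
Lemma flat_le k t : flat k t <= k.+2`!%:R * t ^+ 2.
Proof.
rewrite /flat; case: ifP => [t0|_]; last by rewrite mulr_ge0// sqr_ge0.
have i0 : 0 < t^-1 by rewrite invr_gt0.
have f0 : 0 < k.+2`!%:R :> R by rewrite ltr0n fact_gt0.
rewrite expRN ler_pdivrMr ?expR_gt0// -mulrA.
apply: (@le_trans _ _ (k.+2`!%:R * (t ^+ 2 * (t^-1 ^+ k.+2 / k.+2`!%:R)))).
  rewrite -addn2 exprD [leRHS](_ : _ = t^-1 ^+ k)//.
  by rewrite addn2; field; rewrite !gt_eqF.
apply: ler_wpM2l; first exact: ltW.
apply: ler_wpM2l; first exact: sqr_ge0.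
have := expR_ge1Dxn k.+1 (ltW i0); apply: le_trans.
by rewrite lerDr.
Qed.

Lemma is_derive_flat k t :
  is_derive t 1 (flat k) (flat k.+2 t - k%:R * flat k.+1 t).
Proof.
have [t0|t0|->] := ltgtP t 0.
- have E : \forall u \near t, cst 0 u = flat k u.
    near=> u; rewrite /flat ifF//; apply/negbTE; rewrite -leNgt ltW//.
    by near: u; exact: lt_nbhsl.
  have -> : flat k.+2 t - k%:R * flat k.+1 t = 0.
    by rewrite /flat ltNge ltW// mulr0 subr0.
  by apply: near_eq_is_derive E _; exact: is_derive_cst.
- have Di : is_derive t 1 (fun y : R => y^-1) (- t^-1 ^+ 2).
    have t0' : t != 0 by rewrite gt_eqF.
    split; first exact: (derivableV t0' (@derivable_id _ _ t 1)).
    by rewrite (deriveV t0' (@derivable_id _ _ t 1)) derive_id exprVn; exact: mulr1.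
  have E : \forall u \near t, ((fun y => y^-1) ^+ k * (expR \o (fun y => - y^-1))) u = flat k u.
    near=> u; rewrite /flat ifT; last by near: u; exact: lt_nbhsr.
    by rewrite fctE /= exprfctE.
  have De : is_derive t 1 (expR \o (fun y : R => - y^-1)) (expR (- t^-1) * t^-1 ^+ 2).
    have Dn : is_derive t 1 (fun y : R => - y^-1) (t^-1 ^+ 2).
      by rewrite -(opprK (t^-1 ^+ 2)); exact: is_deriveN.
    exact: is_derive1_comp.
  have D : is_derive t 1 ((fun y : R => y^-1) ^+ k * (expR \o (fun y => - y^-1)))
     (flat k.+2 t - k%:R * flat k.+1 t).
    apply: is_derive_eq; rewrite /flat t0 /= exprfctE.
    case: k {E} => [|k] /=.
      by rewrite /GRing.scale /=; ring.
    by rewrite !exprS /GRing.scale /=; ring.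
  exact: near_eq_is_derive E D.
- have z j : flat j 0 = 0 by rewrite /flat ltxx.
  rewrite !z mulr0 subr0.
  suff : (fun h : R => h^-1 *: ((flat k \o shift 0) (h *: 1) - flat k 0)) @ 0^' --> (0 : R).
    by move=> c; split; [apply/cvg_ex; exists 0|exact: cvg_lim c].
  rewrite z; apply/cvgr0Pnorm_le => e e0.
  pose c : R := k.+2`!%:R; have c0 : 0 < c by rewrite ltr0n fact_gt0.
  near=> h; have h0 : h != 0 by near: h; exact: nbhs_dnbhs_neq.
  have hc : `|h| <= e / c.
    near: h; apply: nbhs_dnbhs; apply/nbhs_normP; exists (e / c); first by rewrite /= divr_gt0.
    by move=> h /=; rewrite sub0r normrN => /ltW.
  rewrite /= subr0 addr0 [h *: 1]mulr1 [_ *: _]mulrC normrM normfV ler_pdivrMr ?normr_gt0//.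
  rewrite ger0_norm ?flat_ge0//; apply: le_trans (flat_le _ _) _.
  rewrite -real_normK ?num_real// expr2 mulrA ler_wpM2r// mulrC -ler_pdivlMr//.
Unshelve. all: by end_near. Qed.

End flat.

Section smooth_ball_bump.
Context {R : realType} {d : nat}.
Local Notation V := 'rV[R]_d.
Implicit Types (A : set V) (f : V -> R) (x c : V).

Lemma pderiv_flat k f x : differentiable f x ->
  differentiable (flat k \o f) x /\
  forall i, pderiv i (flat k \o f) x = (flat k.+2 (f x) - k%:R * flat k.+1 (f x)) * pderiv i f x.
Proof.
move=> df; have [D E] := is_derive_flat k (f x).
have dk : differentiable (flat k) (f x) by exact/derivable1_diffP.
have dc : differentiable (flat k \o f) x by exact: differentiable_comp.
split=> // i; rewrite [LHS]deriveE// diff_comp//= deriv1E// derive1E E.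
by rewrite /pderiv deriveE//; exact: mulrC.
Qed.

Lemma smooth_flat A f k : open A -> smooth_on A f -> smooth_on A (flat k \o f).
Proof.
move=> oA sf; apply/smooth_onP => n.
have Df j x : A x -> differentiable (flat j \o f) x.
  by move=> Ax; exact: (pderiv_flat j (sf [::] x Ax)).1.
have /smooth_onP Cf := sf.
elim: n k => [|n IH] k; split=> //; [exact: Df|exact: Df|move=> i].
apply: (@Cn_local _ _ _ _ (((flat k.+2 \o f) \+ (fun=> - k%:R) \* (flat k.+1 \o f))
    \* pderiv i f)) => //.
  by move=> x /set_mem Ax; rewrite (pderiv_flat k (sf [::] x Ax)).2 /= mulNr.
apply: (CnM oA) => //; last by have [_] := Cf n.+1; apply.
by apply: (CnD oA) => //; apply: (CnM oA) => //; exact: Cn_cst.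
Qed.

Lemma smoothV A f : open A -> (forall x, A x -> f x != 0) -> smooth_on A f ->
  smooth_on A (fun x => (f x)^-1).
Proof.
move=> oA f0 sf; apply/smooth_onP => n; have /smooth_onP Cf := sf.
have Df x : A x -> differentiable (fun x => (f x)^-1) x.
  by move=> Ax; apply: differentiableV; [exact: (sf [::])|exact: f0].
elim: n => [|n IH]; split=> // i.
apply: (@Cn_local _ _ _ _ (((fun=> -1) \* ((fun x => (f x)^-1) \* (fun x => (f x)^-1)))
    \* pderiv i f)) => //.
  move=> x /set_mem Ax; rewrite {2}/pderiv deriveV ?f0//.
    by rewrite /= mulN1r -invfM -expr2.
  exact/diff_derivable/(sf [::]).
apply: (CnM oA) => //; last by have [_] := Cf n.+1; apply.
by apply: (CnM oA); [exact: Cn_cst|exact: CnM].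
Qed.

(** The standard smooth transition from 0 on the negative half-line to 1 beyond 1; the denominator
    never vanishes. *)
Definition step (t : R) : R := flat 0 t / (flat 0 t + flat 0 (1 - t)).

Lemma flat0_gt0 (t : R) : 0 < t -> 0 < flat 0 t.
Proof. by move=> t0; rewrite /flat t0 expr0 mul1r expR_gt0. Qed.

Lemma step_denom_gt0 (t : R) : 0 < flat 0 t + flat 0 (1 - t).
Proof.
have [t0|t0] := ltP 0 t.
  by rewrite ltr_wpDr ?flat_ge0// flat0_gt0.
by rewrite ltr_wpDl ?flat_ge0// flat0_gt0// subr_gt0 (le_lt_trans t0).
Qed.

Lemma step_ge0 t : 0 <= step t.
Proof. by rewrite divr_ge0 ?flat_ge0// ltW// step_denom_gt0. Qed.

Lemma step_le1 t : step t <= 1.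
Proof. by rewrite ler_pdivrMr ?step_denom_gt0// mul1r lerDl flat_ge0. Qed.

Lemma step1 t : 1 <= t -> step t = 1.
Proof.
move=> t1; have := step_denom_gt0 t; rewrite /step.
have -> : flat 0 (1 - t) = 0 by rewrite /flat subr_gt0 ltNge t1.
by rewrite addr0 => f0; rewrite divff// gt_eqF.
Qed.

Lemma step0 t : t <= 0 -> step t = 0.
Proof. by move=> t0; rewrite /step /flat ltNge t0 mul0r. Qed.

Lemma smooth_step A f : open A -> smooth_on A f -> smooth_on A (step \o f).
Proof.
move=> oA sf; have s1 : smooth_on A (fun x => 1 - f x).
  under eq_fun do rewrite -mulN1r.
  apply: smoothD => //; first exact: smooth_cst.
  by apply: smoothM => //; exact: smooth_cst.
apply: (@smoothM _ _ _ (flat 0 \o f)) => //; first exact: smooth_flat.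
apply: smoothV => //; first by move=> x _; rewrite gt_eqF// step_denom_gt0.
apply: smoothD => //; first exact: smooth_flat.
by apply: (@smooth_flat _ (fun x => 1 - f x)).
Qed.

Lemma smooth_coord A i : smooth_on A (fun x : V => x 0 i).
Proof.
have E x : differentiable (fun x : V => x 0 i) x /\
    forall j, pderiv j (fun x : V => x 0 i) x = (i == j)%:R.
  apply: differentiable_gradient => e e0; exists 1 => // v _.
  rewrite mxE /dot_row (bigD1 i)//= eqxx mulr1 big1.
    by rewrite addr0 [X in X - _]addrAC subrr add0r subrr normr0 mulr_ge0// ltW.
  by move=> j ji; rewrite eq_sym (negbTE ji) mulr0.
apply/smooth_onP => -[|n]; split=> //.
1,2: by move=> x _; exact: (E x).1.
move=> j; rewrite (_ : pderiv j _ = fun=> (i == j)%:R); first exact: Cn_cst.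
by apply/funext => x; exact: (E x).2.
Qed.

(** Balls for the sup norm are cubes, so a product of one-dimensional bumps fits them: the
    transition from 1 to 0 takes place between the radii r and 2r. *)
Definition ball_bump c (r : R) : V -> R := fun x =>
  \prod_i (step (2 - (x 0 i - c 0 i) / r) * step (2 + (x 0 i - c 0 i) / r)).

Lemma smooth_ball_bump A c r : open A -> smooth_on A (ball_bump c r).
Proof.
move=> oA; apply/smooth_onP => n; apply: Cn_prod => // i.
have sl : smooth_on A (fun x : V => (x 0 i - c 0 i) / r).
  apply: smoothM => //; last exact: smooth_cst.
  by apply: smoothD => //; [exact: smooth_coord|exact: smooth_cst].
have s1 : smooth_on A (fun x : V => 2 + (x 0 i - c 0 i) / r).
  by apply: smoothD => //; exact: smooth_cst.
have s2 : smooth_on A (fun x : V => 2 - (x 0 i - c 0 i) / r).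
  under eq_fun do rewrite -mulN1r.
  apply: smoothD => //; first exact: smooth_cst.
  by apply: smoothM => //; exact: smooth_cst.
apply: CnM => //.
  by have /smooth_onP := smooth_step oA s2.
by have /smooth_onP := smooth_step oA s1.
Qed.

Lemma ball_bump_ge0 c r x : 0 <= ball_bump c r x.
Proof. by apply: prodr_ge0 => i _; rewrite mulr_ge0 ?step_ge0. Qed.

Lemma ball_bump_le1 c r x : ball_bump c r x <= 1.
Proof.
apply: prodr_ile1 => i _; rewrite mulr_ge0 ?step_ge0//=.
by rewrite -[leRHS]mulr1; apply: ler_pM; rewrite ?step_ge0 ?step_le1.
Qed.

Lemma ball_bump1 c r x : 0 < r -> `|x - c| <= r -> ball_bump c r x = 1.
Proof.
move=> r0 xc; apply: big1 => i _.
have : `|(x 0 i - c 0 i) / r| <= 1.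
  rewrite normrM normfV (gtr0_norm r0) ler_pdivrMr// mul1r.
  by have := norm_coord_le (x - c) i; rewrite !mxE => /le_trans; apply.
by rewrite ler_norml => /andP[? ?]; rewrite !step1 ?mulr1//; lra.
Qed.

Lemma ball_bump0 c r x : 0 < r -> 2 * r <= `|x - c| -> ball_bump c r x = 0.
Proof.
move=> r0 xc; have : exists i, 2 * r <= `|x 0 i - c 0 i|.
  apply: contrapT => /forallNP H; move: xc; apply/negP; rewrite -ltNge.
  rewrite [ `|_|]/Num.Def.normr /= mx_normrE; apply/bigmax_ltP; split.
    by rewrite mulr_gt0.
  move=> [a i] _ /=; rewrite ord1 !mxE ltNge; apply/negP; exact: H.
move=> [i xi]; rewrite /ball_bump (bigD1 i)//=.
have : 2 <= `|(x 0 i - c 0 i) / r|.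
  by rewrite normrM normfV (gtr0_norm r0) ler_pdivlMr.
rewrite ler_normr => /orP[u|u].
  by rewrite [step (2 - _)]step0 ?mul0r//; lra.
by rewrite [step (2 + _)]step0 ?mul0r ?mulr0 ?mul0r//; lra.
Qed.

Lemma closed_ball_compact c (r : R) : compact [set x : V | `|x - c| <= r].
Proof.
apply: bounded_closed_compact.
  exists (r + `|c|); split; first exact: num_real.
  move=> M rM x /= xc; apply: le_trans (ltW rM).
  by rewrite -(subrK c x); apply: le_trans (ler_normD _ _) _; rewrite lerD2r.
rewrite (_ : [set x : V | _] = closed_ball_ Num.norm c r).
  exact: closed_closed_ball_.
by apply/funext => x; rewrite /closed_ball_ /= distrC.
Qed.

End smooth_ball_bump.

Lemma compact_nat_subcover (T : ptopologicalType) (K : set T) (B : nat -> set T) :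
  compact K -> (forall l, open (B l)) -> K `<=` \bigcup_l B l ->
  exists L, forall x, K x -> exists2 l, (l < L)%N & B l x.
Proof.
rewrite compact_cover => cK oB KB.
have [|D _ DK] := cK nat setT B _ KB; first by move=> l _; exact: oB.
have /finite_seqP[D' DE] := finite_fset D.
exists (\max_(l <- D') l).+1 => x /DK[l]; rewrite DE /= => lD Bx.
by exists l => //; rewrite ltnS; exact: leq_bigmax_seq.
Qed.

Section partition.
Context {R : realType} {d : nat}.
Local Notation V := 'rV[R]_d.
Implicit Types (K : set V) (x c : V).

Lemma norm_row_lt x (e : R) : 0 < e -> (forall i, `|x 0 i| < e) -> `|x| < e.
Proof.
move=> e0 H; rewrite [ `|x|]/Num.Def.normr /= mx_normrE; apply/bigmax_ltP; split => //.
by move=> -[a i] _ /=; rewrite ord1.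
Qed.

Lemma rational_point_near x (e : R) : 0 < e ->
  exists q : 'rV[rat]_d, `|x - map_mx ratr q| < e.
Proof.
move=> e0; have /choice[q Hq] (i : 'I_d) : exists q : rat, ratr q \in `]x 0 i - e, x 0 i + e[.
  by apply: rat_in_itvoo; lra.
exists (\row_i q i); apply: norm_row_lt => // i; rewrite !mxE.
by have := Hq i; rewrite in_itv /= ltr_norml => /andP[? ?]; apply/andP; split; lra.
Qed.

Lemma exists_inv_nat_lt (e : R) : 0 < e -> exists n, n.+1%:R^-1 < e.
Proof.
by move=> /ltr_add_invr[n]; rewrite add0r; exists n.
Qed.

(** The telescoping identity behind [partition_of_unity]: the sum reaches 1 as soon as one factor
    vanishes, without any division by a total mass. *)
Lemma sum_prod_onem (s : nat -> R) n :
  \sum_(l < n) s l * \prod_(k < l) (1 - s k) = 1 - \prod_(k < n) (1 - s k).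
Proof.
elim: n => [|n IH]; first by rewrite !big_ord0 subrr.
by rewrite !big_ord_recr /= IH; ring.
Qed.

(** The bumps [s l] are indexed by codes of pairs of a rational centre and an inverse integer
    radius. Finitely many of the balls on which [s l] is 1 cover a compact set, and beyond them the
    product in [eta] is 0 there. The case where [eta l] vanishes identically is that of a code of no
    admissible pair. *)
Lemma partition_of_unity (Om : set V) (I : Type) (U : I -> set V) :
  (forall i, open (U i)) -> Om `<=` \bigcup_i U i ->
  exists eta zeta : nat -> V -> R,
  [/\ forall l, smooth_on setT (eta l) /\ smooth_on setT (zeta l),
      forall l, (forall x, eta l x = 0) \/ (exists i K, [/\ compact K, K `<=` U i &
         forall x, ~ K x -> eta l x = 0 /\ zeta l x = 0]),
      forall l x, zeta l x * eta l x = eta l x &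
      forall K, compact K -> K `<=` Om -> exists L, forall x, K x ->
        \sum_(l < L) eta l x = 1 /\ forall l, (L <= l)%N -> eta l x = 0].
Proof.
move=> oU cU.
pose ctr (p : 'rV[rat]_d * nat) : V := map_mx ratr p.1.
pose rad (p : 'rV[rat]_d * nat) : R := p.2.+1%:R^-1.
have rad0 p : 0 < rad p by rewrite invr_gt0.
(* [s l] vanishes outside radius 2 [rad p]; [zeta l] is 1 inside this radius and vanishes outside
   radius 4 [rad p]. *)
pose valid p := `[< exists i, [set x | `|x - ctr p| <= 4 * rad p] `<=` U i >].
pose s l : V -> R := if unpickle l is Some p then
  if valid p then ball_bump (ctr p) (rad p) else fun=> 0 else fun=> 0.
pose zeta l : V -> R := if unpickle l is Some p then
  if valid p then ball_bump (ctr p) (2 * rad p) else fun=> 0 else fun=> 0.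
pose eta l : V -> R := fun x => s l x * \prod_(k < l) (1 - s k x).
have ss l : smooth_on setT (s l).
  rewrite /s; case: (unpickle l) => [p|]; last exact: smooth_cst.
  by case: ifP => _; [apply: smooth_ball_bump; exact: openT|exact: smooth_cst].
exists eta, zeta; split.
- move=> l; split.
    apply: smoothM => //; first exact: openT.
    apply/smooth_onP => n; apply: Cn_prod => [|k]; first exact: openT.
    under eq_fun do rewrite -mulN1r.
    apply: CnD; [exact: openT|exact: Cn_cst|].
    apply: CnM; [exact: openT|exact: Cn_cst|].
    by have /smooth_onP := ss k.
  rewrite /zeta; case: (unpickle l) => [p|]; last exact: smooth_cst.
  by case: ifP => _; [apply: smooth_ball_bump; exact: openT|exact: smooth_cst].
- move=> l; rewrite /eta /zeta /s; case: (unpickle l) => [p|]; last first.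
    by left=> x; rewrite mul0r.
  case: ifP => [|_]; last by left=> x; rewrite mul0r.
  move=> /asboolP[i pU]; right; exists i, [set x | `|x - ctr p| <= 4 * rad p].
  split=> //; first exact: closed_ball_compact.
  move=> x /negP; rewrite -ltNge => xp; split.
    rewrite ball_bump0 ?mul0r//; apply: le_trans (ltW xp).
    by rewrite ler_pM2r// ler_nat.
  rewrite ball_bump0 ?mulr_gt0//; apply: le_trans (ltW xp).
  by rewrite mulrA -natrM.
- move=> l x; rewrite /eta mulrA; congr (_ * _); rewrite /zeta /s.
  case: (unpickle l) => [p|]; last by rewrite mul0r.
  case: ifP => _; last by rewrite mul0r.
  have [xp|/ltW xp] := leP `|x - ctr p| (2 * rad p).
    by rewrite ball_bump1 ?mul1r// mulr_gt0.
  by rewrite [ball_bump _ (rad p) _]ball_bump0 ?mulr0.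
- move=> K cK KO.
  pose B l : set V := if unpickle l is Some p then
    if valid p then ball (ctr p) (rad p) else set0 else set0.
  have sB l x : B l x -> s l x = 1.
    rewrite /B /s; case: (unpickle l) => [p|//]; case: ifP => // _.
    by rewrite -ball_normE /= distrC => /ltW xp; rewrite ball_bump1.
  have [l|x Kx|L HL] := @compact_nat_subcover _ K B cK.
  + rewrite /B; case: (unpickle l) => [p|]; last exact: open0.
    by case: ifP => _; [exact: ball_open|exact: open0].
  + have [i _ Ux] := cU _ (KO _ Kx).
    have /nbhs_ballP[r /= r0 rU] := open_nbhs_nbhs (conj (oU i) Ux).
    (* The ball of radius 4/(n+1) about a centre at distance less than 1/(n+1) from [x] must stay
       within r of [x]. *)
    have r5 : 0 < r / 5 by rewrite divr_gt0.
    have [n nr] := exists_inv_nat_lt r5.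
    have n0 : 0 < n.+1%:R^-1 :> R by rewrite invr_gt0.
    have [q xq] := rational_point_near x n0.
    exists (pickle (q, n)) => //; rewrite /B pickleK.
    have -> : valid (q, n).
      apply/asboolP; exists i => y /= yq; apply: rU; rewrite -ball_normE /=.
      have -> : x - y = (x - map_mx ratr q) - (y - map_mx ratr q) by rewrite opprB addrA subrK.
      apply: le_lt_trans (ler_normB _ _) _; move: xq yq nr; rewrite /ctr /rad /=.
      by move: (n.+1%:R^-1) `|_ - _| `|y - _| => a b c; lra.
    by rewrite -ball_normE /= distrC.
  exists L => x /HL[l lD Bx].
  have p0 M : (L <= M)%N -> \prod_(k < M) (1 - s k x) = 0.
    move=> LM; have lM : (l < M)%N := leq_trans lD LM.
    by rewrite (bigD1 (Ordinal lM))//= sB// subrr mul0r.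
  split; first by rewrite (sum_prod_onem (s^~ x)) p0// subr0.
  by move=> M LM; rewrite /eta p0// mulr0.
Qed.

End partition.

(** * Distributions as functionals of locally finite order *)

(** There are finitely many lists of length at most [m], so constants depending on the list have a
    common bound. *)
Lemma le_sum_seq_tuple (R : realType) (T : finType) (c : seq T -> R) (m : nat) (s : seq T) :
  (forall t, 0 <= c t) -> (size s <= m)%N ->
  c s <= \sum_(k < m.+1) \sum_(t : k.-tuple T) c t.
Proof.
move=> c0 sm; have sm' : (size s < m.+1)%N by rewrite ltnS.
rewrite (bigD1 (Ordinal sm'))//= (bigD1 (in_tuple s))//= -addrA lerDl.
by apply: addr_ge0; apply: sumr_ge0 => // i _; apply: sumr_ge0.
Qed.

Section complex_estimates.
Context {R : realType} {d : nat}.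
Local Notation C := R[i].
Local Notation V := 'rV[R]_d.
Local Notation Re := complex.Re.
Local Notation Im := complex.Im.
Local Notation normc := Normc.normc.
Local Notation partials f s := (foldr pderiv f s).
Implicit Types (A B K : set V) (f g h : V -> C).

Lemma normc_le_ReIm (z : C) : normc z <= `|Re z| + `|Im z|.
Proof.
have := le_normcD (Re z)%:C (0 +i* Im z).
rewrite (_ : _ + _ = z).
  by rewrite /= !expr0n /= addr0 add0r !sqrtr_sqr.
by apply/eqP; rewrite eq_complex CReD CImD /= addr0 add0r !eqxx.
Qed.

Lemma norm_Re_le (z : C) : `|Re z| <= normc z.
Proof. by rewrite -lecR; exact: normc_ge_Re. Qed.

Lemma norm_Im_le (z : C) : `|Im z| <= normc z.
Proof.
case: z => a b /=; rewrite -sqrtr_sqr ler_wsqrtr// lerDr; exact: sqr_ge0.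
Qed.

Lemma foldr_Cpderiv f s : foldr Cpderiv f s =
  fun x => partials (fun y => Re (f y)) s x +i* partials (fun y => Im (f y)) s x.
Proof. by elim: s => /= [|i s ->]; apply/funext => x //; case: (f x). Qed.

(** The seminorm of order [m] on [P], over lists of indices and for real and imaginary parts
    separately. Compared with the moduli in [nbhs0_on], this changes constants only. *)
Definition deriv_le (m : nat) (e : R) (P : set V) f := forall s x, (size s <= m)%N -> P x ->
  `|partials (fun y => Re (f y)) s x| <= e /\ `|partials (fun y => Im (f y)) s x| <= e.

Lemma deriv_le_support m (e : R) K f : 0 <= e -> support_set f `<=` K ->
  deriv_le m e K f -> deriv_le m e setT f.
Proof.
move=> e0 fK H s x sm _; have [Kx|NK] := pselect (K x); first exact: H.
have : foldr Cpderiv f s x = 0 by apply: support0 => /foldr_support/fK.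
rewrite foldr_Cpderiv => /eqP; rewrite eq_complex => /andP[/eqP /= -> /eqP /= ->].
by rewrite normr0.
Qed.

Lemma partials_comp_mul_bounds A B (theta : V -> V) (w : V -> R) K m : open A ->
  (forall x, A x -> B (theta x)) -> (forall j, smooth_on A (coordf theta j)) ->
  smooth_on A w -> compact K -> K `<=` A ->
  exists2 c : R, 0 <= c & forall (h : V -> R) (e : R), smooth_on B h ->
    (forall t x, (size t <= m)%N -> K x -> `|partials h t (theta x)| <= e) ->
    forall s x, (size s <= m)%N -> K x -> `|partials ((h \o theta) \* w) s x| <= c * e.
Proof.
move=> oA AB st sw cK KA.
have /choice[c Hc] s := (exists2P _ _).1 (partials_comp_mul_bound s oA AB st sw cK KA).
exists (\sum_(k < m.+1) \sum_(t : k.-tuple 'I_d) c t).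
  by apply: sumr_ge0 => k _; apply: sumr_ge0 => t _; have [] := Hc t.
move=> h e sh H s x sm Kx; have e0 : 0 <= e.
  by apply: le_trans (H [::] x _ Kx).
apply: (@le_trans _ _ (c s * e)).
  by apply: (Hc s).2 => // t y ts Ky; apply: H => //; exact: leq_trans sm.
by apply: ler_wpM2r => //; apply: le_sum_seq_tuple => // t; have [] := Hc t.
Qed.

(** This single estimate serves both multiplication by smooth functions, with [theta] the identity,
    and change of variables, with [w] the Jacobian factor. The summand 1 in the constant makes it
    positive. *)
Lemma deriv_le_comp_mul A B (theta : V -> V) (w : V -> C) K m : open A -> open B ->
  (forall x, A x -> B (theta x)) -> (forall j, smooth_on A (coordf theta j)) ->
  Csmooth_on A w -> compact K -> K `<=` A ->
  exists2 c : R, 0 < c & forall h (e : R), Csmooth_on B h ->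
    deriv_le m e (theta @` K) h -> deriv_le m (c * e) K (fun x => h (theta x) * w x).
Proof.
move=> oA oB AB st [sr si] cK KA.
have [c1 c10 H1] := partials_comp_mul_bounds m oA AB st sr cK KA.
have [c2 c20 H2] := partials_comp_mul_bounds m oA AB st si cK KA.
exists (c1 + c2 + 1) => [|h e [hr hi] H s x sm Kx].
  by rewrite ltr_pwDr// addr_ge0.
have e0 : 0 <= e by apply: le_trans (H [::] (theta x) _ _).1 => //; exists x.
have Hr t y : (size t <= m)%N -> K y -> `|partials (fun y => Re (h y)) t (theta y)| <= e.
  by move=> tm Ky; apply: (H _ _ tm _).1; exists y.
have Hi t y : (size t <= m)%N -> K y -> `|partials (fun y => Im (h y)) t (theta y)| <= e.
  by move=> tm Ky; apply: (H _ _ tm _).2; exists y.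
have hir : smooth_on B (fun y => - Im (h y)) by exact: smoothN.
have sc (k : V -> R) : smooth_on B k -> smooth_on A (k \o theta).
  by move=> sk; exact: smooth_comp AB sk st.
have Hir t y : (size t <= m)%N -> K y -> `|partials (fun y => - Im (h y)) t (theta y)| <= e.
  move=> tm Ky; rewrite (_ : (fun y => - Im (h y)) = fun y => -1 * Im (h y)).
    by rewrite (partialsZ _ _ oB)//; [rewrite mulN1r normrN; exact: Hi|exact/AB/KA].
  by apply/funext => z; rewrite mulN1r.
have Ax := KA _ Kx.
have le2 (k1 k2 : V -> R) : smooth_on A k1 -> smooth_on A k2 ->
    `|partials k1 s x| <= c1 * e -> `|partials k2 s x| <= c2 * e ->
    `|partials (k1 \+ k2) s x| <= (c1 + c2 + 1) * e.
  move=> sk1 sk2 k1e k2e; rewrite (partialsD _ oA)//.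
  apply: le_trans (ler_normD _ _) _; apply: le_trans (lerD k1e k2e) _.
  by rewrite -mulrDl ler_wpM2r// lerDl.
split.
  rewrite (_ : (fun y => Re _) = ((fun y => Re (h y)) \o theta) \* (fun y => Re (w y)) \+
     ((fun y => - Im (h y)) \o theta) \* (fun y => Im (w y))); last first.
    by apply/funext => y; rewrite CReM /= mulNr.
  apply: le2; [| |exact: H1|exact: H2].
  - by apply: smoothM => //; exact: sc.
  - by apply: smoothM => //; apply: (sc (fun y => - Im (h y))).
rewrite (_ : (fun y => Im _) = ((fun y => Im (h y)) \o theta) \* (fun y => Re (w y)) \+
   ((fun y => Re (h y)) \o theta) \* (fun y => Im (w y))); last first.
  by apply/funext => y; rewrite CImM /= addrC.
apply: le2; [| |exact: H1|exact: H2].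
- by apply: smoothM => //; exact: sc.
- by apply: smoothM => //; exact: sc.
Qed.

Lemma deriv_le_mul A (w : V -> C) K m : open A -> Csmooth_on A w ->
  compact K -> K `<=` A ->
  exists2 c : R, 0 < c & forall h (e : R), Csmooth_on A h ->
    deriv_le m e K h -> deriv_le m (c * e) K (fun x => h x * w x).
Proof.
move=> oA sw cK KA; have [//|j|c c0 H] := deriv_le_comp_mul (B := A) (theta := id) m oA oA _ _ sw cK KA.
  exact: smooth_coord.
by exists c => // h e sh hK; apply: H => //; rewrite image_id.
Qed.

End complex_estimates.

Section distribution_estimates.
Context {R : realType} {d : nat}.
Local Notation C := R[i].
Local Notation V := 'rV[R]_d.
Local Notation Re := complex.Re.
Local Notation Im := complex.Im.
Local Notation normc := Normc.normc.
Implicit Types (Om X Y : opens R d) (K : set V).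

Lemma test_smooth Om (phi : test Om) : Csmooth_on setT phi.
Proof. by have /is_testP[] := tfunP phi. Qed.

Lemma test_support_compact Om (phi : test Om) : compact (support_set phi).
Proof. by have /is_testP[] := tfunP phi. Qed.

Lemma test_support Om (phi : test Om) : support_set phi `<=` Om.
Proof. by have /is_testP[] := tfunP phi. Qed.

Lemma Cpartial_deriv_le (m : nat) (e : R) (f : V -> C) : Csmooth_on setT f ->
  (forall al, (midx_deg al <= m)%N -> forall x, `|Cpartial al f x| <= e%:C) ->
  deriv_le m e setT f.
Proof.
move=> [Sr Si] H s x sm _.
have := H (fun i => count_mem i s); rewrite midx_deg_count => /(_ sm x).
rewrite /Cpartial foldr_Cpderiv lecR.
rewrite -(perm_partials Sr (perm_midx_seq s)) -(perm_partials Si (perm_midx_seq s)).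
set z := _ +i* _ => h.
by split; [exact: le_trans (norm_Re_le z) h|exact: le_trans (norm_Im_le z) h].
Qed.

Lemma deriv_leZ (m : nat) (e a : R) Om (phi : test Om) : 0 <= a -> deriv_le m e setT phi ->
  deriv_le m (a * e) setT (a%:C *: phi : test Om).
Proof.
move=> a0 H s x sm _; have [Sr Si] := test_smooth phi; have [hr hi] := H s x sm I.
have -> : (fun y => Re ((a%:C *: phi : test Om) y)) = fun y => a * Re (phi y).
  by apply/funext => y; rewrite -[LHS]/(Re (a%:C * phi y)) CReM /= mul0r subr0.
have -> : (fun y => Im ((a%:C *: phi : test Om) y)) = fun y => a * Im (phi y).
  by apply/funext => y; rewrite -[LHS]/(Im (a%:C * phi y)) CImM /= mul0r addr0.
rewrite !(partialsZ _ _ (@openT _))// !normrM (ger0_norm a0).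
by split; exact: ler_wpM2l.
Qed.

(** For the finest locally convex topology a linear functional is continuous as soon as it is so on
    each D_K, where homogeneity turns a neighbourhood of 0 into an estimate by one seminorm. *)
Lemma DprimeP Om (T : Dstar Om) : Dprime Om T <->
  forall K, compact K -> K `<=` Om -> exists (m : nat) (c : R), 0 < c /\
    forall (phi : test Om) (e : R), 0 < e -> support_set phi `<=` K ->
      deriv_le m e setT phi -> normc (T phi) <= c * e.
Proof.
split=> [cT K cK KO|H phi].
  have : \forall psi \near (0 : test Om), normc (T psi) < 1.
    have /cvgrPdist_lt/(_ 1 ltr01) : T psi @[psi --> (0 : test Om)] --> T 0 by exact: cT.
    apply: filterS => psi; rewrite linear0.
    by rewrite sub0r normrN ltcE => /andP[].
  move=> [W [_ /(_ K cK KO)[m [e0 [e00 WK]]]] HW].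
  exists m, (4 / e0); split; first by rewrite divr_gt0.
  (* After scaling by [a], real and imaginary parts of the derivatives are at most e0 / 4, so the
     moduli are below e0. *)
  move=> phi e ep sphi le; pose a : R := e0 / (4 * e).
  have a0 : 0 < a by rewrite divr_gt0// mulr_gt0.
  have : W (a%:C *: phi).
    apply: WK.
      apply: subset_trans sphi; apply: closureS => x /=; apply: contra => /eqP p0.
      by rewrite -[_ x]/(a%:C * phi x) p0 mulr0.
    move=> al am x; have /(_ (midx_seq al) x)[||hr hi] := deriv_leZ (ltW a0) le => //.
      rewrite /midx_seq size_flatten /shape -map_comp sumnE big_map big_enum /=.
      by rewrite (eq_bigr al)// => i _; rewrite size_nseq.
    rewrite [tpartial al _ x](congr1 (fun f => f x) (foldr_Cpderiv _ _)) ltcR.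
    apply: le_lt_trans (normc_le_ReIm _) _; apply: le_lt_trans (lerD hr hi) _.
    rewrite /a; have -> : e0 / (4 * e) * e = e0 / 4 by field; rewrite gt_eqF.
    by lra.
  move=> Wa; have := HW (a%:C *: phi); rewrite subr0 => /(_ Wa).
  rewrite linearZ /= -[X in normc X]/(a%:C * T phi) Normc.normcM /= expr0n addr0 sqrtr_sqr gtr0_norm//.
  rewrite -ltr_pdivlMl// mulr1 => /ltW/le_trans; apply.
  by rewrite /a invf_div mulrAC.
have FF : Filter (nbhs (phi : test Om)) by exact: nbhs_filter.
apply/(@cvgrPdist_lt _ _ _ _ FF) => e e0.
have [r r0 ->] : exists2 r : R, 0 < r & e = r%:C.
  by move: e0; case: e => a b; rewrite ltcE /= => /andP[/eqP -> a0]; exists a.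
(* Linearity makes this sublevel set absolutely convex, and the estimates make it a neighbourhood of
   0 in every D_K: it belongs to the base. *)
exists [set psi | normc (T psi) <= r / 2].
  split.
    move=> a b p q ab /= Tp Tq; rewrite linearD !linearZ.
    apply: le_trans (le_normcD _ _) _; rewrite !Normc.normcM.
    apply: (@le_trans _ _ ((normc a + normc b) * (r / 2))).
      by rewrite mulrDl lerD// ler_wpM2l// -?lecR; exact: (@normr_ge0 C C).
    have : normc a + normc b <= 1 by rewrite -lecR rmorphD.
    by move=> ?; rewrite ler_piMl// divr_ge0// ltW.
  move=> K cK KO; have [m [c [c0 Hc]]] := H K cK KO.
  exists m, (r / 2 / c); split; first by rewrite !divr_gt0.
  move=> psi sK le /=; rewrite -[leRHS](divfK (lt0r_neq0 c0)) mulrC.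
  apply: Hc => //; first by rewrite !divr_gt0.
  apply: Cpartial_deriv_le => [|al am x]; first exact: test_smooth.
  exact/ltW/le.
move=> psi /= Tpsi; rewrite -normrN opprB -linearB ltcR.
by apply: le_lt_trans Tpsi _; rewrite ltr_pdivrMr// mulrDr mulr1 ltrDl.
Qed.

End distribution_estimates.

(** * Stability of distributions under the operations *)

Section operations_on_distributions.
Context {R : realType} {d : nat}.
Local Notation C := R[i].
Local Notation V := 'rV[R]_d.
Local Notation Re := complex.Re.
Local Notation Im := complex.Im.
Local Notation normc := Normc.normc.
Implicit Types (Om X Y : opens R d) (K : set V).

(** The transpose of a map that sends each D_K continuously into some D_K' preserves the criterion
    of [DprimeP]. All the operations except addition are of this kind. *)
Lemma Dprime_comp X Y (A : {linear test Y -> test X}) (T : Dstar X) :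
  (forall K, compact K -> K `<=` Y -> exists K', [/\ compact K', K' `<=` X,
     forall phi : test Y, support_set phi `<=` K -> support_set (A phi) `<=` K' &
     forall m, exists (m' : nat) (c : R), 0 < c /\ forall (phi : test Y) (e : R), 0 < e ->
       support_set phi `<=` K -> deriv_le m' e setT phi ->
       deriv_le m (c * e) K' (A phi)]) ->
  Dprime X T -> Dprime Y (T \o A).
Proof.
move=> HA /DprimeP HT; apply/DprimeP => K cK KY.
have [K' [cK' K'X sA HAm]] := HA K cK KY.
have [m [c [c0 Hc]]] := HT K' cK' K'X; have [m' [c' [c'0 Hc']]] := HAm m.
exists m', (c * c'); split; first by rewrite mulr_gt0.
move=> phi e e0 sphi H; rewrite -mulrA; apply: Hc; first by rewrite mulr_gt0.
  exact: sA.
apply: deriv_le_support; [by rewrite mulr_ge0// ltW|exact: sA|exact: Hc'].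
Qed.

Lemma support_set_subset (f g : V -> C) : (forall x, f x = 0 -> g x = 0) ->
  support_set g `<=` support_set f.
Proof.
move=> fg; apply: closureS => x /=; apply: contra => /eqP/fg ->; exact: eqxx.
Qed.

Lemma Dprime_dmul Om (f : smoothfun Om) T : Dprime Om T -> Dprime Om (Defs.dmul f T).
Proof.
apply: Dprime_comp => K cK KO; exists K; split=> //.
  move=> phi; apply: subset_trans; apply: support_set_subset => x /= ->.
  exact: mulr0.
move=> m; have [c c0 H] := deriv_le_mul m (@oset_open _ _ Om) (sfunP f) cK KO.
exists m, c; split=> // phi e _ _ le.
rewrite (_ : (tmul f phi : V -> C) = fun x => phi x * f x).
  apply: H; first by apply: Csmooth_sub (test_smooth phi).
  by move=> s x sm _; exact: le.
by apply/funext => x /=; exact: mulrC.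
Qed.

Lemma dscale_dmul Om (c : C) (T : Dstar Om) :
  Defs.dscale c T =1 Defs.dmul (Smoothfun (@Csmooth_cst _ _ Om c)) T.
Proof. by move=> phi; rewrite /= -linearZ; congr (T _); exact: testP. Qed.

Lemma Dprime_ext Om (S T : Dstar Om) : S =1 T -> Dprime Om S -> Dprime Om T.
Proof. by move=> ST /DprimeP H; apply/DprimeP => K cK KO; have [m [c [c0 Hc]]] := H K cK KO;
  exists m, c; split=> // phi *; rewrite -ST; exact: Hc. Qed.

Lemma Dprime_dscale Om (c : C) T : Dprime Om T -> Dprime Om (Defs.dscale c T).
Proof.
move=> HT; apply: (Dprime_ext (fun phi => esym (dscale_dmul c T phi))).
exact: Dprime_dmul.
Qed.

Lemma Dprime_dzero Om : Dprime Om (dzero Om).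
Proof.
apply/DprimeP => K _ _; exists 0%N, 1; split=> // phi e e0 _ _.
by rewrite [dzero Om phi]/(0 : C) Normc.normc0 mul1r ltW.
Qed.

Lemma Dprime_dadd Om S T : Dprime Om S -> Dprime Om T -> Dprime Om (Defs.dadd S T).
Proof.
move=> /DprimeP HS /DprimeP HT; apply/DprimeP => K cK KO.
have [m [c [c0 Hc]]] := HS K cK KO; have [m' [c' [c'0 Hc']]] := HT K cK KO.
exists (maxn m m'), (c + c'); split; first by rewrite addr_gt0.
move=> phi e e0 sphi le; rewrite mulrDl.
apply: le_trans (le_normcD _ _) _; apply: lerD.
  by apply: Hc => // s x sm; apply: le; rewrite leq_max sm.
by apply: Hc' => // s x sm; apply: le; rewrite leq_max sm orbT.
Qed.

Lemma Dprime_dpartial Om al T : Dprime Om T -> Dprime Om (dpartial al T).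
Proof.
move=> HT; apply: (@Dprime_dscale Om ((-1) ^+ midx_deg al) (T \o tpartial al)).
apply: Dprime_comp HT => K cK KO; exists K; split=> //.
  by move=> phi; apply: subset_trans; exact: foldr_support.
move=> m; exists (m + size (midx_seq al))%N, 1; split=> // phi e _ _ le s x sm _.
rewrite mul1r (_ : (fun y => Re _) = foldr pderiv (fun y => Re (phi y)) (midx_seq al)); last first.
  by apply/funext => y; rewrite [tpartial al phi y](congr1 (fun f => f y) (foldr_Cpderiv _ _)).
rewrite (_ : (fun y => Im _) = foldr pderiv (fun y => Im (phi y)) (midx_seq al)); last first.
  by apply/funext => y; rewrite [tpartial al phi y](congr1 (fun f => f y) (foldr_Cpderiv _ _)).
by rewrite -!foldr_cat; apply: le => //; rewrite size_cat leq_add2r.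
Qed.

Lemma Dprime_restr X Om (XO : X `<=` Om) T : Dprime Om T -> Dprime X (restr XO T).
Proof.
apply: Dprime_comp => K cK KX; exists K; split=> //; first exact: subset_trans XO.
move=> m; exists m, 1; split=> // phi e _ _ le s x sm _.
by rewrite mul1r; exact: le.
Qed.

Lemma Dprime_dpush X Y (theta : diffeo X Y) T : Dprime X T -> Dprime Y (dpush theta T).
Proof.
set eta := diffeo_inv theta.
apply: Dprime_comp => K cK KY.
have cK' : compact (eta @` K).
  apply: continuous_compact => //; apply: continuous_in_subspaceT => y /set_mem Ky.
  apply/differentiable_continuous/row_differentiable => j.
  by apply: (diffeo_inv_smooth theta j [::]); exact: KY.
have KX : eta @` K `<=` X.
  by move=> _ [y Ky <-]; apply: diffeo_inv_to; exact: KY.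
have oX := @oset_open _ _ X.
exists (eta @` K); split => //.
  move=> phi sphi; apply: (support_compact cK' _).2 => x Nx /=.
  rewrite /pullback; case: ifPn => // /set_mem Xx.
  rewrite support0 ?mul0r// => /sphi Kt; apply: Nx; exists (theta x) => //.
  exact: diffeoK.
move=> m.
have sJ : Csmooth_on X (fun x => (jac theta x)%:C).
  split; last exact: smooth_cst.
  apply: smooth_normr => //; first exact: det_jacobian_neq0.
  by apply: smooth_det => //; exact: diffeo_smooth.
have [c c0 H] := deriv_le_comp_mul m oX (@oset_open _ _ Y) (@diffeo_to _ _ _ _ theta)
  (diffeo_smooth theta) sJ cK' KX.
exists m, c; split=> // phi e _ sphi le s x sm Kx.
have Xx : oset X x by exact: KX.
have E : {in (X : set V), pullback theta phi =1 fun x => phi (theta x) * (jac theta x)%:C}.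
  by move=> y Xy; rewrite /pullback Xy.
rewrite (@partials_local _ _ X _ (fun x => Re (phi (theta x) * (jac theta x)%:C))) ?inE//; last first.
  by move=> y Xy; rewrite -E.
rewrite [X in _ /\ `|X| <= _](@partials_local _ _ X _ (fun x => Im (phi (theta x) * (jac theta x)%:C))) ?inE//; last first.
  by move=> y Xy; rewrite -E.
apply: H => //; first exact: Csmooth_sub (test_smooth phi).
by move=> t y tm _; exact: le.
Qed.

Lemma Csmooth_real A (f : V -> R) : smooth_on A f -> Csmooth_on A (fun x => (f x)%:C).
Proof. by move=> sf; split=> //; exact: smooth_cst. Qed.

(** The factors of [tmul] trade places: [w] is a fixed cut-off and [phi] the smooth factor, so that
    the product lies in D(X) whatever the support of [phi]. *)
Definition tcut X Om (w : test X) (phi : test Om) : test X :=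
  tmul (Smoothfun (Csmooth_sub (@subsetT _ X) (test_smooth phi))) w.

Lemma tcut_linear X Om (w : test X) : linear (@tcut X Om w).
Proof. by move=> a u v; apply: testP => x; rewrite !test_linE /= mulrDl mulrA. Qed.

HB.instance Definition _ X Om (w : test X) :=
  GRing.isLinear.Build C (test Om) (test X) *:%R (@tcut X Om w) (tcut_linear w).

Lemma Dprime_tcut X Om (w : test X) T : Dprime X T -> Dprime Om (T \o @tcut X Om w).
Proof.
apply: Dprime_comp => K cK KO; exists (support_set w).
have cw : compact (support_set w) by exact: test_support_compact.
have wX : support_set w `<=` X by exact: test_support.
split=> //.
  move=> phi _; apply: support_set_subset => x /= ->; exact: mulr0.
move=> m; have [c c0 H] := deriv_le_mul m (@openT _) (test_smooth w) cw (@subsetT _ _).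
exists m, c; split=> // phi e _ _ le; apply: H; first exact: test_smooth.
by move=> s x sm _; exact: le.
Qed.

End operations_on_distributions.

(** * The sheaf of distributions *)

Section sheaf.
Context {R : realType} {d : nat}.
Local Notation C := R[i].
Local Notation V := 'rV[R]_d.
Implicit Types (Om X Y : opens R d) (K : set V).

Lemma is_test_real X (f : V -> R) K : smooth_on setT f -> compact K -> K `<=` X ->
  (forall x, ~ K x -> f x = 0) -> ((fun x => (f x)%:C) : V -> C^o) \in is_test X.
Proof.
move=> sf cK KX f0; have [|cs ss] := @support_compact _ _ (fun x => (f x)%:C) K cK.
  by move=> x /f0 ->.
by apply/is_testP; split; [exact: Csmooth_real|exact: cs|exact: subset_trans KX].
Qed.

Lemma test_sumE Om I (r : seq I) (F : I -> test Om) x :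
  (\sum_(i <- r) F i) x = \sum_(i <- r) F i x.
Proof. by elim: r => [|i r IH]; rewrite ?big_nil ?big_cons // -IH. Qed.

Definition tscale Om (f : V -> R) (sf : smooth_on setT f) (phi : test Om) : test Om :=
  tmul (Smoothfun (Csmooth_sub (@subsetT _ Om) (Csmooth_real sf))) phi.

Lemma test_decomp Om (eta : nat -> V -> R) (se : forall l, smooth_on setT (eta l))
    (phi : test Om) L :
  (forall x, support_set phi x -> \sum_(l < L) eta l x = 1) ->
  phi = \sum_(l < L) tscale (se l) phi.
Proof.
move=> H; apply: testP => x; rewrite test_sumE /=.
have [sx|nx] := pselect (support_set phi x).
  by rewrite -mulr_suml -rmorph_sum /= H// mul1r.
by rewrite (support0 nx) big1// => l _; rewrite mulr0.
Qed.

Fixpoint dsum Om (F : nat -> Dstar Om) n : Dstar Om :=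
  if n is m.+1 then Defs.dadd (dsum F m) (F m) else dzero Om.

Lemma dsumE Om (F : nat -> Dstar Om) n phi : dsum F n phi = \sum_(l < n) F l phi.
Proof. by elim: n => [|n IH]; rewrite ?big_ord0// big_ord_recr /= -IH. Qed.

Lemma Dprime_dsum Om (F : nat -> Dstar Om) n :
  (forall l, Dprime Om (F l)) -> Dprime Om (dsum F n).
Proof.
move=> HF; elim: n => [|n IH] /=; first exact: (@Dprime_dzero R d Om).
exact: (Dprime_dadd IH (HF n)).
Qed.

(** Partial sums are constant from any admissible length on. Hence the choice of the length does not
    matter, and linearity is checked at a length common to both arguments. *)
Lemma locally_finite_dsum Om (F : nat -> Dstar Om) :
  (forall phi, exists L, forall l, (L <= l)%N -> F l phi = 0) ->
  exists S : Dstar Om, forall phi L,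
    (forall l, (L <= l)%N -> F l phi = 0) -> S phi = dsum F L phi.
Proof.
move=> /choice[L HL]; pose s phi := dsum F (L phi) phi.
have widen phi M N : (M <= N)%N -> (forall l, (M <= l)%N -> F l phi = 0) ->
    dsum F M phi = dsum F N phi.
  move=> MN H; rewrite -(subnKC MN); elim: (N - M)%N => [|n IH]; first by rewrite addn0.
  rewrite addnS IH -[RHS]/(dsum F (M + n)%N phi + F (M + n)%N phi).
  by rewrite [F _ _]H ?leq_addr// addr0.
have sE phi M : (forall l, (M <= l)%N -> F l phi = 0) -> s phi = dsum F M phi.
  move=> HM; rewrite /s (widen _ _ (maxn (L phi) M) (leq_maxl _ _) (HL phi)).
  by rewrite -(widen _ _ _ (leq_maxr (L phi) M) HM).
have sl : linear s.
  move=> a u v; pose N := maxn (L u) (L v).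
  have Nu l : (N <= l)%N -> F l u = 0 by rewrite geq_max => /andP[/HL].
  have Nv l : (N <= l)%N -> F l v = 0 by rewrite geq_max => /andP[_ /HL].
  rewrite (sE u N)// (sE v N)// (sE _ N) ?linearP// => l Nl.
  by rewrite linearP Nu// Nv// scaler0 addr0.
pose S : Dstar Om := HB.pack s (GRing.isLinear.Build _ _ _ _ _ sl).
by exists S.
Qed.

(** A test function is a finite sum of pieces [eta l] phi, each with compact support in some
    [U i]. *)
Lemma cover_separated Om (I : Type) (U : I -> opens R d) (UO : forall i, U i `<=` Om)
    (S T : Dstar Om) : oset Om `<=` \bigcup_i U i ->
  (forall i, restr (UO i) S =1 restr (UO i) T) -> S =1 T.
Proof.
move=> cU ST phi; have oU i : open (U i) by exact: oset_open.
have [eta [zeta [sez supp _ fin]]] := partition_of_unity oU cU.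
have se l := (sez l).1.
have [L HL] := fin _ (test_support_compact (phi := phi)) (test_support (phi := phi)).
rewrite (test_decomp se (fun x sx => (HL x sx).1)) !linear_sum.
apply: eq_bigr => l _; have [e0|[i [K [cK KU e0]]]] := supp l.
  have -> : tscale (se l) phi = 0.
    by apply: testP => x /=; rewrite e0 mul0r.
  by rewrite !linear0.
pose w : test (U i) := Test (is_test_real (se l) cK KU (fun x Nx => (e0 x Nx).1)).
have -> : tscale (se l) phi = text (UO i) (tcut w phi).
  by apply: testP => x /=; exact: mulrC.
exact: ST.
Qed.

Lemma restr_restr Om X (Z : opens R d) (XO : X `<=` Om) (ZX : Z `<=` X) (ZO : Z `<=` Om) (T : Dstar Om) :
  restr ZX (restr XO T) =1 restr ZO T.
Proof. by move=> phi; congr (T _); exact: testP. Qed.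

(** [S] is the locally finite sum of the maps sending phi to T_i (eta_l phi), where [U i] contains
    the support of eta_l. Membership in D' is a conditional conclusion, so that the same [S] serves
    for D^* and for D'. *)
Lemma cover_glue Om (I : Type) (U : I -> opens R d) (UO : forall i, U i `<=` Om)
    (T : forall i, Dstar (U i)) : oset Om `<=` \bigcup_i U i ->
  (forall i j, restr (@subopensIl _ _ (U i) (U j)) (T i) =1
               restr (@subopensIr _ _ (U i) (U j)) (T j)) ->
  exists S : Dstar Om, ((forall i, Dprime (U i) (T i)) -> Dprime Om S) /\
    forall i, restr (UO i) S =1 T i.
Proof.
move=> cU compat; have oU i : open (U i) by exact: oset_open.
have [eta [zeta [sez supp _ fin]]] := partition_of_unity oU cU.
have se l := (sez l).1.
have /choice[F HF] l : exists Fl : Dstar Om,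
    [/\ (forall i, Dprime (U i) (T i)) -> Dprime Om Fl,
        forall phi : test Om, (forall x, eta l x = 0 \/ phi x = 0) -> Fl phi = 0 &
        forall j (psi : test (U j)), Fl (text (UO j) psi) = T j (tscale (se l) psi)].
  have [e0|[i [K [cK KU e0]]]] := supp l.
    exists (dzero Om); split=> //; first by move=> _; exact: Dprime_dzero.
    move=> j psi; rewrite (_ : tscale _ _ = 0) ?linear0//.
    by apply: testP => x /=; rewrite e0 mul0r.
  pose w : test (U i) := Test (is_test_real (se l) cK KU (fun x Nx => (e0 x Nx).1)).
  exists (T i \o tcut w); split.
  - by move=> HT; apply: Dprime_tcut; exact: HT.
  - move=> phi z; rewrite /= (_ : tcut w phi = 0) ?linear0//.
    by apply: testP => x /=; have [->|->] := z x; rewrite ?mulr0 ?mul0r.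
  move=> j psi.
  (* The product is supported in both [U i] and [U j], which is what allows [compat] to replace
     [T i] by [T j]. *)
  have kt : ((fun x => psi x * w x : C) : V -> C^o) \in is_test (opensI (U i) (U j)).
    have /is_testP[s1 s2 s3] := tfunP (tcut w (text (UO j) psi)).
    apply/is_testP; split=> // x sx; split; first exact: s3.
    apply: (test_support (phi := psi)); move: x sx; apply: support_set_subset => x ->.
    exact: mul0r.
  have := compat i j (Test kt); rewrite /= => E.
  transitivity (T i (text (@subopensIl _ _ (U i) (U j)) (Test kt))).
    by congr (T i _); exact: testP.
  by rewrite E; congr (T j _); apply: testP => x /=; exact: mulrC.
have Fz (phi : test Om) L : (forall x, support_set phi x -> forall l, (L <= l)%N -> eta l x = 0) ->
    forall l, (L <= l)%N -> F l phi = 0.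
  move=> HL l Ll; have [_ Fl0 _] := HF l; apply: Fl0 => x.
  by have [/HL/(_ l Ll)|/support0] := pselect (support_set phi x); [left|right].
have fin' (phi : test Om) : exists L, forall l, (L <= l)%N -> F l phi = 0.
  have [L HL] := fin _ (test_support_compact (phi := phi)) (test_support (phi := phi)).
  by exists L; apply: Fz => x /HL[].
have [S HS] := locally_finite_dsum fin'.
exists S; split.
  (* On D_K the functional [S] is one finite sum, with a length that depends on [K] only. *)
  move=> HT; apply/DprimeP => K cK KO; have [L HL] := fin K cK KO.
  have /DprimeP/(_ K cK KO)[m [c [c0 Hc]]] : Dprime Om (dsum F L).
    by apply: Dprime_dsum => l; have [HF1 _ _] := HF l; exact: HF1.
  exists m, c; split=> // phi e e0 sphi le; rewrite (HS phi L).
    exact: Hc.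
  by apply: Fz => x /sphi/HL[].
move=> j psi; rewrite /restr /=.
have [L HL] := fin _ (test_support_compact (phi := psi))
  (subset_trans (test_support (phi := psi)) (UO j)).
rewrite (HS _ L); last by apply: Fz => x /HL[].
rewrite dsumE [in RHS](test_decomp se (fun x sx => (HL x sx).1)) linear_sum.
by apply: eq_bigr => l _; have [_ _ ->] := HF l.
Qed.

Lemma presheaf_Dstar : @presheaf R d.
Proof.
split=> [Om OO T phi|Om X Z XO ZX ZO T]; last exact: restr_restr.
by congr (T _); exact: testP.
Qed.

Lemma restr_morphism_Dstar : @restr_morphism R d.
Proof.
move=> Om X XO; split=> //.
- by move=> f T phi; congr (T _); exact: testP.
- by move=> al T phi; congr (_ *: T _); exact: testP.
Qed.

Lemma separated_sub (F : forall Om, set (Dstar Om)) : @Defs.separated R d F.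
Proof. by move=> Om I U UO cU S T _ _; exact: cover_separated. Qed.

Lemma gluing_Dstar : @gluing R d (fun Om => [set: Dstar Om]).
Proof.
move=> Om I U UO cU T _ compat.
by have [S [_ HS]] := cover_glue UO cU compat; exists S.
Qed.

Lemma gluing_Dprime : @gluing R d (fun Om => Dprime Om).
Proof.
move=> Om I U UO cU T HT compat.
by have [S [DS HS]] := cover_glue UO cU compat; exists S => //; exact: DS.
Qed.

Lemma differential_Dstar Om :
  differential_submodule [set: Dstar Om] /\ differential_subspace [set: Dstar Om].
Proof. by split; split. Qed.

Lemma differential_Dprime Om :
  differential_submodule (Dprime Om) /\ differential_subspace (Dprime Om).
Proof.
split; split=> *; [exact: Dprime_dzero|exact: Dprime_dadd|exact: Dprime_dmul|
  exact: Dprime_dpartial|exact: Dprime_dzero|exact: Dprime_dadd|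
  exact: Dprime_dscale|exact: Dprime_dpartial].
Qed.

Lemma subsheaf_Dprime : subsheaf_of_differential_modules
  (fun Om : opens R d => Dprime Om) (fun Om : opens R d => [set: Dstar Om]).
Proof.
split; [exact: presheaf_Dstar|exact: restr_morphism_Dstar| | |by []].
  split; [exact: differential_Dprime| |exact: separated_sub|exact: gluing_Dprime].
  by move=> Om X XO T; exact: Dprime_restr.
by split; [exact: differential_Dstar| |exact: separated_sub|exact: gluing_Dstar].
Qed.

(** The largest open set is the union of all those on which [T] vanishes; [T] vanishes on it because
    functionals are determined by their restrictions to a cover. The argument takes place entirely
    in D^*. *)
Lemma is_support_dist_support Om (T : Dstar Om) : is_support T (dist_support T).
Proof.
pose I := {X : opens R d | exists XO : X `<=` Om, restr XO T =1 dzero X}.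
pose W : set V := \bigcup_(i : I) oset (sval i).
have oW : open W by apply: bigcup_open => i _; exact: oset_open.
pose U := Opens oW.
have UO : U `<=` Om by move=> x [[X [XO XT]] _ /=]; exact: XO.
exists U, UO.
have XU X (XO : X `<=` Om) : restr XO T =1 dzero X -> X `<=` U.
  by move=> XT x Xx; exists (exist _ X (ex_intro _ XO XT)).
have TU : restr UO T =1 dzero U.
  have iU (i : I) : sval i `<=` U by move=> x; exists i.
  apply: (@cover_separated U I (fun i => sval i) iU) => // i.
  have [XO XT] := svalP i => phi.
  by rewrite (restr_restr UO (iU i) XO) XT.
split=> //; apply/seteqP; split=> x.
  move=> [Omx Hx]; split=> // Ux; have [phi pU] := Hx U oW Ux.
  have pt : (phi : V -> C^o) \in is_test U.
    by apply/is_testP; split=> //; [exact: test_smooth|exact: test_support_compact].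
  have -> : phi = text UO (Test pt) by exact: testP.
  by have /= -> := TU (Test pt); rewrite eqxx.
move=> [Omx NUx]; split=> // A oA Ax; apply: contrapT => /forall2NP H; apply: NUx.
have oX : open (Om `&` A) by apply: openI => //; exact: oset_open.
have XO : Opens oX `<=` Om by move=> y [].
apply: (XU (Opens oX) XO) => // phi /=.
have [|/negP/negPn/eqP//] := H (text XO phi); case.
by apply: subset_trans (test_support (phi := phi)) _ => y [].
Qed.

End sheaf.

(** * Lebesgue measure *)

(** Lengths of intervals, empty ones included, add up under a cut at [a]; so do volumes of boxes cut
    by a hyperplane. *)
Lemma max0_split (R : realDomainType) (x y a : R) :
  Num.max 0 (y - x) = Num.max 0 (Num.min y a - x) + Num.max 0 (y - Num.max x a).
Proof.
rewrite !maxEle !minEle; case: (leP y a) => ya; case: (leP x a) => xa;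
  do ![case: leP => //= ?]; lra.
Qed.

Section lebesgue_measure_Rn.
Context {R : realType} {d : nat}.
Local Notation V := 'rV[R]_d.
Local Notation mu := (@lebesgue_outer_measure R d).
Implicit Types (A K : set V) (x c : V) (i : 'I_d).
Local Open Scope ereal_scope.

(** The hyperplane cuts each box of a cover into two boxes whose volumes add up, and the two
    families cover the two parts of the set. *)
Lemma halfspace_caratheodory i (a : R) : mu.-caratheodory [set x : V | (x 0 i <= a)%R].
Proof.
set H := [set x | _]; apply: le_caratheodory_measurable => X.
apply: le_ereal_inf_tmp => _ [B XB <-].
pose lo (b : option (V * V)) := if b is Some (u, v)
  then Some (u, (\row_j if j == i then Num.min (v 0 j) a else v 0 j)%R) else None.
pose hi (b : option (V * V)) := if b is Some (u, v)
  then Some ((\row_j if j == i then Num.max (u 0 j) a else u 0 j)%R, v) else None.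
have volE b : box_volume b = (box_volume (lo b) + box_volume (hi b))%R.
  case: b => [[u v]|] /=; last by rewrite addr0.
  rewrite (bigD1 i)//= [in RHS](bigD1 i)//= [X in (_ = _ + X)%R](bigD1 i)//=.
  rewrite !mxE !eqxx.
  under [X in (_ = _ * X + _)%R]eq_bigr => j ji do rewrite mxE (negbTE ji).
  under [X in (_ = _ + _ * X)%R]eq_bigr => j ji do rewrite mxE (negbTE ji).
  rewrite -mulrDl; congr (_ * _)%R.
  exact: max0_split.
have loP b x : box b x -> H x -> box (lo b) x.
  case: b => [[u v]|]//= bx Hx j; rewrite mxE; case: eqVneq => [->|_]; last exact: bx.
  by have /andP[-> xv] := bx i; rewrite le_min xv.
have hiP b x : box b x -> (~` H) x -> box (hi b) x.
  case: b => [[u v]|]//= bx Hx j; rewrite mxE; case: eqVneq => [->|_]; last exact: bx.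
  have /andP[ux ->] := bx i; rewrite ge_max ux andbT /=.
  by move/negP: Hx; rewrite -ltNge => /ltW.
apply: (@le_trans _ _ (\sum_(k <oo) (box_volume (lo (B k)))%:E +
    \sum_(k <oo) (box_volume (hi (B k)))%:E)).
  apply: leeD; apply: ereal_inf_lbound.
    exists (lo \o B) => //= x [/XB[k _ Bx] Hx]; exists k => //; exact: loP.
  exists (hi \o B) => //= x [/XB[k _ Bx] Hx]; exists k => //; exact: hiP.
rewrite -nneseriesD; [|by move=> *; exact: box_volume_ge0..].
by under [in leRHS]eq_eseriesr do rewrite volE EFinD.
Qed.

(** An open set is a countable union of cubes with rational centres, each a finite intersection of
    half-spaces and complements of half-spaces. *)
Lemma open_caratheodory A : open A -> mu.-caratheodory A.
Proof.
move=> oA; pose ctr (p : 'rV[rat]_d * nat) : V := map_mx ratr p.1.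
pose rad (p : 'rV[rat]_d * nat) : R := p.2.+1%:R^-1%R.
(* Half-open, so that each coordinate condition is a closed half-space minus another one. *)
pose Q p : set V := [set x | forall i, (ctr p 0 i - rad p < x 0 i <= ctr p 0 i + rad p)%R].
have mI (F : 'I_d -> set V) : (forall i, mu.-caratheodory (F i)) ->
    mu.-caratheodory [set x | forall i, F i x].
  move=> mF; rewrite (_ : [set x | _] = \big[setI/setT]_(i < d) F i); last first.
    apply/seteqP; split=> x /=.
      by move=> H; elim/big_ind: _ => // B D; split.
    by move=> + i; rewrite (bigD1 i)//= => -[].
  elim/big_ind: _ => // [|B D].
    rewrite -setC0; apply: caratheodory_measurable_setC; exact: caratheodory_measurable_set0.
  exact: caratheodory_measurable_setI.
have mQ p : mu.-caratheodory (Q p).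
  rewrite (_ : Q p = [set x | forall i,
    ([set y : V | y 0 i <= ctr p 0 i + rad p]%R `&`
     ~` [set y : V | y 0 i <= ctr p 0 i - rad p]%R) x]); last first.
    apply/seteqP; split=> x /= H i; have := H i.
      by move=> /andP[ax xb]; split=> //; apply/negP; rewrite -ltNge.
    by move=> [-> /negP]; rewrite -ltNge andbT.
  apply: mI => i; apply: caratheodory_measurable_setI; first exact: halfspace_caratheodory.
  by apply: caratheodory_measurable_setC; exact: halfspace_caratheodory.
pose B l : set V := if unpickle l is Some p then
  if `[< Q p `<=` A >] then Q p else set0 else set0.
have -> : A = \bigcup_l B l.
  apply/seteqP; split=> [x Ax|x [l _]]; last first.
    rewrite /B; case: (unpickle l) => [p|//]; case: ifPn => [/asboolP|//]; exact.
  have /nbhs_ballP[r /= r0 rU] := open_nbhs_nbhs (conj oA Ax).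
  (* The cube of half-side 1/(n+1) about a centre at distance less than 1/(n+1) from [x] lies within
     2/(n+1) of [x]. *)
  have r3 : (0 < r / 3)%R by rewrite divr_gt0.
  have [n nr] := exists_inv_nat_lt r3.
  have n0 : (0 < n.+1%:R^-1 :> R)%R by rewrite invr_gt0.
  have [q xq] := rational_point_near x n0.
  exists (pickle (q, n)) => //; rewrite /B pickleK.
  have -> : `[< Q (q, n) `<=` A >].
    apply/asboolP => y yQ; apply: rU; rewrite -ball_normE /=.
    apply: norm_row_lt => // i; rewrite !mxE.
    have := norm_coord_le (x - map_mx ratr q) i; move: (yQ i) xq nr; rewrite /ctr /rad /= !mxE.
    move: (n.+1%:R^-1)%R => a /andP[h1 h2] h3 h4 h5; have := le_lt_trans h5 h3.
    by rewrite !ltr_norml => /andP[? ?]; apply/andP; split; lra.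
  move=> i; move: xq; have := norm_coord_le (x - map_mx ratr q) i.
  rewrite /ctr /rad /= !mxE => h1 h2; have := le_lt_trans h1 h2.
  move: (n.+1%:R^-1)%R (ratr _) (x 0%R i) => a b c.
  by rewrite ltr_norml => /andP[? ?]; apply/andP; split; lra.
apply: caratheodory_measurable_bigcup => l; rewrite /B.
case: (unpickle l) => [p|]; last exact: caratheodory_measurable_set0.
by case: ifP => _; [exact: mQ|exact: caratheodory_measurable_set0].
Qed.

Lemma closed_caratheodory A : closed A -> mu.-caratheodory A.
Proof.
move=> cA; rewrite -(setCK A); apply: caratheodory_measurable_setC.
by apply: open_caratheodory; exact: closed_openC.
Qed.

End lebesgue_measure_Rn.

(** * Lower bound for the measure of a ball *)

Lemma card_ord_open_itv (R : realType) (N : nat) (a b : R) :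
  #|[pred m : 'I_N | a < m%:R < b]|%:R <= Num.max 0 (b - a) + 1.
Proof.
set S := [pred m : 'I_N | _].
have [m0 Sm0|S0] := pickP S; last first.
  by rewrite eq_card0// addr_ge0// le_max lexx.
case: (arg_minnP (fun m : 'I_N => m : nat) Sm0) => p Sp pmin.
case: (arg_maxnP (fun m : 'I_N => m : nat) Sm0) => q Sq qmax.
have pq : (p <= q)%N by exact: pmin.
have cS : (#|S| <= (q - p).+1)%N.
  rewrite cardE -(size_map val) -(size_iota p (q - p).+1); apply: uniq_leq_size.
    by rewrite map_inj_uniq ?enum_uniq//; exact: val_inj.
  move=> _ /mapP[m + ->]; rewrite mem_enum => Sm; rewrite mem_iota.
  by rewrite pmin//= addnS subnKC// ltnS; exact: qmax.
apply: (@le_trans _ _ (q - p).+1%:R); first by rewrite ler_nat.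
rewrite -natr1 lerD2r natrB// le_max; apply/orP; right.
by move: Sp Sq => /andP[? _] /andP[_ ?]; lra.
Qed.

Section measure_of_balls.
Context {R : realType} {d : nat}.
Local Notation V := 'rV[R]_d.
Local Notation mu := (@lebesgue_outer_measure R d).
Implicit Types (A K : set V) (x c : V) (i : 'I_d).

(** Widening a box by [t] on both sides accounts for 2t; the third [t] absorbs the excess of 1 in
    the count of lattice points, whose mesh will be at most [t]. *)
Definition enlarged_volume (b : option (V * V)) (t : R) : R :=
  if b is Some (u, v) then \prod_i (Num.max 0 (v 0 i - u 0 i) + t *+ 3) else 0.

Lemma enlarged_volume_near (b : option (V * V)) (e : R) : 0 < e ->
  exists2 t : R, 0 < t & enlarged_volume b t <= box_volume b + e.
Proof.
case: b => [[u v]|] e0; last by exists 1 => //=; rewrite add0r ltW.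
have c : enlarged_volume (Some (u, v)) t @[t --> (0 : R)] --> enlarged_volume (Some (u, v)) 0.
  rewrite /enlarged_volume; elim: (index_enum _) => [|i s IH].
    by under eq_fun do rewrite big_nil; rewrite big_nil; exact: cvg_cst.
  under eq_fun do rewrite big_cons; rewrite big_cons; apply: cvgM IH.
  by apply: cvgD; [exact: cvg_cst|apply: cvgMn; exact: cvg_id].
have E : enlarged_volume (Some (u, v)) 0 = box_volume (Some (u, v)).
  by apply: eq_bigr => i _; rewrite mul0rn addr0.
move/cvgrPdist_le: c => /(_ e e0); rewrite E => /nbhs_normP[r /= r0 rH].
exists (r / 2); first by rewrite divr_gt0.
have : `|box_volume (Some (u, v)) - enlarged_volume (Some (u, v)) (r / 2)| <= e.
  by apply: rH; rewrite /= sub0r normrN gtr0_norm ?divr_gt0// ltr_pdivrMr// ltr_pMr// ltr1n.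
by rewrite distrC => /ler_normlW; rewrite lerBlDl.
Qed.

(* Counting the points of the lattice of mesh r/N that lie in the boxes of a
   finite cover, and comparing with those that lie in the ball. *)
Lemma lebesgue_outer_ball_ge c (r : R) : 0 < r ->
  ((r ^+ d)%:E <= lebesgue_outer [set x : V | (`|x - c| <= r)%R])%E.
Proof.
move=> r0; set K := [set x | _]; apply: le_ereal_inf_tmp => _ [B KB <-].
have cK : compact K by exact: closed_ball_compact.
apply/lee_addgt0Pr => e e0.
have e2 k : 0 < e / 2 ^+ k.+1 by rewrite divr_gt0// exprn_gt0.
have /choice[t Ht] k : exists t : R, 0 < t /\
    enlarged_volume (B k) t <= box_volume (B k) + e / 2 ^+ k.+1.
  by have [t t0 H] := enlarged_volume_near (B k) (e2 k); exists t.
(* Open enlargements of the boxes, so that compactness extracts a finite subcover. *)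
pose O k : set V := if B k is Some (u, v)
  then [set x | forall i, u 0 i - t k < x 0 i < v 0 i + t k] else set0.
have oO k : open (O k).
  rewrite /O; case: (B k) => [[u v]|]; last exact: open0.
  rewrite [A in open A](_ : _ = \big[setI/setT]_(i < d)
      ((fun x : V => x 0 i) @^-1` `]u 0 i - t k, v 0 i + t k[)); last first.
    apply/seteqP; split=> x /=.
      by move=> H; elim/big_ind: _ => //= i _; rewrite in_itv /=.
    by move=> + i; rewrite (bigD1 i)//= in_itv /= => -[].
  elim/big_ind: _ => //; [exact: openT|exact: openI|move=> i _].
  by apply: open_comp => // x _; exact: coord_continuous.
have KO : K `<=` \bigcup_k O k.
  move=> x /KB[k _ Bx]; exists k => //; move: Bx; rewrite /O.
  case: (B k) => [[u v]|//] /= H i; have /andP[? ?] := H i.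
  by have [t0 _] := Ht k; apply/andP; split; lra.
have [L HL] := compact_nat_subcover cK oO KO.
(* Finitely many boxes are left, so one mesh r / N is below all their margins. *)
have [N N0 HN] : exists2 N, (0 < N)%N & forall k, (k < L)%N -> r / N%:R <= t k.
  have m0 : 0 < \big[Num.min/1]_(k < L) t k / r.
    by rewrite divr_gt0//; apply/bigmin_gtP; split=> // k _; have [] := Ht k.
  have [n Hn] := exists_inv_nat_lt m0; exists n.+1 => // k kL.
  have : r / n.+1%:R < \big[Num.min/1]_(k < L) t k.
    by rewrite mulrC -ltr_pdivlMr.
  by move=> /bigmin_gtP[_ H]; apply: ltW; exact: (H (Ordinal kL)).
have N0' : 0 < N%:R :> R by rewrite ltr0n.
(* These N^d points fill the corner cube with sides [c_i, c_i + r] of the ball; counting there gives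
   r^d, a crude but positive bound. *)
pose pt (j : {ffun 'I_d -> 'I_N}) : V := \row_i (c 0 i + r * (j i)%:R / N%:R).
have Kpt j : K (pt j).
  apply/norm_row_le => [|i]; first exact: ltW.
  rewrite !mxE addrAC subrr add0r ger0_norm; last by rewrite divr_ge0// mulr_ge0// ltW.
  by rewrite ler_pdivrMr// ler_wpM2l ?(ltW r0)// ler_nat ltnW.
have cover_count : (N ^ d)%:R <= \sum_(k < L) (#|[pred j | `[< O k (pt j) >]]|%:R : R).
  rewrite -natr_sum ler_nat -[in leqLHS](card_ord N) -[in leqLHS](card_ord d) -card_ffun.
  rewrite -sum1_card; apply: (@leq_trans (\sum_(j : {ffun 'I_d -> 'I_N}) \sum_(k < L | `[< O k (pt j) >]) 1)).
    apply: leq_sum => j _; have [k kL Ok] := HL _ (Kpt j).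
    by rewrite (bigD1 (Ordinal kL))//=; exact/asboolP.
  rewrite (exchange_big_dep xpredT)//=; apply: leq_sum => k _.
  by rewrite sum1_card.
have box_count k : (k < L)%N -> #|[pred j | `[< O k (pt j) >]]|%:R <=
    (N%:R / r) ^+ d * enlarged_volume (B k) (t k).
  move=> kL; have [t0 _] := Ht k; rewrite /O /enlarged_volume.
  case: (B k) => [[u v]|]; last first.
    rewrite mulr0 eq_card0// => j; rewrite !inE; exact/asboolP.
  pose al i := (u 0 i - t k - c 0 i) * (N%:R / r).
  pose be i := (v 0 i + t k - c 0 i) * (N%:R / r).
  have rN0 : 0 < N%:R / r by rewrite divr_gt0.
  pose P i : pred 'I_N := [pred m : 'I_N | al i < m%:R < be i].
  apply: (@le_trans _ _ (#|family P|%:R)).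
    rewrite ler_nat; apply: subset_leq_card; apply/fintype.subsetP => j.
    rewrite unfold_in /= => /asboolP H; apply/familyP => i; rewrite inE /=.
    have := H i; rewrite /pt mxE /al /be -(ltr_pdivlMr _ _ rN0) -(ltr_pdivrMr _ _ rN0) invf_div.
    have -> : r * (j i)%:R / N%:R = (j i)%:R * (r / N%:R) by rewrite mulrAC mulrC.
    by move=> /andP[? ?]; apply/andP; split; lra.
  rewrite card_family foldrE big_map big_enum /= natr_prod.
  rewrite -[X in _ ^+ X](card_ord d) -prodr_const -big_split /=.
  apply: ler_prod => i _; rewrite ler0n /=.
  apply: le_trans (card_ord_open_itv _ _ _) _.
  rewrite (mulrSr (t k)) addrA mulrDr; apply: lerD; last by rewrite -ler_pdivrMl// mulr1 invf_div HN.
  rewrite /al /be -mulrBl; have -> : v 0 i + t k - c 0 i - (u 0 i - t k - c 0 i) =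
    v 0 i - u 0 i + t k *+ 2 by rewrite mulr2n; ring.
  rewrite ge_max [X in _ && (X <= _)]mulrC ler_pM2l// lerD2r le_max lexx orbT andbT.
  by rewrite mulr_ge0 ?addr_ge0 ?le_max ?lexx ?mulrn_wge0// ltW.
have : r ^+ d <= \sum_(k < L) (box_volume (B k) + e / 2 ^+ k.+1).
  have rN : 0 < (N%:R / r) ^+ d by rewrite exprn_gt0// divr_gt0.
  rewrite -(ler_pM2l rN) -exprMn divfK ?gt_eqF//.
  apply: le_trans (_ : _ <= (N ^ d)%:R) _; first by rewrite natrX.
  apply: le_trans cover_count _; rewrite mulr_sumr; apply: ler_sum => k _.
  apply: le_trans (box_count _ (ltn_ord k)) _.
  by rewrite ler_pM2l//; have [] := Ht k.
rewrite big_split /= -lee_fin => /le_trans; apply; rewrite EFinD; apply: leeD.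
  rewrite -sumEFin -(big_mkord xpredT (fun k => (box_volume (B k))%:E)).
  by apply: nneseries_lim_ge => k _ _; exact: box_volume_ge0.
rewrite lee_fin (_ : \sum_(k < L) _ = e - e / 2 ^+ L).
  by rewrite gerBl divr_ge0// ?exprn_ge0// ltW.
elim: (L) => [|n IH]; first by rewrite big_ord0 expr0 divr1 subrr.
rewrite big_ord_recr /= IH exprS; field.
by rewrite expf_neq0.
Qed.

End measure_of_balls.

(** * Integrals of compactly supported functions *)

Section integral_compact_support.
Context {R : realType} {d : nat}.
Local Notation V := 'rV[R]_d.
Local Notation lam := (@lebesgueRn R d).
Local Notation lebesgue_type := (caratheodory_type (@lebesgue_outer_measure R d)).
Implicit Types (A K : set V) (x c h : V) (f g : V -> R).

Lemma continuous_add f g : continuous f -> continuous g -> continuous (fun x => f x + g x).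
Proof. by move=> cf cg x; exact: (cvgD (cf x) (cg x)). Qed.

Lemma continuous_scale f (a : R) : continuous f -> continuous (fun x => a * f x).
Proof. by move=> cf x; exact: (cvgM (cvg_cst a) (cf x)). Qed.

Lemma continuous_translate f h : continuous f -> continuous (fun x => f (x + h)).
Proof.
move=> cf x; apply: (@continuous_comp _ _ _ (fun x => x + h) f); last exact: cf.
exact: (@cvgD _ V _ (nbhs x) _ id (cst h) x h cvg_id (cvg_cst h)).
Qed.

Lemma continuous_lebesgue_measurable (D : set lebesgue_type) f : measurable D ->
  continuous f -> measurable_fun D (f : lebesgue_type -> R).
Proof.
move=> mD cf; apply: (@measurable_funS _ _ _ _ setT) => //.
apply: (measurability _ (RGenOInfty.measurableE R)) => _ [_ [a ->] <-].
rewrite setTI; apply: open_caratheodory; apply: open_comp => // x _; exact: cf.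
Qed.

Lemma lebesgue_outer_ball_lty (r : R) :
  (lebesgue_outer [set x : V | (`|x| <= r)%R] < +oo)%E.
Proof.
pose B : option (V * V) := Some (\row_i - r, \row_i r).
apply: (@le_lt_trans _ _ (box_volume B)%:E); last exact: ltry.
apply: ereal_inf_lbound; exists (fun k => if k == 0%N then B else None).
  move=> x /= xr; exists 0%N => //= i; rewrite !mxE -ler_norml.
  exact: le_trans (norm_coord_le _ _) xr.
rewrite nneseries_recl//; last by move=> k _; exact: box_volume_ge0.
by rewrite eseries0 ?adde0// => -[].
Qed.

Lemma continuous_ball_bump c (r : R) : continuous (ball_bump c r).
Proof.
by move=> x; apply/differentiable_continuous/(@smooth_ball_bump _ _ setT c r (@openT _) [::]).
Qed.

Definition vanish_out (r : R) f := forall x, r <= `|x| -> f x = 0.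

Definition vint f : R := \int[lam]_(x in setT) f x.

Lemma vanish_outW (r s : R) f : r <= s -> vanish_out r f -> vanish_out s f.
Proof. by move=> rs H x sx; apply: H; exact: le_trans sx. Qed.

Lemma ball_measurable (r : R) : measurable ([set x : V | `|x| <= r] : set lebesgue_type).
Proof.
rewrite (_ : [set x : V | _] = [set x | `|x - 0| <= r]); last first.
  by apply/seteqP; split=> x /=; rewrite subr0.
apply: closed_caratheodory; apply: compact_closed; first exact: norm_hausdorff.
exact: closed_ball_compact.
Qed.

Lemma integrable_compact_support f (r : R) : continuous f -> vanish_out r f ->
  lam.-integrable setT (EFin \o f).
Proof.
move=> cf vf; pose B : set lebesgue_type := [set x : V | `|x| <= r].
have mB : measurable B by exact: ball_measurable.
have -> : EFin \o f = (EFin \o f) \_ B.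
  apply/funext => x; rewrite patchE; case: ifPn => // /negP xB /=; rewrite vf//.
  by rewrite leNgt; apply/negP => /ltW xr; apply: xB; exact/mem_set.
apply/(integrable_mkcond _ mB); apply: measurable_bounded_integrable => //.
- exact: lebesgue_outer_ball_lty.
- exact: continuous_lebesgue_measurable.
have cB : compact ([set x : V | `|x - 0| <= r]) by exact: closed_ball_compact.
have /compact_bounded[M [Mr HM]] : compact (f @` [set x : V | `|x - 0| <= r]).
  by apply: continuous_compact => //; exact: continuous_subspaceT.
exists M; split=> // N MN x Bx; apply: HM MN _ _; exists x => //=.
by rewrite subr0.
Qed.

Lemma vint_linear f g (a r : R) : continuous f -> continuous g ->
  vanish_out r f -> vanish_out r g ->
  vint (fun x => a * f x + g x) = a * vint f + vint g.
Proof.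
move=> cf cg vf vg; have If := integrable_compact_support cf vf.
have Ig := integrable_compact_support cg vg.
have Iaf : lam.-integrable setT (EFin \o (fun x => a * f x)).
  apply: (@integrable_compact_support _ r) => [|x /vf ->]; last exact: mulr0.
  exact: continuous_scale.
by rewrite /vint RintegralD// RintegralZl.
Qed.

Lemma vint_le f g (r : R) : continuous f -> continuous g ->
  vanish_out r f -> vanish_out r g -> (forall x, f x <= g x) -> vint f <= vint g.
Proof.
move=> cf cg vf vg fg; apply: le_Rintegral => //.
  exact: integrable_compact_support vf.
exact: integrable_compact_support vg.
Qed.

(** The bump is 1 on the ball that carries [f], so [e] times the bump dominates [f]. *)
Lemma vint_bound f (r e : R) : 0 < r -> continuous f -> vanish_out r f ->
  (forall x, `|f x| <= e) -> `|vint f| <= e * vint (ball_bump 0 r).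
Proof.
move=> r0 cf vf fe; have r2 : r <= 2 * r by rewrite ler_pMl// ler1n.
have vf2 := vanish_outW r2 vf.
have cb := @continuous_ball_bump 0 r.
have vb : vanish_out (2 * r) (ball_bump 0 r) by move=> x xr; rewrite ball_bump0// subr0.
have c0 : continuous (fun _ : V => 0 : R) by exact: cst_continuous.
have v0 : vanish_out (2 * r) (fun _ : V => 0 : R) by [].
have vint0 : vint (fun=> 0) = 0 by rewrite /vint /Rintegral integral0.
have E a : vint (fun x => a * ball_bump 0 r x + 0) = a * vint (ball_bump 0 r).
  by rewrite (vint_linear a cb c0 vb v0) vint0 addr0.
have cab a : continuous (fun x => a * ball_bump 0 r x + 0).
  by apply: continuous_add c0; exact: continuous_scale.
have vab a : vanish_out (2 * r) (fun x => a * ball_bump 0 r x + 0).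
  by move=> x /vb ->; rewrite mulr0 addr0.
have fb x : `|f x| <= e * ball_bump 0 r x + 0.
  have [rx|xr] := leP r `|x|.
    rewrite vf// normr0 addr0 mulr_ge0 ?ball_bump_ge0//; exact: le_trans (fe x).
  by rewrite ball_bump1 ?subr0 ?(ltW xr)// mulr1 addr0.
rewrite ler_norml -mulNr -!E; apply/andP; split; apply: (vint_le (r := 2 * r)) => // x.
  have := fb x; rewrite ler_norml => /andP[+ _]; apply: le_trans.
  by rewrite !addr0 mulNr.
by have := fb x; rewrite ler_norml => /andP[_].
Qed.

Lemma vint_gt0 f c (r s : R) : 0 < r -> continuous f -> vanish_out s f ->
  (forall x, 0 <= f x) -> (forall x, `|x - c| <= r -> 1 <= f x) -> 0 < vint f.
Proof.
move=> r0 cf vf f0 f1; have If := integrable_compact_support cf vf.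
have fin : (\int[lam]_x (f x)%:E)%E \is a fin_num by exact: integrable_fin_num.
apply: fine_gt0; move: fin; rewrite ge0_fin_numE => [->|]; last first.
  by apply: integral_ge0 => x _; rewrite lee_fin.
rewrite andbT; pose B : set lebesgue_type := [set x : V | `|x - c| <= r].
have mB : measurable B.
  apply: closed_caratheodory; apply: compact_closed; first exact: norm_hausdorff.
  exact: closed_ball_compact.
apply: (@lt_le_trans _ _ (lam B)).
  apply: lt_le_trans (lebesgue_outer_ball_ge c r0).
  by rewrite lte_fin exprn_gt0.
rewrite -[leLHS]mul1e -integral_cst//.
have fE x : (0 <= (f x)%:E)%E by rewrite lee_fin.
have mf := continuous_lebesgue_measurable (@measurableT _ lebesgue_type) cf.
apply: (@le_trans _ _ (\int[lam]_(x in B) (f x)%:E)%E).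
  apply: ge0_le_integral => //.
  by apply/measurable_EFinP; exact: measurable_funTS.
by apply: ge0_subset_integral => //; exact/measurable_EFinP.
Qed.

Lemma le_lebesgue_outer_translate A h :
  (lebesgue_outer ((fun x => (x + h)%R) @^-1` A) <= lebesgue_outer A)%E.
Proof.
apply: le_ereal_inf_tmp => _ [B AB <-].
pose tr (b : option (V * V)) := if b is Some (u, v) then Some (u - h, v - h) else None.
apply: ereal_inf_lbound; exists (tr \o B) => /=.
  move=> x /AB[k _ Bx]; exists k => //; move: Bx => /=.
  case: (B k) => [[u v]|//] /= H i; have := H i; rewrite !mxE => /andP[? ?].
  by apply/andP; split; lra.
apply: eq_eseriesr => k _; congr EFin; case: (B k) => [[u v]|//] /=.
by apply: eq_bigr => i _; rewrite !mxE opprB addrA subrK.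
Qed.

Lemma lebesgue_outer_translate A h :
  lebesgue_outer ((fun x => x + h) @^-1` A) = lebesgue_outer A.
Proof.
apply/eqP; rewrite eq_le le_lebesgue_outer_translate /=.
rewrite [leLHS](_ : _ = lebesgue_outer ((fun x => x - h) @^-1` ((fun x => x + h) @^-1` A))).
  exact: le_lebesgue_outer_translate.
by congr lebesgue_outer; apply/funext => x /=; rewrite subrK.
Qed.

(** Translations preserve the outer measure, hence the Caratheodory condition, which is tested on
    the translated set [Y]. *)
Lemma translate_measurable h :
  measurable_fun (setT : set lebesgue_type) ((fun x => x + h) : lebesgue_type -> lebesgue_type).
Proof.
move=> _ A mA; rewrite setTI.
suff : (@lebesgue_outer_measure R d).-caratheodory ((fun x => x + h) @^-1` A) by [].
move=> X.
pose Y := (fun x => x - h) @^-1` X.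
have -> : X = (fun x => x + h) @^-1` Y by apply/funext => x; rewrite /Y /= addrK.
have muT Z : lebesgue_outer_measure ((fun x => x + h) @^-1` Z) = lebesgue_outer_measure Z.
  exact: lebesgue_outer_translate.
rewrite preimage_setC -!preimage_setI !muT; exact: (mA Y).
Qed.

Lemma vint_translate f (r : R) h : continuous f -> vanish_out r f ->
  vint (fun x => f (x + h)) = vint f.
Proof.
move=> cf vf; have mh := translate_measurable h.
have cfh := continuous_translate (h := h) cf.
have vfh : vanish_out (r + `|h|) (fun x => f (x + h)).
  move=> x xr; apply: vf; rewrite -(lerD2r `|h|); apply: le_trans xr _.
  by rewrite -{1}(addrK h x) ler_normB.
rewrite /vint /Rintegral; congr fine.
pose th : lebesgue_type -> lebesgue_type := fun x => x + h.
have mf : measurable_fun [set: lebesgue_type] (EFin \o f).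
  by apply/measurable_EFinP; exact: continuous_lebesgue_measurable.
have Ifh : lam.-integrable (th @^-1` setT) ((EFin \o f) \o th).
  exact: integrable_compact_support vfh.
rewrite -[LHS](integral_pushforward mh mf Ifh measurableT).
apply: eq_measure_integral => A _ _; exact: lebesgue_outer_translate.
Qed.

Lemma smooth_continuous f : smooth_on setT f -> continuous f.
Proof. by move=> sf x; exact/differentiable_continuous/(sf [::]). Qed.

Lemma vanish_out_pderiv f i (r s : R) : r < s -> vanish_out r f -> vanish_out s (pderiv i f).
Proof.
move=> rs vf x sx; rewrite /pderiv (near_eq_derive _ (g := cst 0)) ?derive_cst//.
have : \forall y \near x, r < `|y|.
  have : (`|y| : R) @[y --> x] --> `|x| by exact: norm_continuous.
  by move=> /cvgr_gt; apply; exact: lt_le_trans sx.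
by apply: filterS => y /ltW/vf.
Qed.

(** By translation invariance the differences f(x + v) - f(x) integrate to 0. With v of length h in
    direction [i], h times the derivative differs from them by O(h^2), uniformly on a fixed ball;
    divide by h and let h tend to 0. *)
Lemma vint_pderiv f i (r : R) : smooth_on setT f -> vanish_out r f -> vint (pderiv i f) = 0.
Proof.
move=> sf vf0; pose q : R := `|r| + 1.
have q0 : 0 < q by rewrite ltr_pwDr.
have vf : vanish_out q f.
  by apply: vanish_outW vf0; rewrite (le_trans (ler_norm _))// lerDl.
have qq : q < q + 1 by rewrite ltrDl.
have vp j : vanish_out (q + 1) (pderiv j f) by exact: vanish_out_pderiv vf.
have sp := smooth_pderiv i sf.
have cf := smooth_continuous sf; have cp := smooth_continuous sp.
have [M M0 HM] : exists2 M : R, 0 <= M & forall x, `|pderiv i (pderiv i f) x| <= M.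
  have cK : compact [set x : V | `|x - 0| <= q + 1 + 1] by exact: closed_ball_compact.
  have [M M0 HM] := smooth_bounded (smooth_pderiv i sp) cK (@subsetT _ _).
  exists M => // x; have [xq|qx] := leP `|x - 0| (q + 1 + 1); first exact: HM.
  have vpp : vanish_out (q + 1 + 1) (pderiv i (pderiv i f)).
    by apply: vanish_out_pderiv (vp i); rewrite ltrDl.
  by rewrite vpp ?normr0//; rewrite subr0 in qx; exact: ltW.
set W := vint (ball_bump 0 (q + 1)).
have key (h : R) : 0 < h -> h <= 1 -> `|vint (pderiv i f)| <= h * (M * W).
  move=> h0 h1; pose v : V := h *: delta_mx 0 i.
  have nv : `|v| <= 1.
    rewrite normrZ gtr0_norm// -[leRHS]mulr1; apply: ler_pM => //; first exact: ltW.
    exact: norm_delta_row.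
  have cfv := continuous_translate (h := v) cf.
  have vfv : vanish_out (q + 1) (fun x => f (x + v)).
    move=> x xq; apply: vf; rewrite -(lerD2r 1); apply: le_trans xq _.
    rewrite -{1}(addrK v x); apply: le_trans (ler_normB _ _) _; exact: lerD.
  have vf1 : vanish_out (q + 1) f by apply: vanish_outW vf; rewrite lerDl.
  pose g x := -1 * f (x + v) + f x.
  have cg : continuous g.
    by apply: continuous_add cf; exact: continuous_scale.
  have vg : vanish_out (q + 1) g by move=> x xq; rewrite /g (vf1 x xq) (vfv x xq) mulr0 addr0.
  have g0 : vint g = 0.
    by rewrite (vint_linear _ cfv cf vfv vf1) (vint_translate _ cf vf) mulN1r addNr.
  have E : vint (fun x => h * pderiv i f x + g x) = h * vint (pderiv i f).
    by rewrite (vint_linear _ cp cg (vp i) vg) g0 addr0.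
  rewrite -(ler_pM2l h0) -{1}(gtr0_norm h0) -normrM -E !mulrA.
  apply: vint_bound; first by rewrite ltr_pwDr// ltW.
  - by apply: continuous_add cg; exact: continuous_scale.
  - by move=> x xq; rewrite (vp i)// (vg x xq) mulr0 addr0.
  move=> x; have := difference_quotient_bound x (ltW h0) sf HM.
  by rewrite opprB (addrC (f x)) -mulN1r mulrA.
apply/eqP; rewrite -normr_le0; apply/ler_addgt0Pr => /= e e0; rewrite add0r.
have W0 : 0 <= W by apply: Rintegral_ge0 => x _; exact: ball_bump_ge0.
pose D : R := M * W + 1; have D0 : 0 < D by rewrite ltr_pwDr// mulr_ge0.
pose h : R := Num.min 1 (e / D).
have h0 : 0 < h by rewrite lt_min ltr01 divr_gt0.
have h1 : h <= 1 by rewrite ge_min lexx.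
apply: le_trans (key h h0 h1) _; apply: (@le_trans _ _ (h * D)).
  by rewrite ler_pM2l// lerDl.
by rewrite -ler_pdivlMr// ge_min lexx orbT.
Qed.

End integral_compact_support.

(** * Weak limits of distributions *)

Section weak_limits.
Context {R : realType} {d : nat}.
Local Notation C := R[i].
Local Notation V := 'rV[R]_d.
Local Notation Re := complex.Re.
Local Notation Im := complex.Im.
Local Notation normc := Normc.normc.
Local Notation partials f s := (foldr pderiv f s).
Implicit Types (Om : opens R d) (K : set V).

Lemma partials_ReD Om (u v : test Om) s x :
  partials (fun y => Re ((u + v : test Om) y)) s x =
  partials (fun y => Re (u y)) s x + partials (fun y => Re (v y)) s x.
Proof.
rewrite -(partialsD _ (@openT _) (test_smooth u).1 (test_smooth v).1)//.
by congr (foldr _ _ _ _); apply/funext => y; exact: CReD.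
Qed.

Lemma partials_ImD Om (u v : test Om) s x :
  partials (fun y => Im ((u + v : test Om) y)) s x =
  partials (fun y => Im (u y)) s x + partials (fun y => Im (v y)) s x.
Proof.
rewrite -(partialsD _ (@openT _) (test_smooth u).2 (test_smooth v).2)//.
by congr (foldr _ _ _ _); apply/funext => y; exact: CImD.
Qed.

Lemma partials_ReB Om (u v : test Om) s x :
  partials (fun y => Re ((u - v : test Om) y)) s x =
  partials (fun y => Re (u y)) s x - partials (fun y => Re (v y)) s x.
Proof. by have := partials_ReD (u - v) v s x; rewrite subrK => ->; rewrite addrK. Qed.

Lemma partials_ImB Om (u v : test Om) s x :
  partials (fun y => Im ((u - v : test Om) y)) s x =
  partials (fun y => Im (u y)) s x - partials (fun y => Im (v y)) s x.
Proof. by have := partials_ImD (u - v) v s x; rewrite subrK => ->; rewrite addrK. Qed.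

Lemma deriv_leD m (a b : R) Om (u v : test Om) :
  deriv_le m a setT u -> deriv_le m b setT v -> deriv_le m (a + b) setT (u + v : test Om).
Proof.
move=> Hu Hv s x sm _; rewrite partials_ReD partials_ImD.
have [? ?] := Hu s x sm I; have [? ?] := Hv s x sm I.
by split; apply: le_trans (ler_normD _ _) _; exact: lerD.
Qed.

Lemma deriv_leW m n (a b : R) (P : set V) (f : V -> C) : (m <= n)%N -> a <= b ->
  deriv_le n a P f -> deriv_le m b P f.
Proof.
move=> mn ab H s x sm Px; have [? ?] := H s x (leq_trans sm mn) Px.
by split; exact: le_trans ab.
Qed.

Lemma support_setB Om (u v : test Om) K : closed K ->
  support_set u `<=` K -> support_set v `<=` K -> support_set (u - v : test Om) `<=` K.
Proof.
move=> cK uK vK; rewrite (closure_id K).1//; apply: closureS => x /=.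
apply: contraPP => Kx; have ux : u x = 0 by apply: support0 => /uK.
have vx : v x = 0 by apply: support0 => /vK.
by rewrite -[_ x]/(u x - v x) ux vx subrr eqxx.
Qed.

Lemma support_setD Om (u v : test Om) K : closed K ->
  support_set u `<=` K -> support_set v `<=` K -> support_set (u + v : test Om) `<=` K.
Proof.
move=> cK uK vK; rewrite (closure_id K).1//; apply: closureS => x /=.
apply: contraPP => Kx; have ux : u x = 0 by apply: support0 => /uK.
have vx : v x = 0 by apply: support0 => /vK.
by rewrite -[_ x]/(u x + v x) ux vx addr0 eqxx.
Qed.

(** Nested intervals: the limit is the supremum of the lower bounds [u l - b l], all of which are
    below every [u k + b k]. *)
Lemma cauchy_bound_limit (u b : nat -> R) k0 : (forall k, 0 <= b k) ->
  (forall k l, (k0 <= k)%N -> (k <= l)%N -> `|u l - u k| <= b k) ->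
  exists g, forall k, (k0 <= k)%N -> `|g - u k| <= b k.
Proof.
move=> b0 H; pose E : set R := [set u l - b l | l in [set l | (k0 <= l)%N]].
have ub k : (k0 <= k)%N -> ubound E (u k + b k).
  move=> k0k _ [l /= k0l <-]; case: (leqP k l) => [kl|/ltnW lk].
    have := H k l k0k kl; rewrite ler_norml => /andP[_]; have := b0 l.
    by rewrite lerBlDr => ? ?; lra.
  have := H l k k0l lk; rewrite ler_norml => /andP[+ _]; have := b0 k.
  by move=> ? ?; lra.
have E0 : E !=set0 by exists (u k0 - b k0); exists k0 => /=.
have hs : has_sup E by split => //; exists (u k0 + b k0); exact: ub.
exists (sup E) => k k0k; rewrite ler_norml; apply/andP; split.
  have : u k - b k <= sup E by apply: sup_upper_bound => //; exists k.
  by move=> ?; lra.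
have : sup E <= u k + b k by apply: ge_sup => //; exact: ub.
by move=> ?; lra.
Qed.

(** Completeness of D_K in quantitative form. The orders [m k] are unbounded, so every derivative is
    eventually controlled, and the halving of [e] bounds all the changes after step k by [e k]. *)
Lemma test_space_complete Om K (S : nat -> test Om) (m : nat -> nat) (e : nat -> R) :
  compact K -> K `<=` Om -> (forall k, support_set (S k) `<=` K) ->
  (forall k, (k <= m k)%N) -> (forall k, (m k <= m k.+1)%N) ->
  (forall k, 0 < e k) -> (forall k, e k.+1 <= e k / 2) ->
  (forall k, deriv_le (m k) (e k / 2) setT (S k.+1 - S k : test Om)) ->
  exists2 S' : test Om, support_set S' `<=` K &
    forall k, deriv_le (m k) (e k) setT (S' - S k : test Om).
Proof.
move=> cK KO sS km mm e0 e2 dS.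
have mle k l : (k <= l)%N -> (m k <= m l)%N.
  by move=> kl; rewrite -(subnKC kl); elim: (l - k)%N => [|n IH]; rewrite ?addn0// addnS (leq_trans IH).
(* The term - [e l] makes the induction work: a step of size [e l / 2] is at most [e l - e l.+1]. *)
have tele k l : (k <= l)%N -> deriv_le (m k) (e k - e l) setT (S l - S k : test Om).
  move=> kl; rewrite -(subnKC kl); elim: (l - k)%N => [|n IH].
    rewrite addn0 !subrr => s x sm _.
    rewrite -(subrr (S k)) partials_ReB partials_ImB !subrr normr0; split; exact: lexx.
  rewrite addnS.
  have -> : S (k + n).+1 - S k = (S (k + n)%N - S k) + (S (k + n).+1 - S (k + n)%N).
    by rewrite [RHS]addrC addrA subrK.
  have kn : (m k <= m (k + n))%N by exact/mle/leq_addr.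
  have := deriv_leD IH (deriv_leW kn (lexx _) (dS (k + n)%N)).
  apply: deriv_leW => //; have := e2 (k + n)%N; move=> ?; lra.
have tele' k l : (k <= l)%N -> deriv_le (m k) (e k) setT (S l - S k : test Om).
  by move=> kl; apply: deriv_leW (tele k l kl) => //; rewrite gerBl ltW.
have emono i j : (i <= j)%N -> e j <= e i.
  move=> ij; rewrite -(subnKC ij); elim: (j - i)%N => [|n IH]; first by rewrite addn0.
  rewrite addnS; apply: le_trans (e2 _) _; apply: le_trans _ IH.
  by rewrite ler_pdivrMr// ler_pMr// ler1n.
have small (a : R) : 0 < a -> exists N, forall n, (N <= n)%N -> e n <= a.
  move=> a0; have eN n : e n <= e 0%N / 2 ^+ n.
    elim: n => [|n IH]; first by rewrite expr0 divr1.
    by apply: le_trans (e2 n) _; rewrite exprSr invfM mulrA ler_pM2r// invr_gt0.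
  have [n Hn] := exists_inv_nat_lt (divr_gt0 a0 (e0 0%N)).
  exists n => k nk; apply: le_trans (emono _ _ nk) _.
  apply: le_trans (eN n) _; rewrite mulrC -ler_pdivlMr//.
  apply: le_trans _ (ltW Hn); rewrite lef_pV2 ?posrE ?exprn_gt0// -natrX ler_nat.
  exact: ltn_expl.
(* [p] stands for the real or the imaginary part. The limits [G] of all derivatives are first found
   pointwise; [smooth_limit] then shows that they are the derivatives of one function. *)
have lim_of (p : C -> R) :
    (forall k l s x, (k <= l)%N -> (size s <= m k)%N ->
      `|partials (fun y => p (S l y)) s x - partials (fun y => p (S k y)) s x| <= e k) ->
    (forall k, smooth_on setT (fun y => p (S k y))) -> p 0 = 0 ->
    exists g : V -> R, [/\ smooth_on setT g,
      forall k s x, (size s <= m k)%N ->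
        `|partials g s x - partials (fun y => p (S k y)) s x| <= e k &
      forall x, ~ K x -> g x = 0].
  move=> cau sp p0.
  have /choice[G HG] (sx : seq 'I_d * V) : exists g, forall k, (size sx.1 <= k)%N ->
      `|g - partials (fun y => p (S k y)) sx.1 sx.2| <= e k.
    apply: cauchy_bound_limit => [k|k l sk kl]; first exact: ltW.
    by apply: cau => //; exact: leq_trans (km k).
  have [sG GE] : smooth_on setT (fun x => G ([::], x)) /\
      forall s, partials (fun x => G ([::], x)) s = fun x => G (s, x).
    apply: (@smooth_limit _ _ (fun n y => p (S n y)) (fun s x => G (s, x))) => // s a a0.
    have [N HN] := small a a0.
    exists (maxn N (size s)) => n; rewrite geq_max => /andP[Nn sn] x.
    by rewrite distrC; apply: le_trans (HG (s, x) n sn) (HN _ Nn).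
  exists (fun x => G ([::], x)); split => //.
    move=> k s x sk; rewrite GE; apply/ler_addgt0Pr => /= a a0.
    have [N HN] := small a a0; pose l := maxn (maxn N k) (size s).
    have Nl : (N <= l)%N by rewrite /l !leq_max leqnn.
    have kl : (k <= l)%N by rewrite /l !leq_max leqnn orbT.
    have sl : (size s <= l)%N by rewrite /l leq_maxr.
    rewrite (addrC (e k)) (_ : _ - _ = (G (s, x) - partials (fun y => p (S l y)) s x) +
      (partials (fun y => p (S l y)) s x - partials (fun y => p (S k y)) s x)); last first.
      by rewrite addrA subrK.
    apply: le_trans (ler_normD _ _) _; apply: lerD; last exact: cau.
    exact: le_trans (HG (s, x) l sl) (HN _ Nl).
  move=> x Kx; apply/eqP; rewrite -normr_le0; apply/ler_addgt0Pr => /= a a0.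
  have [N HN] := small a a0; rewrite add0r; apply: le_trans (HN _ (leqnn N)).
  have := HG ([::], x) N (leq0n _); rewrite /= (_ : S N x = 0) ?p0 ?subr0//.
  by apply: support0 => /sS.
have [||gr [sgr gr1 gr0]] := lim_of (@complex.Re R) _ _ erefl.
- by move=> k l s x kl sk; rewrite -partials_ReB; exact: (tele' k l kl s x sk I).1.
- by move=> k; exact: (test_smooth (S k)).1.
have [||gi [sgi gi1 gi0]] := lim_of (@complex.Im R) _ _ erefl.
- by move=> k l s x kl sk; rewrite -partials_ImB; exact: (tele' k l kl s x sk I).2.
- by move=> k; exact: (test_smooth (S k)).2.
pose g : V -> C := fun x => gr x +i* gi x.
have [|cg sg] := @support_compact _ _ g K cK.
  by move=> x Kx; rewrite /g gr0// gi0.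
have gt : (g : V -> C^o) \in is_test Om.
  by apply/is_testP; split; [split|exact: cg|exact: subset_trans KO].
exists (Test gt) => // k s x sk _; rewrite partials_ReB partials_ImB.
by split; [exact: gr1|exact: gi1].
Qed.

(* Gliding hump: if T were of infinite order on K, one could pick test functions
   phi_k with rapidly decreasing derivatives and indices n_k such that T_(n_k) is
   large on the partial sum S_k of the phi_k, and by continuity of T_(n_k) also on
   all later ones.  The limit S of the S_k is a test function, but T_n S is unbounded. *)
Lemma weak_cvg_Dprime Om (Tn : nat -> Dstar Om) (T : Dstar Om) :
  (forall n, Dprime Om (Tn n)) -> weak_cvg Tn T -> Dprime Om T.
Proof.
move=> HTn cT; apply/DprimeP => K cK KO; apply: contrapT => nT.
have clK : closed K by apply: compact_closed => //; exact: norm_hausdorff.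
have normc_ge0 (z : C) : 0 <= normc z by rewrite -lecR; exact: (@normr_ge0 C C).
have normcB (z w : C) : normc z - normc w <= normc (z - w).
  by rewrite lerBlDr -{1}(subrK w z); exact: le_normcD.
have unbounded m (r A : R) : 0 < r -> 0 <= A -> exists phi : test Om,
    [/\ support_set phi `<=` K, deriv_le m r setT phi & A < normc (T phi)].
  move=> r0 A0; apply: contrapT => H; apply: nT; exists m, ((A + 1) / r).
  split; first by rewrite divr_gt0// ltr_pwDr.
  move=> phi e e0 sphi le; rewrite leNgt; apply/negP => lt; apply: H.
  have a0 : 0 < r / e by rewrite divr_gt0.
  exists ((r / e)%:C *: phi); split.
  - apply: subset_trans sphi; apply: support_set_subset => x /= p0.
    by rewrite -[_ x]/((r / e)%:C * phi x) p0 mulr0.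
  - by have := deriv_leZ (ltW a0) le; rewrite divfK// gt_eqF.
  rewrite linearZ /= -[X in normc X]/((r / e)%:C * T phi) Normc.normcM /=.
  rewrite expr0n addr0 sqrtr_sqr (gtr0_norm a0).
  apply: (@lt_trans _ _ (A + 1)); first by rewrite ltrDl.
  rewrite mulrC -ltr_pdivrMr// invf_div.
  by move: lt; rewrite -mulrA (mulrC r^-1).
have near_T phi (a : R) : 0 < a -> exists N, forall n, (N <= n)%N -> normc (Tn n phi - T phi) <= a.
  move=> a0; have a0C : 0 < a%:C :> C^o by rewrite ltcR.
  have /cvgrPdist_le/(_ _ a0C)[N _ HN] := cT phi.
  by exists N => n /HN; rewrite -normrN opprB lecR.
(* A state (S, m, e, n) consists of a partial sum, the order and the radius of a ball about it that
   will contain the limit, and the index n of a functional that is large on this ball. *)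
pose valid (st : test Om * nat * R * nat) := 0 < st.1.2 /\ support_set st.1.1.1 `<=` K.
pose rel k (st st' : test Om * nat * R * nat) :=
  [/\ (st.1.1.2 <= st'.1.1.2)%N, (k.+1 <= st'.1.1.2)%N, st'.1.2 <= st.1.2 / 2,
     deriv_le st.1.1.2 (st.1.2 / 2) setT (st'.1.1.1 - st.1.1.1 : test Om) &
     forall psi : test Om, support_set psi `<=` K ->
       deriv_le st'.1.1.2 st'.1.2 setT (psi - st'.1.1.1 : test Om) ->
       k%:R < normc (Tn st'.2 psi)].
have /choice[F HF] (p : nat * (test Om * nat * R * nat)) :
    exists st', valid p.2 -> valid st' /\ rel p.1 p.2 st'.
  case: p => k [[[S m] e] n0] /=.
  have [|nv] := pselect (valid (S, m, e, n0)); last by exists (S, m, e, n0).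
  move=> [/= e0 sS]; have e20 : 0 < e / 2 by rewrite divr_gt0.
  (* The margin 2 pays for two errors of at most 1: from [T] to [Tn n] at the new sum [S'], and from
     [S'] to any [psi] in the ball about it. *)
  have [phi [sphi le ge]] := unbounded m _ (normc (T S) + k%:R + 2) e20
    (addr_ge0 (addr_ge0 (normc_ge0 _) (ler0n _ _)) (ler0n _ 2)).
  pose S' : test Om := S + phi.
  have [n Hn] := near_T S' 1 ltr01; have := Hn _ (leqnn n) => {}Hn.
  have /DprimeP/(_ K cK KO)[m1 [c1 [c10 Hc1]]] := HTn n.
  (* Order k + 1 ensures that every derivative is eventually controlled; order [m1] and radius 1 /
     c1 make [Tn n] vary by at most 1 from the centre of the ball. *)
  pose m' := maxn (maxn m k.+1) m1; pose e' : R := Num.min (e / 2) (1 / c1).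
  have e'0 : 0 < e' by rewrite lt_min e20 divr_gt0.
  have sS' : support_set S' `<=` K by exact: support_setD.
  exists (S', m', e', n) => _; split; first by split.
  split=> /=.
  - by rewrite /m' !leq_max leqnn.
  - by rewrite /m' !leq_max leqnn orbT.
  - by rewrite ge_min lexx.
  - by rewrite /S' addrC addKr.
  move=> psi spsi le'.
  have B1 : normc (Tn n (psi - S')) <= 1.
    apply: le_trans (_ : _ <= c1 * e') _.
      apply: Hc1 => //; first exact: support_setB.
      by apply: deriv_leW le' => //; rewrite /m' leq_maxr.
    by rewrite mulrC -ler_pdivlMr// ge_min lexx orbT.
  rewrite linearB in B1.
  have B2 : normc (T S') - normc (Tn n S') <= 1.
    apply: le_trans (normcB _ _) _; apply: le_trans _ Hn.
    by rewrite -[X in normc X <= _]opprB normcN.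
  have B3 : normc (Tn n S') - normc (Tn n psi) <= 1.
    apply: le_trans (normcB _ _) _; apply: le_trans _ B1.
    by rewrite -[X in normc X <= _]opprB normcN.
  have B4 : normc (T phi) - normc (T S) <= normc (T S').
    apply: le_trans (_ : _ <= normc (T phi - - T S)) _.
      by rewrite -(normcN (T S)); exact: normcB.
    by rewrite opprK /S' linearD addrC.
  move: B2 B3 B4 ge; move: (normc _) (normc _) (normc _) (normc _) (normc _) => *; lra.
pose s := fix s k := if k is k'.+1 then F (k', s k') else (0 : test Om, 0%N, 1 : R, 0%N).
have Hs k : valid (s k).
  elim: k => [|k IH] /=; last by have [] := HF (k, s k) IH.
  split=> //=; have [//|_] := @support_compact _ _ (0 : test Om) set0 (@compact0 _).
  by move=> s0 x /s0.
have Hr k : rel k (s k) (s k.+1) by have [] := HF (k, s k) (Hs k).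
have [|k|k|k|k|k|S sS HS] := @test_space_complete Om K (fun k => (s k).1.1.1)
  (fun k => (s k).1.1.2) (fun k => (s k).1.2) cK KO _ _ _ _ _ _.
- by move=> k; exact: (Hs k).2.
- by case: k => [//|k]; have [] := Hr k.
- by have [] := Hr k.
- exact: (Hs k).1.
- by have [] := Hr k.
- by have [] := Hr k.
have Tbig k : k%:R < normc (Tn (s k.+1).2 S).
  by have [_ _ _ _ H] := Hr k; apply: H => //; exact: HS.
have [N HN] := near_T S 1 ltr01.
pose M : R := \sum_(n < N) normc (Tn n S) + (normc (T S) + 1).
have M0 : 0 <= M by rewrite addr_ge0 ?addr_ge0// sumr_ge0.
have bM n : normc (Tn n S) <= M.
  have [nN|Nn] := ltnP n N.
    rewrite /M (bigD1 (Ordinal nN))//= -addrA lerDl.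
    by rewrite addr_ge0 ?sumr_ge0// addr_ge0.
  apply: (@le_trans _ _ (normc (T S) + 1)); last by rewrite /M lerDr sumr_ge0.
  by rewrite -lerBlDl; apply: le_trans (normcB _ _) (HN _ Nn).
have := lt_le_trans (Tbig (Num.bound M)) (bM _).
by rewrite ltNge (ltW (archi_boundP M0)).
Qed.

End weak_limits.

(** * Locally integrable functions as distributions of order zero *)

Lemma norm_Rintegral_le (R : realType) (dT : measure_display) (T : measurableType dT)
  (mu : {measure set T -> \bar R}) (D K : set T) (g h : T -> R) (e : R) :
  measurable D -> measurable K -> K `<=` D -> measurable_fun D g -> measurable_fun K h ->
  (forall x, ~ K x -> g x = 0) -> (forall x, 0 <= h x) -> 0 <= e ->
  (forall x, K x -> `|g x| <= e * h x) ->
  (\int[mu]_(x in K) (h x)%:E < +oo)%E ->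
  `|\int[mu]_(x in D) g x| <= e * fine (\int[mu]_(x in K) (h x)%:E)%E.
Proof.
move=> mD mK KD mg mh g0 h0 e0 gh hoo.
have mEg : measurable_fun D (EFin \o g) by exact/measurable_EFinP.
have hfin : (\int[mu]_(x in K) (h x)%:E)%E \is a fin_num.
  by rewrite ge0_fin_numE//; apply: integral_ge0 => x _; rewrite lee_fin.
have gK : (\int[mu]_(x in D) `|(g x)%:E| <= e%:E * \int[mu]_(x in K) (h x)%:E)%E.
  have -> : (\int[mu]_(x in D) `|(g x)%:E| = \int[mu]_(x in K) `|(g x)%:E|)%E.
    rewrite -[in RHS](setIidr KD) integral_mkcondr; apply: eq_integral => x _.
    rewrite patchE; case: ifPn => // /negP xK; rewrite g0 ?abse0//.
    by move=> Kx; apply: xK; exact/mem_set.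
  rewrite -ge0_integralZl//=; last 2 first.
  - exact/measurable_EFinP.
  - by move=> x _; rewrite lee_fin.
  apply: ge0_le_integral => //.
  - have mgK : measurable_fun K g by exact: measurable_funS mg.
    by apply/measurable_EFinP; apply: measurableT_comp mgK.
  - by apply/measurable_EFinP; apply: measurable_funM.
have : (`|\int[mu]_(x in D) (g x)%:E| <= e%:E * \int[mu]_(x in K) (h x)%:E)%E.
  by apply: le_trans gK; exact: le_abse_integral.
rewrite /Rintegral -(fineK hfin); case: (\int[mu]_(x in D) (g x)%:E)%E => [r||] //=.
Qed.

Lemma measurable_normc (R : realType) (dT : measure_display) (T : measurableType dT)
  (D : set T) (f : T -> R[i]) : measurable_fun D (fun x => complex.Re (f x)) ->
  measurable_fun D (fun x => complex.Im (f x)) ->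
  measurable_fun D (fun x => Normc.normc (f x)).
Proof.
move=> mr mi; have ms : measurable_fun setT (@Num.sqrt R).
  by apply: continuous_measurable_fun; exact: sqrt_continuous.
pose q := (fun x => complex.Re (f x)) \* (fun x => complex.Re (f x)) \+
  (fun x => complex.Im (f x)) \* (fun x => complex.Im (f x)).
rewrite (_ : (fun x => Normc.normc (f x)) = @Num.sqrt R \o q).
  by apply: measurableT_comp ms _; apply: measurable_funD; exact: measurable_funM.
by apply/funext => x; rewrite /q /=; case: (f x) => a b /=; rewrite !expr2.
Qed.

Section locally_integrable.
Context {R : realType} {d : nat}.
Local Notation C := R[i].
Local Notation V := 'rV[R]_d.
Local Notation Re := complex.Re.
Local Notation Im := complex.Im.
Local Notation normc := Normc.normc.
Local Notation lam := (@lebesgueRn R d).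
Local Notation lebesgue_type := (caratheodory_type (@lebesgue_outer_measure R d)).
Implicit Types (Om : opens R d) (K : set V).

Lemma schwartz_image_Dprime Om (T : Dstar Om) : schwartz_image Om T -> Dprime Om T.
Proof.
move=> [f [mr mi fK] TE]; apply/DprimeP => K cK KO.
have mOm : measurable (oset Om : set lebesgue_type) by exact/open_caratheodory/oset_open.
have mK : measurable (K : set lebesgue_type).
  by apply: closed_caratheodory; apply: compact_closed => //; exact: norm_hausdorff.
have mn : measurable_fun (K : set lebesgue_type) ((fun x => normc (f x)) : lebesgue_type -> R).
  by apply: measurable_normc; [exact: measurable_funS mr|exact: measurable_funS mi].
pose c := fine (\int[lam]_(x in K) (normc (f x))%:E)%E.
have n0 (z : C) : 0 <= normc z by rewrite -lecR; exact: (@normr_ge0 C C).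
have c0 : 0 <= c by rewrite fine_ge0// integral_ge0// => x _; rewrite lee_fin.
(* The modulus of phi is at most 2e, and the real and imaginary parts of the integral are each at
   most 2ec; the summand 1 ensures positivity. *)
exists 0%N, (4 * c + 1); split; first by rewrite ltr_pwDr// mulr_ge0.
move=> phi e e0 sphi le; have cp := test_smooth phi.
have phi0 x : ~ K x -> phi x = 0 by move=> Kx; apply: support0 => /sphi.
have mpr := continuous_lebesgue_measurable mOm (smooth_continuous cp.1).
have mpi := continuous_lebesgue_measurable mOm (smooth_continuous cp.2).
have nfp x : normc (f x * phi x) <= e * 2 * normc (f x).
  rewrite Normc.normcM mulrC; apply: ler_wpM2r => //.
  apply: le_trans (normc_le_ReIm _) _; rewrite mulr_natr mulr2n.
  by have [] := le [::] x (leq0n _) I => /= ? ?; exact: lerD.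
have e2 : 0 <= e * 2 by rewrite mulr_ge0// ltW.
have Hr : `|\int[lam]_(x in Om) Re (f x * phi x)| <= e * 2 * c.
  refine (norm_Rintegral_le mOm mK KO _ mn _ (fun x => n0 (f x)) e2 _ (fK K cK KO)).
  - under eq_fun do rewrite CReM.
    by apply: measurable_funB; exact: measurable_funM.
  - by move=> x /phi0 ->; rewrite mulr0.
  - by move=> x _; apply: le_trans (norm_Re_le _) (nfp x).
have Hi : `|\int[lam]_(x in Om) Im (f x * phi x)| <= e * 2 * c.
  refine (norm_Rintegral_le mOm mK KO _ mn _ (fun x => n0 (f x)) e2 _ (fK K cK KO)).
  - under eq_fun do rewrite CImM.
    by apply: measurable_funD; exact: measurable_funM.
  - by move=> x /phi0 ->; rewrite mulr0.
  - by move=> x _; apply: le_trans (norm_Im_le _) (nfp x).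
rewrite TE; apply: le_trans (normc_le_ReIm _) _; apply: le_trans (lerD Hr Hi) _.
rewrite mulrDl mul1r; apply: (@le_trans _ _ (4 * c * e)); last by rewrite lerDl ltW.
by rewrite (_ : e * 2 * c + e * 2 * c = 4 * c * e)//; ring.
Qed.

End locally_integrable.

(** * Regularization by Landau kernels *)

Section landau.
Context {R : realType} {d : nat}.
Local Notation V := 'rV[R]_d.
Local Notation partials f s := (foldr pderiv f s).
Implicit Types (A K : set V) (x y z : V) (f g : V -> R) (k : V -> V -> R).

(** Smooth kernels of finite rank. They are closed under sums and products, so they include the
    polynomials in the coordinates of x - y. *)
Definition separable k := exists (I : finType) (u v : I -> V -> R),
  (forall a, smooth_on setT (u a) /\ smooth_on setT (v a)) /\
  forall x y, k x y = \sum_a u a y * v a x.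

Lemma separable_mul_fun f g : smooth_on setT f -> smooth_on setT g ->
  separable (fun x y => g y * f x).
Proof.
move=> sf sg; exists unit, (fun=> g), (fun=> f); split=> // x y.
by rewrite (big_pred1 tt)// => -[].
Qed.

Lemma separableD k1 k2 : separable k1 -> separable k2 ->
  separable (fun x y => k1 x y + k2 x y).
Proof.
move=> [I [u [v [s E]]]] [J [u' [v' [s' E']]]].
exists (I + J)%type, (fun a => match a with inl i => u i | inr j => u' j end),
  (fun a => match a with inl i => v i | inr j => v' j end).
by split=> [[a|a]//|x y]; rewrite big_sumType /= E E'.
Qed.

Lemma separableM k1 k2 : separable k1 -> separable k2 ->
  separable (fun x y => k1 x y * k2 x y).
Proof.
move=> [I [u [v [s E]]]] [J [u' [v' [s' E']]]].
exists (I * J)%type, (fun a => u a.1 \* u' a.2), (fun a => v a.1 \* v' a.2).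
split=> [[a b]|x y] /=.
  have [? ?] := s a; have [? ?] := s' b.
  by split; apply: smoothM => //; exact: openT.
rewrite E E' big_distrlr /= pair_big /=; apply: eq_bigr => -[a b] _ /=.
by rewrite mulrACA.
Qed.

Lemma separable_sum I (r : seq I) (F : I -> V -> V -> R) :
  (forall i, separable (F i)) -> separable (fun x y => \sum_(i <- r) F i x y).
Proof.
move=> H; elim: r => [|i r IH].
  have [I0 [u [v [s E]]]] := separable_mul_fun (@smooth_cst R d setT 0) (@smooth_cst R d setT 0).
  by exists I0, u, v; split=> // x y; rewrite -E big_nil mulr0.
have [I0 [u [v [s E]]]] := separableD (H i) IH.
by exists I0, u, v; split=> // x y; rewrite -E big_cons.
Qed.

Definition landau (c : R) z : R := 1 - c * \sum_i z 0 i ^+ 2.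

Lemma separable_landau c n : separable (fun x y => landau c (x - y) ^+ n).
Proof.
have s1 : smooth_on setT (fun _ : V => 1 : R) by exact: smooth_cst.
have sl : separable (fun x y => landau c (x - y)).
  have sc : separable (fun x y : V => - c * 1) by apply: separable_mul_fun; exact: smooth_cst.
  have s0 := separable_mul_fun s1 s1.
  have sd i : separable (fun x y => (x - y) 0 i).
    have sx : separable (fun x y : V => 1 * x 0 i).
      by apply: (separable_mul_fun (f := fun x : V => x 0 i)) => //; exact: smooth_coord.
    have sy : separable (fun x y : V => y 0 i * -1).
      by apply: (separable_mul_fun (g := fun x : V => x 0 i));
        [exact: smooth_cst|exact: smooth_coord].
    have [I0 [u [v [s E]]]] := separableD sx sy.
    by exists I0, u, v; split=> // x y; rewrite -E !mxE mul1r mulrN1.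
  have [I0 [u [v [s E]]]] := separableD s0 (separableM sc
    (separable_sum (index_enum 'I_d) (fun i => separableM (sd i) (sd i)))).
  exists I0, u, v; split=> // x y; rewrite -E /landau mulr1 mulr1 mulNr.
  by congr (_ - _ * _); apply: eq_bigr => i _; rewrite expr2.
elim: n => [|n IH].
  have [I0 [u [v [s E]]]] := separable_mul_fun s1 s1.
  by exists I0, u, v; split=> // x y; rewrite -E mulr1 expr0.
have [I0 [u [v [s E]]]] := separableM sl IH.
by exists I0, u, v; split=> // x y; rewrite -E exprS.
Qed.

Lemma smooth_landau c n : smooth_on setT (fun z => landau c z ^+ n).
Proof.
have [I0 [u [v [s E]]]] := separable_landau c n.
rewrite (_ : (fun z => _) = fun z => \sum_a u a 0 * v a z); last first.
  by apply/funext => z; rewrite -E subr0.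
apply: smooth_sum => [|a]; first exact: openT.
by apply: smoothM; [exact: openT|exact: smooth_cst|exact: (s a).2].
Qed.

Lemma landauN c z : landau c (- z) = landau c z.
Proof. by congr (1 - _ * _); apply: eq_bigr => i _; rewrite mxE sqrrN. Qed.

Lemma pderiv_even f i z : differentiable f z -> (forall z, f (- z) = f z) ->
  pderiv i f (- z) = - pderiv i f z.
Proof.
move=> df fN; rewrite -mulN1r -(derive_scale (-1) _ df) scaleN1r /pderiv /derive.
rewrite (_ : (fun h : R => _) = fun h : R => h^-1 *: ((f \o shift z) (h *: - delta_mx 0 i) - f z)) //.
by apply/funext => h /=; rewrite fN -(fN (h *: _ + _)) opprD opprK scalerN.
Qed.

(** The kernel is neither truncated nor normalized, in order to remain a polynomial. The formula is
    a good approximation only when y and the support of [g] lie in a ball adapted to [c]. *)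
Definition landau_conv c n g y : R := vint (fun x => landau c (x - y) ^+ n * g x).

Lemma smooth_translate A f z : smooth_on setT f -> smooth_on A (fun x => f (x + z)).
Proof.
move=> sf; have E s : partials (fun x => f (x + z)) s = fun x => partials f s (x + z).
  elim: s => //= i s ->; apply/funext => x; exact: derive_translate.
by move=> s x _; rewrite E; apply: differentiable_translate; exact: sf.
Qed.

Lemma vint_sum I (s : seq I) (c : I -> R) (F : I -> V -> R) (r : R) :
  (forall a, smooth_on setT (F a) /\ vanish_out r (F a)) ->
  vint (fun x => \sum_(a <- s) c a * F a x) = \sum_(a <- s) c a * vint (F a).
Proof.
move=> H; elim: s => [|a s IH].
  by under eq_fun do rewrite big_nil; rewrite big_nil /vint /Rintegral integral0.
under eq_fun do rewrite big_cons.
rewrite big_cons -IH; have [sa va] := H a.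
rewrite (vint_linear _ (smooth_continuous sa) _ va)//.
  apply: smooth_continuous; apply: smooth_sum => [|b]; first exact: openT.
  by apply: smoothM; [exact: openT|exact: smooth_cst|exact: (H b).1].
by move=> x xr; rewrite big1// => b _; rewrite (H b).2// mulr0.
Qed.

Lemma landau_conv_sum c n (I : finType) (u v : I -> V -> R) g (r : R) y :
  (forall a, smooth_on setT (v a)) -> smooth_on setT g -> vanish_out r g ->
  (forall x y, landau c (x - y) ^+ n = \sum_a u a y * v a x) ->
  landau_conv c n g y = \sum_a u a y * vint (v a \* g).
Proof.
move=> sv sg vg E; rewrite -(@vint_sum _ _ _ _ r) => [|a]; last first.
  split; first by apply: smoothM => //; exact: openT.
  by move=> x xr /=; rewrite vg// mulr0.
congr vint; apply/funext => x; rewrite E mulr_suml.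
by apply: eq_bigr => a _; rewrite /= mulrA.
Qed.

Lemma smooth_landau_conv c n g (r : R) : smooth_on setT g -> vanish_out r g ->
  smooth_on setT (landau_conv c n g).
Proof.
move=> sg vg; have [I [u [v [s E]]]] := separable_landau c n.
rewrite (funext (fun y => landau_conv_sum y (fun a => (s a).2) sg vg E)).
apply: smooth_sum => [|a]; first exact: openT.
by apply: smoothM; [exact: openT|exact: (s a).1|exact: smooth_cst].
Qed.

(** The derivative in y falls on the finitely many factors [u a]. Summed up, it is minus the
    derivative of the kernel in x, which [vint_pderiv] moves to [g]. *)
Lemma pderiv_landau_conv c n g (r : R) i : smooth_on setT g -> vanish_out r g ->
  pderiv i (landau_conv c n g) = landau_conv c n (pderiv i g).
Proof.
move=> sg vg; have [I [u [v [s E]]]] := separable_landau c n.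
have su a := (s a).1; have sv a := (s a).2.
have oT : open [set: V] by exact: openT.
pose w a := vint (v a \* g).
have convE : landau_conv c n g = fun y => \sum_a w a * u a y.
  apply/funext => y; rewrite (landau_conv_sum y sv sg vg E).
  by apply: eq_bigr => a _; rewrite mulrC.
have swu a : smooth_on setT (fun y => w a * u a y).
  by apply: smoothM => //; exact: smooth_cst.
apply/funext => y; rewrite convE -[LHS]/(partials (fun y => \sum_a w a * u a y) [:: i] y).
rewrite (partials_sum _ _ oT)//; under eq_bigr do rewrite (partialsZ _ _ oT)// mulrC /=.
pose U x := landau c x ^+ n; have sU : smooth_on setT U by exact: smooth_landau.
have UN x : U (- x) = U x by rewrite /U landauN.
(* Evenness of [U] writes the kernel as U (y - x), a translate of [U] in y, and turns the derivative
   at y - x into minus the one at x - y. *)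
have dE x : \sum_a pderiv i (u a) y * v a x = - pderiv i U (x - y).
  transitivity (pderiv i (fun y => U (y - x)) y).
    rewrite (_ : (fun y => U (y - x)) = fun y => \sum_a v a x * u a y).
      rewrite -[RHS]/(partials (fun y => \sum_a v a x * u a y) [:: i] y) (partials_sum _ _ oT)//.
        by apply: eq_bigr => a _; rewrite (partialsZ _ _ oT)//= mulrC.
      by move=> a; apply: smoothM => //; exact: smooth_cst.
    apply/funext => z; rewrite -UN opprB /U E.
    by apply: eq_bigr => a _; rewrite mulrC.
  rewrite [LHS]derive_translate -opprB; apply: pderiv_even => //; exact: (sU [::]).
rewrite -(@vint_sum _ _ _ _ r) => [|a]; last first.
  split; first exact: smoothM.
  by move=> x xr /=; rewrite vg// mulr0.
pose k x := U (x - y); have sk : smooth_on setT k by exact: smooth_translate.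
have r1 : r < r + 1 by rewrite ltrDl.
have skg : smooth_on setT (k \* g) by exact: smoothM.
have vkg : vanish_out r (k \* g) by move=> x xr /=; rewrite vg// mulr0.
have Z0 := vint_pderiv i skg vkg.
have sp := smooth_pderiv i skg.
have vp : vanish_out (r + 1) (pderiv i (k \* g)) by exact: vanish_out_pderiv vkg.
have sA : smooth_on setT (k \* pderiv i g) by apply: smoothM => //; exact: smooth_pderiv.
have vA : vanish_out (r + 1) (k \* pderiv i g).
  by move=> x xr /=; rewrite (vanish_out_pderiv i r1 vg xr) mulr0.
have := vint_linear (-1) (smooth_continuous sp) (smooth_continuous sA) vp vA.
rewrite Z0 mulr0 add0r => ZA; apply: etrans _ ZA.
congr vint; apply/funext => x.
rewrite pderivM; [|exact: (sk [::])|exact: (sg [::])].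
rewrite /= mulN1r opprD addrAC addNr add0r.
transitivity ((\sum_a pderiv i (u a) y * v a x) * g x).
  by rewrite mulr_suml; apply: eq_bigr => a _; rewrite mulrA.
have -> : pderiv i k x = pderiv i U (x - y) by exact: derive_translate.
by rewrite dE mulNr mulrC.
Qed.

(** The normalizing constant. The cut-off [b] is needed for integrability and will be 1 at all the
    differences x - y that occur. *)
Definition landau_mass c n (b : V -> R) : R := vint (fun z => landau c z ^+ n * b z).

Lemma vanish_out_partials f K (r : R) s : compact K -> (forall x, K x -> `|x| < r) ->
  (forall x, ~ K x -> f x = 0) -> vanish_out r (partials f s).
Proof.
move=> cK Kr f0 x xr; have oK : open (~` K).
  by apply: closed_openC; apply: compact_closed => //; exact: norm_hausdorff.
have Kx : (~` K) x by move=> /Kr; rewrite ltNge xr.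
rewrite (@partials_local _ _ _ f (fun=> 0) s oK) ?inE//.
  suff -> : partials (fun _ : V => 0 : R) s = fun=> 0 by [].
  by elim: s => //= i s ->; apply/funext => z; exact: derive_cst.
by move=> y /set_mem /f0 ->.
Qed.

Lemma vintZ f (a r : R) : smooth_on setT f -> vanish_out r f ->
  vint (fun x => a * f x) = a * vint f.
Proof.
move=> sf vf; have := vint_linear a (smooth_continuous sf)
  (@cst_continuous _ _ (0 : R)) vf (fun _ _ => erefl 0).
have -> : vint (fun _ : V => 0 : R) = 0 by rewrite /vint /Rintegral integral0.
by rewrite addr0 => <-; congr vint; apply/funext => x; rewrite addr0.
Qed.

Lemma vint_norm_le f g (r : R) : smooth_on setT f -> smooth_on setT g ->
  vanish_out r f -> vanish_out r g -> (forall x, `|f x| <= g x) -> `|vint f| <= vint g.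
Proof.
move=> sf sg vf vg fg; have sNg : smooth_on setT (fun x => -1 * g x).
  by apply: smoothM => //; [exact: openT|exact: smooth_cst].
have vNg : vanish_out r (fun x => -1 * g x) by move=> x /vg ->; rewrite mulr0.
rewrite ler_norml -mulN1r -(vintZ (-1) sg vg); apply/andP; split.
  apply: (vint_le (smooth_continuous sNg) (smooth_continuous sf) vNg vf) => x.
  by rewrite mulN1r; have := fg x; rewrite ler_norml => /andP[].
apply: (vint_le (smooth_continuous sf) (smooth_continuous sg) vf vg) => x.
by have := fg x; rewrite ler_norml => /andP[].
Qed.

Lemma smooth_vanish_bounded f (r : R) : smooth_on setT f -> vanish_out r f ->
  exists2 M : R, 0 <= M & forall x, `|f x| <= M.
Proof.
move=> sf vf; have cK : compact [set x : V | `|x - 0| <= r] by exact: closed_ball_compact.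
have [M M0 HM] := smooth_bounded sf cK (@subsetT _ _).
exists M => // x; have [xq|qx] := leP `|x - 0| r; first exact: HM.
by rewrite vf ?normr0//; rewrite subr0 in qx; exact: ltW.
Qed.

Lemma smooth_vanish_lipschitz f (r : R) : smooth_on setT f -> vanish_out r f ->
  exists2 M : R, 0 <= M & forall x y, `|f x - f y| <= M * `|x - y|.
Proof.
move=> sf vf; have r1 : r < r + 1 by rewrite ltrDl.
have /choice[M HM] i := (exists2P _ _).1
  (smooth_vanish_bounded (smooth_pderiv i sf) (vanish_out_pderiv i r1 vf)).
have M0 : 0 <= \sum_i M i by apply: sumr_ge0 => i _; have [] := HM i.
exists (d%:R * \sum_i M i); first by rewrite mulr_ge0.
move=> x y; have df z : differentiable f z by exact: (sf [::]).
have [c _] := mean_value_line y (x - y) df.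
rewrite (addrC y) subrK => ->; rewrite derive_sum_pderiv//.
apply: norm_dot_row_le => i; have [_ H] := HM i; apply: le_trans (H _) _.
by rewrite (bigD1 i)//= lerDl; apply: sumr_ge0 => j _; have [] := HM j.
Qed.

(* The value of c keeps the kernel nonnegative on the ball of radius 4N.  There,
   in the sup norm, it is at most (1 - c dl^2)^n outside of the ball of radius dl,
   but at least (1 - c d dl'^2)^n on the ball of radius dl' = dl / (d + 1), and the
   quotient of these two bounds tends to 0. *)
Lemma landau_approx g (N : R) : 0 < N -> smooth_on setT g -> vanish_out N g ->
  let c := ((d%:R + 1) * (4 * N) ^+ 2)^-1 in
  let J n := landau_mass c n (ball_bump 0 (2 * N)) in
  forall e : R, 0 < e -> exists n0, forall n, (n0 <= n)%N -> forall y, `|y| <= N ->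
    `|(J n)^-1 * landau_conv c n g y - g y| <= e.
Proof.
move=> N0 sg vg c J; pose b : V -> R := ball_bump 0 (2 * N).
have d1 : 0 < d%:R + 1 :> R by rewrite ltr_pwDr.
have M0 : 0 < 4 * N by rewrite mulr_gt0.
have c0 : 0 < c by rewrite invr_gt0 mulr_gt0// exprn_gt0.
have cE : c * ((d%:R + 1) * (4 * N) ^+ 2) = 1 by rewrite mulVf// gt_eqF// mulr_gt0// exprn_gt0.
have N2 : 0 < 2 * N by rewrite mulr_gt0.
have sb : smooth_on setT b by apply: smooth_ball_bump; exact: openT.
have b0 z : 4 * N <= `|z| -> b z = 0.
  by move=> zN; rewrite /b ball_bump0 ?subr0// mulrA -natrM.
have b1 z : `|z| <= 2 * N -> b z = 1 by move=> zN; rewrite /b ball_bump1 ?subr0.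
have bge0 z : 0 <= b z by exact: ball_bump_ge0.
have sum_le z (a : R) : `|z| <= a -> \sum_i z 0 i ^+ 2 <= d%:R * a ^+ 2.
  move=> za; rewrite -[X in X%:R](card_ord d) mulr_natl -sumr_const.
  apply: ler_sum => i _; rewrite -real_normK ?num_real// ler_pXn2r ?nnegrE//.
    exact: le_trans (norm_coord_le _ _) za.
  exact: le_trans za.
have sum_ge z (a : R) : 0 < a -> a <= `|z| -> a ^+ 2 <= \sum_i z 0 i ^+ 2.
  move=> a0 az; have [i zi] : exists i, a <= `|z 0 i|.
    apply: contrapT => /forallNP H; move: az; apply/negP; rewrite -ltNge.
    by apply: norm_row_lt => // i; rewrite ltNge; apply/negP; exact: H.
  rewrite (bigD1 i)//= -(real_normK (num_real (z 0 i))) ler_wpDr//.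
    by apply: sumr_ge0 => j _; exact: sqr_ge0.
  by rewrite ler_pXn2r ?nnegrE// ltW.
have u0 z : `|z| <= 4 * N -> 0 <= landau c z.
  move=> zN; rewrite subr_ge0 -[leRHS]cE ler_pM2l//; apply: le_trans (sum_le _ _ zN) _.
  by rewrite ler_wpM2r ?sqr_ge0// lerDl.
have ub0 n z : 0 <= landau c z ^+ n * b z.
  have [zN|/ltW zN] := leP `|z| (4 * N); last by rewrite b0// mulr0.
  by rewrite mulr_ge0// exprn_ge0// u0.
have svK n : smooth_on setT (fun z => landau c z ^+ n * b z).
  by apply: smoothM => //; [exact: openT|exact: smooth_landau].
have vK n : vanish_out (4 * N) (fun z => landau c z ^+ n * b z).
  by move=> z zN; rewrite b0// mulr0.
have vb : vanish_out (4 * N) b by [].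
(* On the ball of radius [dl] the kernel is at least r2^n; [beta] is the integral of a bump carried
   by this ball. *)
have lower (dl : R) : 0 < dl -> dl <= 2 * N -> let r2 := 1 - c * (d%:R * dl ^+ 2) in
    exists2 beta : R, 0 < beta & forall n, 0 <= r2 -> r2 ^+ n * beta <= J n.
  move=> dl0 dlN r2; pose b' := ball_bump (0 : V) (dl / 2).
  have dl2 : 0 < dl / 2 by rewrite divr_gt0.
  have sb' : smooth_on setT b' by apply: smooth_ball_bump; exact: openT.
  have b'0 z : dl <= `|z| -> b' z = 0.
    by move=> zd; rewrite /b' ball_bump0 ?subr0// mulrC divfK.
  have vb' : vanish_out (4 * N) b'.
    move=> z zN; apply: b'0; apply: le_trans dlN _; apply: le_trans zN.
    by rewrite ler_pM2r// ler_nat.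
  exists (vint b').
    apply: (@vint_gt0 _ _ b' 0 (dl / 2) (4 * N)) => //.
    - exact: smooth_continuous.
    - by move=> z; exact: ball_bump_ge0.
    - by move=> z zd; rewrite /b' ball_bump1.
  move=> n r20; rewrite -(vintZ _ sb' vb'); apply: (@vint_le _ _ _ _ (4 * N)).
  - by apply: continuous_scale; exact: smooth_continuous.
  - exact: smooth_continuous.
  - by move=> z zN; rewrite vb'// mulr0.
  - exact: vK.
  move=> z; have [dz|/ltW zd] := leP dl `|z|.
    by rewrite b'0// mulr0.
  have zN : `|z| <= 2 * N by exact: le_trans dlN.
  rewrite -/b b1// mulr1; apply: (@le_trans _ _ (r2 ^+ n)).
    by rewrite ler_piMr ?exprn_ge0// ball_bump_le1.
  have r2u : r2 <= landau c z by rewrite lerB// ler_pM2l// sum_le.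
  by rewrite lerXn2r// nnegrE// (le_trans r20).
have cN2 : c * (d%:R * N ^+ 2) < 1.
  rewrite -[ltRHS]cE ltr_pM2l// exprMn.
  apply: (@lt_le_trans _ _ ((d%:R + 1) * N ^+ 2)).
    by rewrite ltr_pM2r ?exprn_gt0// ltrDl.
  by rewrite ler_pM2l// ler_peMl ?sqr_ge0// -natrX ler1n.
have NN : N <= 2 * N by rewrite ler_pMl// ler1n.
have J0 n : 0 < J n.
  have [beta beta0 H] := lower N N0 NN.
  apply: lt_le_trans (H n _); last by rewrite subr_ge0 ltW.
  by rewrite mulr_gt0// exprn_gt0// subr_gt0.
move=> e e0.
have [G G0 HG] := smooth_vanish_bounded sg vg.
have [L L0 HL] := smooth_vanish_lipschitz sg vg.
(* Within distance [dl] the Lipschitz bound lets [g] vary by at most e / 2; the other half of [e] is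
   for the tail of the kernel. *)
pose dl : R := Num.min N (e / 2 / (L + 1)).
have L1 : 0 < L + 1 by rewrite ltr_pwDr.
have dl0 : 0 < dl by rewrite lt_min N0 !divr_gt0.
have dlN : dl <= N by rewrite ge_min lexx.
have Ldl : L * dl <= e / 2.
  apply: (@le_trans _ _ ((L + 1) * dl)); first by rewrite ler_pM2r// lerDl.
  by rewrite mulrC -ler_pdivlMr// ge_min lexx orbT.
pose dl' : R := dl / (d%:R + 1).
have dl'0 : 0 < dl' by rewrite divr_gt0.
have dl'd : dl' <= dl by rewrite ler_pdivrMr// ler_pMr// lerDr.
pose r1 : R := 1 - c * dl ^+ 2; pose r2 : R := 1 - c * (d%:R * dl' ^+ 2).
have dd : d%:R * dl' ^+ 2 < dl ^+ 2.
  rewrite /dl' expr_div_n mulrA ltr_pdivrMr ?exprn_gt0// mulrC ltr_pM2l ?exprn_gt0//.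
  by rewrite expr2; nra.
have r12 : r1 < r2 by rewrite /r1 /r2 ltrD2l ltrN2 ltr_pM2l.
have r10 : 0 <= r1.
  rewrite subr_ge0 -[leRHS]cE ler_pM2l//.
  apply: (@le_trans _ _ (1 * N ^+ 2)).
    by rewrite mul1r ler_pXn2r ?nnegrE// ltW.
  rewrite exprMn; apply: ler_pM => //; first exact: sqr_ge0.
    by rewrite lerDr.
  by rewrite ler_peMl ?sqr_ge0// -natrX ler1n.
have r20 : 0 < r2 by exact: le_lt_trans r12.
have [beta beta0 Hbeta] := lower dl' dl'0 (le_trans dl'd (le_trans dlN NN)).
pose B := vint b; have B0 : 0 <= B by apply: Rintegral_ge0 => z _; exact: bge0.
pose A : R := 2 * G * B; have A0 : 0 <= A by rewrite !mulr_ge0.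
have [n0 Hn0] : exists n0, forall n, (n0 <= n)%N -> A * (r1 / r2) ^+ n <= e / 2 * beta.
  have q1 : `|r1 / r2| < 1.
    by rewrite ger0_norm ?divr_ge0// ?ltW// ltr_pdivrMr// mul1r.
  have a0 : 0 < e / 2 * beta / (A + 1) by rewrite !divr_gt0// ?mulr_gt0 ?divr_gt0// ltr_pwDr.
  have /cvgr0Pnorm_le/(_ _ a0)[n0 _ H] := cvg_expr q1.
  exists n0 => n /H /= Hn; have := le_trans (ler_norm _) Hn.
  rewrite ler_pdivlMr ?ltr_pwDr// mulrC; apply: le_trans.
  by rewrite ler_wpM2r ?lerDl// exprn_ge0// divr_ge0// ltW.
exists n0 => n n0n y yN.
pose k x := landau c (x - y) ^+ n * b (x - y).
have sk : smooth_on setT k by exact: (@smooth_translate _ _ (- y) (svK n)).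
(* Since y has norm at most N, a point of norm at least 5N is at distance at least 4N from y. *)
have vtr (h : V -> R) : vanish_out (4 * N) h -> vanish_out (5 * N) (fun x => h (x - y)).
  move=> vh x xN; apply: vh; have := ler_normB (x - y) (- y).
  by rewrite opprK subrK normrN => ?; lra.
have vk : vanish_out (5 * N) k by exact: vtr (vK n).
have vg5 : vanish_out (5 * N) g by apply: vanish_outW vg; rewrite ler_pMl// ler1n.
have oT : open [set: V] by exact: openT.
have skg : smooth_on setT (k \* g) by exact: smoothM.
have vkg : vanish_out (5 * N) (k \* g) by move=> x xN /=; rewrite vg5// mulr0.
pose bt x := b (x - y).
have sbt : smooth_on setT bt by exact: (@smooth_translate _ _ (- y) sb).
have vbt : vanish_out (5 * N) bt by exact: vtr vb.
pose w x := 2 * G * r1 ^+ n * bt x.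
have sw : smooth_on setT w by apply: smoothM => //; exact: smooth_cst.
have vw : vanish_out (5 * N) w by move=> x xN; rewrite /w vbt// mulr0.
have skk : smooth_on setT (fun x => - g y * k x + (k \* g) x).
  by apply: smoothD => //; apply: smoothM => //; exact: smooth_cst.
have sbd : smooth_on setT (fun x => e / 2 * k x + w x).
  by apply: smoothD => //; apply: smoothM => //; exact: smooth_cst.
have vkk : vanish_out (5 * N) (fun x => - g y * k x + (k \* g) x).
  by move=> x xN; rewrite vk// vkg// mulr0 addr0.
have vbd : vanish_out (5 * N) (fun x => e / 2 * k x + w x).
  by move=> x xN; rewrite vk// vw// mulr0 addr0.
(* Near y the Lipschitz bound applies; away from y the kernel is at most r1^n and [g] varies by at
   most 2G, which is the term [w]. *)
have ptw x : `|- g y * k x + (k \* g) x| <= e / 2 * k x + w x.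
  have -> : - g y * k x + (k \* g) x = k x * (g x - g y).
    by rewrite mulrBr mulNr addrC (mulrC (g y)).
  have k0 : 0 <= k x by exact: ub0.
  have w0 : 0 <= w x by apply: mulr_ge0; [apply: mulr_ge0; [exact: mulr_ge0|exact: exprn_ge0]|exact: bge0].
  rewrite normrM (ger0_norm k0); have [xd|dx] := leP `|x - y| dl.
    apply: ler_wpDr => //; rewrite mulrC ler_wpM2r//.
    apply: le_trans (HL x y) _; apply: le_trans _ Ldl; exact: ler_wpM2l.
  have [Nx|/ltW xN] := leP (4 * N) `|x - y|.
    by rewrite /w /bt /k b0// !mulr0 mul0r add0r.
  apply: ler_wpDl; first by rewrite mulr_ge0// divr_ge0// ltW.
  have g2 : `|g x - g y| <= 2 * G.
    apply: le_trans (ler_normB _ _) _; rewrite mulrC mulr_natr mulr2n; exact: lerD.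
  rewrite /w mulrC -mulrA; apply: ler_pM => //.
  rewrite /k; apply: ler_wpM2r; first exact: bge0.
  have u1 : landau c (x - y) <= r1 by rewrite lerB// ler_pM2l// sum_ge// ltW.
  by rewrite lerXn2r// nnegrE// u0.
(* Where [g] is nonzero, x - y lies in the ball of radius 2N, on which the cut-off is 1: truncating
   the kernel leaves the convolution unchanged. *)
have kg x : landau c (x - y) ^+ n * g x = (k \* g) x.
  rewrite /k /=; have [xN|Nx] := leP N `|x|; first by rewrite vg// !mulr0.
  by rewrite b1 ?mulr1//; apply: le_trans (ler_normB _ _) _; lra.
have E1 : 2 * G * r1 ^+ n * B <= e / 2 * J n.
  have -> : 2 * G * r1 ^+ n * B = A * (r1 / r2) ^+ n * r2 ^+ n.
    by rewrite expr_div_n -[RHS]mulrA divfK ?expf_neq0 ?gt_eqF// /A mulrAC.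
  apply: (@le_trans _ _ (e / 2 * beta * r2 ^+ n)).
    by apply: ler_wpM2r; [rewrite exprn_ge0// ltW|exact: Hn0].
  rewrite -mulrA ler_pM2l ?divr_gt0// mulrC; apply: Hbeta; exact: ltW.
rewrite -(ler_pM2l (J0 n)) -{1}(gtr0_norm (J0 n)) -normrM mulrBr mulVKf ?gt_eqF//.
have JE : vint k = J n.
  by rewrite [LHS](vint_translate _ (smooth_continuous (svK n)) (vK n)).
have -> : landau_conv c n g y - J n * g y = vint (fun x => - g y * k x + (k \* g) x).
  rewrite (vint_linear _ (smooth_continuous sk) (smooth_continuous skg) vk vkg) JE.
  by rewrite mulNr addrC (mulrC (g y)) /landau_conv (funext kg).
apply: le_trans (vint_norm_le skk sbd vkk vbd ptw) _.
rewrite (vint_linear _ (smooth_continuous sk) (smooth_continuous sw) vk vw) JE.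
rewrite [X in _ + X](vintZ _ sbt vbt) [vint bt](vint_translate _ (smooth_continuous sb) vb).
by apply: le_trans (lerD (lexx _) E1) _; rewrite -mulrDl -splitr mulrC.
Qed.

End landau.

(** * Functionals with a smooth density *)

Lemma bounded_integral_lty (R : realType) (dT : measure_display) (T : measurableType dT)
  (mu : {measure set T -> \bar R}) (K : set T) (h : T -> R) (M : R) :
  measurable K -> (mu K < +oo)%E -> measurable_fun K h -> 0 <= M ->
  (forall x, 0 <= h x) -> (forall x, K x -> h x <= M) ->
  (\int[mu]_(x in K) (h x)%:E < +oo)%E.
Proof.
move=> mK muK mh M0 h0 hM; apply: (@le_lt_trans _ _ (\int[mu]_(x in K) M%:E)%E).
  apply: ge0_le_integral => //.
  - by move=> x _; rewrite lee_fin.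
  - exact/measurable_EFinP.
by rewrite integral_cst// lte_mul_pinfty.
Qed.

Section smooth_densities.
Context {R : realType} {d : nat}.
Local Notation C := R[i].
Local Notation V := 'rV[R]_d.
Local Notation Re := complex.Re.
Local Notation Im := complex.Im.
Local Notation normc := Normc.normc.
Local Notation lam := (@lebesgueRn R d).
Local Notation lebesgue_type := (caratheodory_type (@lebesgue_outer_measure R d)).
Local Notation partials f s := (foldr pderiv f s).
Implicit Types (Om : opens R d) (K : set V) (h : V -> C).

Lemma compact_norm_lt K : compact K -> exists2 N : R, 0 < N & forall x, K x -> `|x| < N.
Proof.
move=> /compact_bounded[M [_ HM]]; exists (Num.max (M + 1) 0 + 1).
  by rewrite ltr_pwDr// le_max lexx orbT.
move=> x Kx; apply: (@le_lt_trans _ _ (Num.max (M + 1) 0)); last by rewrite ltrDl.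
by rewrite le_max HM// ltrDl.
Qed.

(** A density smooth on the whole space, not only on [Om], keeps sums and cut-offs elementary and
    lets the integrals run over the whole space. *)
Definition smooth_density Om (T : Dstar Om) : Prop :=
  exists2 h, Csmooth_on setT h & forall phi, T phi = Cintegral Om (fun x => h x * phi x).

Lemma smooth_density_schwartz_image Om (T : Dstar Om) :
  smooth_density T -> schwartz_image Om T.
Proof.
move=> [h [sr si] TE]; have mOm : measurable (oset Om : set lebesgue_type).
  exact/open_caratheodory/oset_open.
exists h; last exact: TE.
have cr := smooth_continuous sr; have ci := smooth_continuous si.
split; [exact: continuous_lebesgue_measurable|exact: continuous_lebesgue_measurable|].
move=> K cK KO; have mK : measurable (K : set lebesgue_type).
  by apply: closed_caratheodory; apply: compact_closed => //; exact: norm_hausdorff.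
have n0 (z : C) : 0 <= normc z by rewrite -lecR; exact: (@normr_ge0 C C).
have [c1 c10 H1] := smooth_bounded sr cK (@subsetT _ K).
have [c2 c20 H2] := smooth_bounded si cK (@subsetT _ K).
refine (bounded_integral_lty mK _ _ (addr_ge0 c10 c20) (fun x => n0 (h x)) _).
- have [N _ KN] := compact_norm_lt cK.
  apply: le_lt_trans (lebesgue_outer_ball_lty N).
  by apply: le_lebesgue_outer => x /KN /ltW.
- by apply: measurable_normc; apply: continuous_lebesgue_measurable.
- by move=> x Kx; apply: le_trans (normc_le_ReIm _) _; apply: lerD; [exact: H1|exact: H2].
Qed.

Lemma test_vanish_out Om (phi : test Om) : exists r : R, forall x, r <= `|x| -> phi x = 0.
Proof.
have [N _ KN] := compact_norm_lt (test_support_compact (phi := phi)).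
exists N => x xN; apply: support0 => /KN; rewrite ltNge.
by rewrite xN.
Qed.

Lemma Cintegral_supported Om (g : V -> C) : (forall x, ~ oset Om x -> g x = 0) ->
  Cintegral Om g = Cintegral setT g.
Proof.
move=> g0; have mOm : measurable (oset Om : set lebesgue_type).
  exact/open_caratheodory/oset_open.
have E (f : V -> R) : (forall x, ~ oset Om x -> f x = 0) ->
    \int[lam]_(x in Om) f x = \int[lam]_(x in setT) f x.
  move=> f0; rewrite /Rintegral integral_mkcond; congr fine; apply: eq_integral => x _.
  rewrite patchE; case: ifPn => // /negP xO; rewrite f0// => Ox.
  by apply: xO; exact/mem_set.
by congr (_ +i* _); apply: E => x /g0 ->.
Qed.

Lemma Cintegral_linear (a : C) (g h : V -> C) (r : R) :
  Csmooth_on setT g -> Csmooth_on setT h ->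
  (forall x, r <= `|x| -> g x = 0) -> (forall x, r <= `|x| -> h x = 0) ->
  Cintegral setT (fun x => a * g x + h x) = a * Cintegral setT g + Cintegral setT h.
Proof.
move=> [gr gi] [hr hi] vg vh.
have vgr : vanish_out r (fun x => Re (g x)) by move=> x /vg ->.
have vgi : vanish_out r (fun x => Im (g x)) by move=> x /vg ->.
have vhr : vanish_out r (fun x => Re (h x)) by move=> x /vh ->.
have vhi : vanish_out r (fun x => Im (h x)) by move=> x /vh ->.
have lin (b c : R) (p q s : V -> R) : smooth_on setT p -> smooth_on setT q ->
    smooth_on setT s -> vanish_out r p -> vanish_out r q -> vanish_out r s ->
    vint (fun x => b * p x + (c * q x + s x)) = b * vint p + (c * vint q + vint s).
  move=> sp sq ss vp vq vs; rewrite -(vint_linear c (smooth_continuous sq) (smooth_continuous ss) vq vs).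
  apply: (vint_linear b (smooth_continuous sp) _ vp).
    apply: continuous_add; last exact: smooth_continuous.
    by apply: continuous_scale; exact: smooth_continuous.
  by move=> x xr; rewrite vq// vs// mulr0 addr0.
rewrite /Cintegral -![\int[lam]_(x in setT) _]/(vint _).
apply/eqP; rewrite eq_complex CReD CImD CReM CImM /=; apply/andP; split; apply/eqP.
  rewrite -addrA -mulNr -(lin _ _ _ _ _ gr gi hr vgr vgi vhr).
  by congr vint; apply/funext => x; rewrite CReD CReM mulNr addrA.
rewrite -addrA -(lin _ _ _ _ _ gi gr hi vgi vgr vhi).
by congr vint; apply/funext => x; rewrite CImD CImM addrA.
Qed.

Lemma Cintegral0 : Cintegral setT (fun _ : V => 0 : C) = 0.
Proof.
have v0 : vint (fun _ : V => 0 : R) = 0 by rewrite /vint /Rintegral integral0.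
by rewrite -[LHS]/(vint (fun=> 0) +i* vint (fun=> 0)) v0.
Qed.

Lemma Csmooth_sum I (s : seq I) (F : I -> V -> C) :
  (forall a, Csmooth_on setT (F a)) -> Csmooth_on setT (fun x => \sum_(a <- s) F a x).
Proof.
move=> sF; elim: s => [|a s IH].
  by under eq_fun do rewrite big_nil; exact: Csmooth_cst.
by under eq_fun do rewrite big_cons; apply: CsmoothD => //; exact: openT.
Qed.

Lemma Cintegral_sum I (s : seq I) (c : I -> C) (F : I -> V -> C) (r : R) :
  (forall a, Csmooth_on setT (F a)) -> (forall a x, r <= `|x| -> F a x = 0) ->
  Cintegral setT (fun x => \sum_(a <- s) c a * F a x) =
    \sum_(a <- s) c a * Cintegral setT (F a).
Proof.
move=> sF vF; elim: s => [|a s IH].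
  by under eq_fun do rewrite big_nil; rewrite big_nil; exact: Cintegral0.
under eq_fun do rewrite big_cons; rewrite big_cons -IH.
apply: (@Cintegral_linear _ _ _ r) => //.
- by apply: Csmooth_sum => b; apply: CsmoothM => //; [exact: openT|exact: Csmooth_cst].
- by move=> x xr; exact: vF.
by move=> x xr; rewrite big1// => b _; rewrite vF// mulr0.
Qed.

Lemma Csmooth_density_mul h Om (phi : test Om) : Csmooth_on setT h ->
  Csmooth_on setT (fun x => h x * phi x).
Proof. by move=> sh; apply: CsmoothM => //; [exact: openT|exact: test_smooth]. Qed.

Lemma test_integralE Om h (phi : test Om) :
  Cintegral Om (fun x => h x * phi x) = Cintegral setT (fun x => h x * phi x).
Proof.
apply: Cintegral_supported => x NO; rewrite (support0 (f := phi)) ?mulr0//.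
by move=> /test_support.
Qed.

Lemma smooth_density_exists Om h : Csmooth_on setT h ->
  exists T : Dstar Om, smooth_density T /\
    forall phi, T phi = Cintegral setT (fun x => h x * phi x).
Proof.
move=> sh; pose t (phi : test Om) : C^o := Cintegral setT (fun x => h x * phi x).
have tl : linear t.
  move=> a u v; have [r1 H1] := test_vanish_out u; have [r2 H2] := test_vanish_out v.
  rewrite /t -[RHS]/(a * _ + _) -(@Cintegral_linear _ _ _ (Num.max r1 r2)).
  - congr Cintegral; apply/funext => x.
    by rewrite [(a *: u + v) x]test_linE mulrDr mulrCA.
  - exact: Csmooth_density_mul.
  - exact: Csmooth_density_mul.
  - by move=> x; rewrite ge_max => /andP[/H1 -> _]; rewrite mulr0.
  - by move=> x; rewrite ge_max => /andP[_ /H2 ->]; rewrite mulr0.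
pose T : Dstar Om := HB.pack t (GRing.isLinear.Build _ _ _ _ _ tl).
by exists T; split=> //; exists h => // phi; rewrite test_integralE.
Qed.

Lemma smooth_density_dzero Om : smooth_density (dzero Om).
Proof.
exists (fun=> 0); first exact: Csmooth_cst.
move=> phi; rewrite test_integralE -[LHS]Cintegral0; congr Cintegral.
by apply/funext => x; rewrite mul0r.
Qed.

Lemma smooth_density_dadd Om (S T : Dstar Om) :
  smooth_density S -> smooth_density T -> smooth_density (Defs.dadd S T).
Proof.
move=> [f sf SE] [g sg TE]; exists (f \+ g).
  by apply: CsmoothD => //; exact: openT.
move=> phi; have [r Hr] := test_vanish_out phi.
rewrite /= SE TE !test_integralE -[X in X + _]mul1r -(@Cintegral_linear _ _ _ r).
- by congr Cintegral; apply/funext => x; rewrite mul1r /= mulrDl.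
- exact: Csmooth_density_mul.
- exact: Csmooth_density_mul.
- by move=> x /Hr ->; rewrite mulr0.
- by move=> x /Hr ->; rewrite mulr0.
Qed.

Lemma smooth_density_dsum Om (F : nat -> Dstar Om) n :
  (forall l, smooth_density (F l)) -> smooth_density (dsum F n).
Proof.
move=> HF; elim: n => [|n IH] /=; first exact: smooth_density_dzero.
exact: smooth_density_dadd.
Qed.

End smooth_densities.

(** * Approximation of distributions by smooth densities *)

Section regularization.
Context {R : realType} {d : nat}.
Local Notation C := R[i].
Local Notation V := 'rV[R]_d.
Local Notation Re := complex.Re.
Local Notation Im := complex.Im.
Local Notation normc := Normc.normc.
Local Notation partials f s := (foldr pderiv f s).
Implicit Types (Om : opens R d) (K : set V) (g : V -> R).

(** The error [err n g] commutes with derivatives by [pderiv_landau_conv], so [landau_approx]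
    applied to the derivatives of [g] gives all orders by induction. *)
Lemma landau_approx_partials K (N : R) : 0 < N -> compact K -> (forall x, K x -> `|x| < N) ->
  let c := ((d%:R + 1) * (4 * N) ^+ 2)^-1 in
  let J n := landau_mass c n (ball_bump (0 : V) (2 * N)) in
  forall m g (e : R), 0 < e -> smooth_on setT g -> (forall x, ~ K x -> g x = 0) ->
  exists n0, forall n, (n0 <= n)%N -> forall s y, (size s <= m)%N -> `|y| <= N ->
    `|partials (fun z => (J n)^-1 * landau_conv c n g z - g z) s y| <= e.
Proof.
move=> N0 cK KN c J; have oT : open [set: V] by exact: openT.
have oK : open (~` K).
  by apply: closed_openC; apply: compact_closed => //; exact: norm_hausdorff.
have vg g : (forall x, ~ K x -> g x = 0) -> vanish_out N g.
  by move=> g0; exact: (@vanish_out_partials _ _ g K N [::] cK KN g0).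
pose err n g z := (J n)^-1 * landau_conv c n g z - g z.
have derr n g i : smooth_on setT g -> (forall x, ~ K x -> g x = 0) ->
    pderiv i (err n g) = err n (pderiv i g).
  move=> sg /vg vNg; have sc := smooth_landau_conv c n sg vNg.
  have -> : err n g = (fun z => (J n)^-1 * landau_conv c n g z) \+ (fun z => -1 * g z).
    by apply/funext => z; rewrite /err /= mulN1r.
  apply/funext => z; rewrite /err -(pderiv_landau_conv c n i sg vNg).
  rewrite -[LHS]/(partials _ [:: i] z) (partialsD _ oT)//.
  - by rewrite !(partialsZ _ _ oT)//= mulN1r.
  - by apply: smoothM => //; exact: smooth_cst.
  - by apply: smoothM => //; exact: smooth_cst.
elim=> [|m IH] g e e0 sg g0.
  have [n0 H] := landau_approx N0 sg (vg _ g0) e0.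
  by exists n0 => n n0n [|//] y _ yN; exact: H.
have [n1 H1] := landau_approx N0 sg (vg _ g0) e0.
have /choice[F HF] i : exists n0, forall n, (n0 <= n)%N -> forall s y, (size s <= m)%N ->
    `|y| <= N -> `|partials (err n (pderiv i g)) s y| <= e.
  apply: IH => //; first exact: smooth_pderiv.
  move=> x Kx; rewrite (@pderiv_local _ _ _ g (fun=> 0) i oK) ?inE//.
    exact: derive_cst.
  by move=> z /set_mem /g0.
exists (maxn n1 (\max_i F i)) => n; rewrite geq_max => /andP[n1n Fn] s y.
case: (lastP s) => [_ yN|{}s i]; first exact: H1.
rewrite size_rcons ltnS => sm yN; rewrite foldr_rcons (derr n g i)//.
apply: HF => //; apply: leq_trans Fn; exact: leq_bigmax.
Qed.

Lemma complex_sum (I : Type) (s : seq I) (f g : I -> R) :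
  \sum_(a <- s) (f a +i* g a) = (\sum_(a <- s) f a) +i* (\sum_(a <- s) g a).
Proof.
by elim: s => [|a s IH]; rewrite ?big_nil// !big_cons IH.
Qed.

(** [D psi] and [T chi] are the same finite sum, of the T (zeta u_a) times the integrals of v_a psi:
    this is how [T] passes through the integral. *)
Lemma landau_pairing Om (T : Dstar Om) K (zeta : V -> R) c n (b : R) :
  smooth_on setT zeta -> compact K -> K `<=` Om -> (forall x, ~ K x -> zeta x = 0) ->
  exists D : Dstar Om, smooth_density D /\ forall psi : test Om, exists chi : test Om,
    D psi = T chi /\ forall y, chi y = (zeta y)%:C *
      ((b * landau_conv c n (fun x => Re (psi x)) y) +i*
       (b * landau_conv c n (fun x => Im (psi x)) y)).
Proof.
move=> sz cK KO z0; have oT : open [set: V] by exact: openT.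
have [I [u [v [s E]]]] := @separable_landau R d c n.
have sv a := (s a).2.
have szu a : smooth_on setT (zeta \* u a) by apply: smoothM => //; exact: (s a).1.
have zu0 a x : ~ K x -> (zeta \* u a) x = 0 by move=> /z0 /= ->; rewrite mul0r.
pose t a : test Om := Test (is_test_real (szu a) cK KO (zu0 a)).
pose h x := \sum_a (b%:C * T (t a)) * (v a x)%:C.
have sh : Csmooth_on setT h.
  apply: Csmooth_sum => a; apply: CsmoothM => //; first exact: Csmooth_cst.
  exact: Csmooth_real.
have [D [HD DE]] := smooth_density_exists Om sh.
exists D; split=> // psi; have [sr si] := test_smooth psi.
have [r Hr] := test_vanish_out psi.
have vr : vanish_out r (fun x => Re (psi x)) by move=> x /Hr ->.
have vi : vanish_out r (fun x => Im (psi x)) by move=> x /Hr ->.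
pose p a := vint (v a \* (fun x => Re (psi x))).
pose q a := vint (v a \* (fun x => Im (psi x))).
have IE a : Cintegral setT (fun x => (v a x)%:C * psi x) = p a +i* q a.
  rewrite /p /q /vint /Cintegral.
  congr (_ +i* _); apply: eq_Rintegral => x _ /=.
    by rewrite CReM /= mul0r subr0.
  by rewrite CImM /= mul0r addr0.
exists (\sum_a (b%:C * (p a +i* q a)) *: t a); split.
  rewrite DE linear_sum /=.
  have -> : (fun x => h x * psi x) = fun x =>
      \sum_a (b%:C * T (t a)) * ((v a x)%:C * psi x).
    by apply/funext => x; rewrite /h mulr_suml; apply: eq_bigr => a _; rewrite mulrA.
  rewrite (@Cintegral_sum _ _ _ _ _ _ r); last 2 first.
  - by move=> a; apply: Csmooth_density_mul; exact: Csmooth_real.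
  - by move=> a x /Hr ->; rewrite mulr0.
  by apply: eq_bigr => a _; rewrite linearZ /= IE mulrAC.
move=> y; rewrite test_sumE (landau_conv_sum y sv sr vr E) (landau_conv_sum y sv si vi E).
rewrite !mulr_sumr -complex_sum mulr_sumr; apply: eq_bigr => a _.
rewrite -[LHS]/(b%:C * (p a +i* q a) * (zeta y * u a y)%:C) -/(p a) -/(q a).
apply/eqP; rewrite eq_complex !CReM !CImM /=; apply/andP; split; apply/eqP.
  by rewrite !mulr0 !mul0r !subr0; ring.
by rewrite !mulr0 !mul0r !addr0 !add0r; ring.
Qed.

(** As zeta psi = psi, the error chi - psi is zeta times the error of the convolution. It therefore
    lives in D_K, where the estimate of [T] applies, and it has to be small on [K] only. *)
Lemma compact_regularization Om (T : Dstar Om) K (zeta : V -> R) :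
  Dprime Om T -> smooth_on setT zeta -> compact K -> K `<=` Om ->
  (forall x, ~ K x -> zeta x = 0) ->
  exists D : nat -> Dstar Om, (forall n, smooth_density (D n)) /\
    forall psi : test Om, (forall x, ~ K x -> psi x = 0) ->
    (forall x, (zeta x)%:C * psi x = psi x) ->
    forall e : R, 0 < e -> exists n0, forall n, (n0 <= n)%N -> normc (D n psi - T psi) <= e.
Proof.
move=> HT sz cK KO z0; have [N N0 KN] := compact_norm_lt cK.
have oT : open [set: V] by exact: openT.
pose c : R := ((d%:R + 1) * (4 * N) ^+ 2)^-1.
pose J n := landau_mass c n (ball_bump (0 : V) (2 * N)).
have /choice[D HD] n := landau_pairing T c n (J n)^-1 sz cK KO z0.
exists D; split=> [n|psi psi0 zpsi e e0]; first by have [] := HD n.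
have /DprimeP/(_ K cK KO)[m [c0 [c00 H0]]] := HT.
have [c1 c10 H1] := deriv_le_mul m oT (Csmooth_real sz) cK (@subsetT _ K).
have e1 : 0 < e / c0 / c1 by rewrite !divr_gt0.
have [sr si] := test_smooth psi.
have [n1 A1] := landau_approx_partials N0 cK KN m e1 sr
  (fun x Kx => congr1 (@complex.Re R) (psi0 x Kx)).
have [n2 A2] := landau_approx_partials N0 cK KN m e1 si
  (fun x Kx => congr1 (@complex.Im R) (psi0 x Kx)).
exists (maxn n1 n2) => n; rewrite geq_max => /andP[n1n n2n].
have [_ /(_ psi)[chi [-> chiE]]] := HD n.
pose k x := ((J n)^-1 * landau_conv c n (fun x => Re (psi x)) x - Re (psi x)) +i*
  ((J n)^-1 * landau_conv c n (fun x => Im (psi x)) x - Im (psi x)).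
have kE : ((chi - psi : test Om) : V -> C) = fun x => k x * (zeta x)%:C.
  apply/funext => x; rewrite -[LHS]/(chi x - psi x) chiE -{1}(zpsi x) -mulrBr mulrC.
  by congr (_ * _); rewrite /k; case: (psi x).
have [r Hr] := test_vanish_out psi.
have sk : Csmooth_on setT k.
  have sN (g : V -> R) : smooth_on setT g -> vanish_out r g ->
      smooth_on setT (fun x => (J n)^-1 * landau_conv c n g x - g x).
    move=> sg vg; apply: smoothD => //; last exact: smoothN.
    by apply: smoothM; [|exact: smooth_cst|exact: smooth_landau_conv vg].
  by split; apply: sN => // x /Hr ->.
rewrite -linearB; apply: (@le_trans _ _ (c0 * (c1 * (e / c0 / c1)))); last first.
  by rewrite (mulrC c1) divfK ?gt_eqF// mulrC divfK// gt_eqF.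
have kK x : ~ K x -> (chi - psi : test Om) x = 0.
  by move=> /z0 zx; rewrite kE zx mulr0.
have [_ sK] := support_compact cK kK.
apply: H0 => //; first by rewrite mulr_gt0.
apply: (deriv_le_support (K := K)) => //; first by rewrite ltW// mulr_gt0.
rewrite kE; apply: H1 => // s x sm Kx; have xN := ltW (KN _ Kx).
by split; [exact: A1|exact: A2].
Qed.

Lemma smooth_density_dmul Om (f : V -> R) (sf : smooth_on setT f) (T : Dstar Om) :
  smooth_density T ->
  smooth_density
    (Defs.dmul (Smoothfun (Csmooth_sub (@subsetT _ Om) (Csmooth_real sf))) T).
Proof.
move=> [h sh TE]; exists (fun x => h x * (f x)%:C).
  by apply: CsmoothM => //; [exact: openT|exact: Csmooth_real].
move=> phi; rewrite /= TE; congr Cintegral.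
by apply/funext => x; rewrite /= mulrA.
Qed.

Lemma normc_sum_le (I : Type) (s : seq I) (f : I -> C) :
  normc (\sum_(a <- s) f a) <= \sum_(a <- s) normc (f a).
Proof.
elim: s => [|a s IH]; first by rewrite !big_nil Normc.normc0.
by rewrite !big_cons; apply: le_trans (le_normcD _ _) _; rewrite lerD2l.
Qed.

Lemma Dprime_smooth_limit Om (T : Dstar Om) : Dprime Om T ->
  exists2 Tn : nat -> Dstar Om, (forall n, smooth_density (Tn n)) & weak_cvg Tn T.
Proof.
move=> HT.
(* The cover of [Om] by itself: what is wanted is local finiteness and compact supports. *)
have [||eta [zeta [sez supp ze fin]]] := @partition_of_unity R d Om unit (fun=> oset Om).
- by move=> _; exact: oset_open.
- by move=> x Ox; exists tt.
have se l := (sez l).1.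
have /choice[F HF] l : exists D : nat -> Dstar Om,
    [/\ forall n, smooth_density (D n),
       forall psi : test Om, (forall x, eta l x = 0 \/ psi x = 0) -> forall n, D n psi = 0 &
       forall (psi : test Om) (e : R), 0 < e -> exists n0, forall n, (n0 <= n)%N ->
         normc (D n psi - T (tscale (se l) psi)) <= e].
  have [e0|[_ [K [cK KO eK]]]] := supp l.
    exists (fun=> dzero Om); split=> [n||psi e e_gt0] //; first exact: smooth_density_dzero.
    exists 0%N => n _; have -> : tscale (se l) psi = 0.
      by apply: testP => x /=; rewrite e0 mul0r.
    by rewrite linear0 subr0 Normc.normc0 ltW.
  have [E [HE HE']] := compact_regularization HT (sez l).2 cK KO (fun x Kx => (eK x Kx).2).
  exists (fun n => Defs.dmul (Smoothfun (Csmooth_sub (@subsetT _ Om) (Csmooth_real (se l)))) (E n)).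
  split=> [n|psi H n|psi e e0].
  - exact: smooth_density_dmul.
  - rewrite /= -/(tscale (se l) psi) (_ : tscale _ _ = 0) ?linear0//.
    by apply: testP => x /=; have [->|->] := H x; rewrite ?mul0r ?mulr0.
  apply: (HE' (tscale (se l) psi)) => // x; first by move=> /eK[/= -> _]; rewrite mul0r.
  by rewrite /= mulrA -rmorphM ze.
exists (fun n => dsum (F^~ n) n) => [n|psi].
  by apply: smooth_density_dsum => l; have [] := HF l.
have [L HL] := fin _ (test_support_compact (phi := psi)) (test_support (phi := psi)).
have F0 l n : (L <= l)%N -> F l n psi = 0.
  move=> Ll; have [_ H _] := HF l; apply: H => x.
  by have [/HL[_ /(_ l Ll)]|/support0] := pselect (support_set psi x); [left|right].
apply/cvgrPdist_le => e e0.
have [r r0 ->] : exists2 r : R, 0 < r & e = r%:C.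
  by move: e0; case: e => a b; rewrite ltcE /= => /andP[/eqP -> a0]; exists a.
(* Only the L terms with l < L act on psi; L + 1 avoids a division by 0 when there are none. *)
have rL : 0 < r / L.+1%:R by rewrite divr_gt0.
have /choice[M HM] l : exists n0, forall n, (n0 <= n)%N ->
    normc (F l n psi - T (tscale (se l) psi)) <= r / L.+1%:R.
  by have [_ _ H] := HF l; exact: H.
exists (maxn L (\max_(l < L) M l)) => // n /=; rewrite geq_max => /andP[Ln Mn].
rewrite -normrN opprB lecR dsumE.
have -> : \sum_(l < n) F l n psi = \sum_(l < L) F l n psi.
  rewrite -!(big_mkord xpredT (fun l => F l n psi)) (@big_cat_nat _ _ _ L)//=.
  by rewrite [X in _ + X]big_nat_cond [X in _ + X]big1 ?addr0// => l /andP[/andP[/F0]].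
rewrite {2}(test_decomp se (fun x sx => (HL x sx).1)) linear_sum -sumrB.
apply: le_trans (normc_sum_le _ _) _.
apply: (@le_trans _ _ (\sum_(l < L) r / L.+1%:R)).
  by apply: ler_sum => l _; apply: HM; apply: leq_trans Mn; exact: leq_bigmax.
rewrite sumr_const card_ord -[X in X <= _]mulr_natr -mulrA ler_piMr ?(ltW r0)//.
by rewrite mulrC ler_pdivrMr// mul1r ler_nat.
Qed.

End regularization.

Theorem theorem9p1 (R : realType) (d : nat) :
  [/\ (* (i) *)
      forall Om : opens R d,
        Dprime Om = [set T : Dstar Om | exists2 Tn : nat -> Dstar Om,
          (forall n, schwartz_image Om (Tn n)) & weak_cvg Tn T],
      (* (ii) *)
      forall Om : opens R d,
        differential_submodule (Dprime Om) /\ differential_subspace (Dprime Om),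
      (* (iii) *)
      subsheaf_of_differential_modules
        (fun Om : opens R d => Dprime Om)
        (fun Om : opens R d => [set: Dstar Om]) /\
      (forall (Om : opens R d) (T : Dstar Om),
        Dprime Om T -> is_support T (dist_support T))
    & (* (iv) *)
      forall (X Y : opens R d) (theta : diffeo X Y) (T : Dstar X),
        Dprime X T -> Dprime Y (dpush theta T)].
Proof.
split; [|exact: differential_Dprime| |exact: Dprime_dpush]; last first.
  split; first exact: subsheaf_Dprime.
  by move=> Om T _; exact: is_support_dist_support.
move=> Om; apply/seteqP; split=> T /=.
  move=> /Dprime_smooth_limit[Tn HTn cT]; exists Tn => // n.
  exact: smooth_density_schwartz_image.
move=> [Tn HTn cT]; apply: weak_cvg_Dprime cT => n; exact: schwartz_image_Dprime.
Qed.
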